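(* Let $r\ge1$, $c\in\mathbb R\setminus\{0\}$ and $v_0\in H^1(\mathbb R)$. Then the Cauchy problem $$i\partial_tv+\partial_x^2v+e^{c|v|^r}v=0,\quad v(x,0)=v_0(x),\qquad x\in\mathbb R,$$ is locally well-posed in $H^1(\mathbb R)$.
   Context: All functions are complex valued on $\mathbb R$. $e^{it\partial_x^2}$ is the linear Schrödinger group (Fourier multiplier with symbol $e^{-it|\xi|^2}$). Solutions are understood in the sense of the integral (Duhamel) equation $v(t)=e^{it\partial_x^2}v_0+i\int_0^te^{i(t-\tau)\partial_x^2}\big(e^{c|v(\tau)|^r}v(\tau)\big)\,d\tau$. ''Locally well-posed in $H^1(\mathbb R)$'' means: for every $v_0\in H^1(\mathbb R)$ there exist $T>0$ and a unique solution $v\in C([-T,T],H^1(\mathbb R))$, and moreover there exist $T>0$ and a neighborhood $V$ of $v_0$ in $H^1(\mathbb R)$ such that the data-to-solution map from $V$ into $C([-T,T];H^1(\mathbb R))$ is continuous. *)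

(* Defs.v *)
From HB Require Import structures.
From mathcomp Require Import all_boot all_order all_algebra.
From mathcomp Require Import complex.
From mathcomp Require Import all_classical all_reals all_analysis.

Set Implicit Arguments.
Unset Strict Implicit.
Unset Printing Implicit Defensive.

Import Order.TTheory GRing.Theory Num.Theory.
Import numFieldNormedType.Exports.
Import Normc.

Local Open Scope classical_set_scope.
Local Open Scope ring_scope.
Local Open Scope complex_scope.

(* Elements of L^2(R) and H^1(R) are represented by Borel functions R -> R[i];
   two representatives are identified when they agree almost everywhere. *)

Section FunctionSpaces.
Context {R : realType}.
Implicit Types (u : R -> R[i]).

Notation mu := (@lebesgue_measure R).

Definition cmeasurable u :=
  measurable_fun setT (fun x => complex.Re (u x)) /\
  measurable_fun setT (fun x => complex.Im (u x)).

Definition cintegral (D : set R) u : R[i] :=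
  (\int[mu]_(x in D) complex.Re (u x)) +i* (\int[mu]_(x in D) complex.Im (u x)).

Definition L2norm u : \bar R := Lnorm mu 2%:E (fun x => (normc (u x))%:E).

Definition L2 u := cmeasurable u /\ (L2norm u < +oo)%E.

Definition test_function (phi : R -> R) :=
  (forall (n : nat) (x : R), derivable (phi^`(n))%classic x 1) /\
  (exists M : R, forall x, M < `|x| -> phi x = 0).

Definition weak_derivative u u' :=
  forall phi : R -> R, test_function phi ->
    cintegral setT (fun x => u x * ((phi^`()%classic x)%:C)) =
    - cintegral setT (fun x => u' x * (phi x)%:C).

Definition H1 u := L2 u /\ exists u', L2 u' /\ weak_derivative u u'.

(* The weak derivative of an element of H^1 (0 if u is not in H^1). *)
Definition wderiv u : R -> R[i] :=
  xget (fun=> 0) [set u' | L2 u' /\ weak_derivative u u'].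

(* Only meaningful on H^1: [fine] sends infinite values to 0. *)
Definition H1norm u : R :=
  Num.sqrt (fine (L2norm u) ^+ 2 + fine (L2norm (wderiv u)) ^+ 2).

Definition H1dist u (v : R -> R[i]) : R := H1norm (fun x => u x - v x).

Definition aeeq u (v : R -> R[i]) := u = v %[ae mu].

Definition expi (theta : R) : R[i] := cos theta +i* sin theta.

(* (2 pi)^(-1/2) * \int_{-n}^{n} e^{i s x xi} u(x) dx; s = -1 gives the Fourier
   transform and s = 1 its inverse. *)
Definition trunc_fourier (s : R) (n : nat) u (xi : R) : R[i] :=
  ((Num.sqrt (2 * pi))^-1)%:C *
  cintegral `[- n%:R, n%:R] (fun x => expi (s * x * xi) * u x).

(* The L^2 Fourier transform is the L^2 limit of the truncated integrals. *)
Definition is_fourier (s : R) u g :=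
  L2 g /\
  L2norm (fun xi => trunc_fourier s n u xi - g xi) @[n --> \oo] --> 0%E.

Definition fourier u : R -> R[i] := xget (fun=> 0) [set g | is_fourier (-1) u g].

Definition inv_fourier u : R -> R[i] := xget (fun=> 0) [set g | is_fourier 1 u g].

Definition schrodinger (t : R) u : R -> R[i] :=
  inv_fourier (fun xi => expi (- (t * xi ^+ 2)) * fourier u xi).

(* [x] lists the points of a subdivision of [a, b] after a; [xi k] is the tag of
   the k-th subinterval, whose endpoints are nth a (a :: x) k and nth a x k. *)
Definition tagged_partition (a b : R) (x : seq R) (xi : nat -> R) :=
  itv_partition a b x /\
  forall k, (k < size x)%N -> nth a (a :: x) k <= xi k <= nth a x k.

Definition mesh_lt (delta a : R) (x : seq R) :=
  forall k, (k < size x)%N -> nth a x k - nth a (a :: x) k < delta.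

Definition riemann_sum (g : R -> R -> R[i]) (a : R) (x : seq R) (xi : nat -> R)
    : R -> R[i] :=
  fun y => \sum_(k < size x) (nth a x k - nth a (a :: x) k)%:C * g (xi k) y.

(* For a <= b: the Riemann integral over [a, b] of an H^1-valued function, with
   convergence of the Riemann sums in H^1; for integrands continuous in H^1 it
   is the Bochner integral. *)
Definition is_H1_RInt (g : R -> R -> R[i]) (a b : R) (I : R -> R[i]) :=
  [/\ forall tau, a <= tau <= b -> H1 (g tau),
      H1 I &
      forall eps, 0 < eps -> exists2 delta, 0 < delta &
        forall x xi, tagged_partition a b x xi -> mesh_lt delta a x ->
          H1dist (riemann_sum g a x xi) I < eps].

Definition is_H1_integral (g : R -> R -> R[i]) (a b : R) (I : R -> R[i]) :=
  if a <= b then is_H1_RInt g a b I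
  else is_H1_RInt g b a (fun y => - I y).

Definition C_H1 (T : R) (v : R -> R -> R[i]) :=
  (forall t, t \in `[- T, T] -> H1 (v t)) /\
  (forall t, t \in `[- T, T] ->
     H1dist (v s) (v t) @[s --> within [set` `[- T, T]] (nbhs t)] --> 0).

(* v in C([-T, T], H^1) solves i v_t + v_xx + f(v) = 0, v(0) = v0, in the
   Duhamel sense. *)
Definition duhamel_solution (f : R[i] -> R[i]) (v0 : R -> R[i]) (T : R)
    (v : R -> R -> R[i]) :=
  C_H1 T v /\
  forall t, t \in `[- T, T] -> exists I : R -> R[i],
    is_H1_integral
      (fun tau => schrodinger (t - tau) (fun x => f (v tau x))) 0 t I /\
    aeeq (v t) (fun x => schrodinger t v0 x + (0 +i* 1) * I x).

Definition unique_duhamel_solution (f : R[i] -> R[i]) (v0 : R -> R[i]) (T : R)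
    (v : R -> R -> R[i]) :=
  duhamel_solution f v0 T v /\
  forall w, duhamel_solution f v0 T w ->
    forall t, t \in `[- T, T] -> aeeq (w t) (v t).

Definition H1_neighborhood (v0 : R -> R[i]) (V : set (R -> R[i])) :=
  V `<=` H1 /\
  exists2 rho : R, 0 < rho & forall w, H1 w -> H1dist w v0 < rho -> V w.

(* Continuity of a map from a subset V of H^1 to C([-T, T], H^1) with the sup
   norm. *)
Definition continuous_into_C_H1 (V : set (R -> R[i])) (T : R)
    (Phi : (R -> R[i]) -> R -> R -> R[i]) :=
  forall w, V w -> forall eps, 0 < eps -> exists2 delta, 0 < delta &
    forall w', V w' -> H1dist w' w < delta ->
      forall t, t \in `[- T, T] -> H1dist (Phi w' t) (Phi w t) < eps.

(* Local well-posedness in H^1 of i v_t + v_xx + f(v) = 0. *)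
Definition locally_well_posed_H1 (f : R[i] -> R[i]) :=
  forall v0, H1 v0 ->
    (exists T : R, 0 < T /\ exists v, unique_duhamel_solution f v0 T v) /\
    (exists T : R, 0 < T /\ exists V, H1_neighborhood v0 V /\
       exists Phi : (R -> R[i]) -> R -> R -> R[i],
         (forall w, V w -> unique_duhamel_solution f w T (Phi w)) /\
         continuous_into_C_H1 V T Phi).

Definition exp_nonlinearity (c r : R) (z : R[i]) : R[i] :=
  (expR (c * (normc z `^ r)))%:C * z.

End FunctionSpaces.

(* Main.v *)
(** The free evolution [S t] is bounded on L^2 uniformly in [t], commutes with
    the weak derivative and is strongly continuous, hence has the same
    properties on H^1.  Since [r >= 1], the differential of
    [f z = e^{c |z|^r} z] is locally Lipschitz (its singular part is
    [|z|^r] times a function of [z / |z|]), and H^1 embeds in the bounded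
    functions in dimension one, so [u |-> f u] is Lipschitz on the balls of H^1.
    The Duhamel map is then a contraction for the weighted norm
    [sup_t e^{- lam |t|} ||v t||_{H^1}] on a time interval depending only on the
    size of the data.  This gives existence, and the same estimate gives
    uniqueness and Lipschitz dependence on the data.

    About the Fourier transform only the L^2 bound, the strong convergence of
    the truncated integrals and the exchange of derivatives with multiplication
    by [xi] are needed: neither Plancherel's identity nor the inversion
    formula.  The bound is obtained for cosine and sine transforms of functions
    supported in [[-c, c]]: inserting the weight [1 - (xi/M)^2] turns the
    integral over [[-M, M]] into a quadratic form whose kernel is at most
    [10 M / (1 + (M z)^2)], and Schur's test applies. *)
Require Import Defs.
From mathcomp Require Import all_boot all_order all_algebra.
From mathcomp Require Import complex.
From mathcomp Require Import all_classical all_reals all_analysis.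
From mathcomp Require Import measurable_realfun ring lra.
Set Implicit Arguments.
Unset Strict Implicit.
Unset Printing Implicit Defensive.
Import Order.TTheory GRing.Theory Num.Theory.
Import numFieldNormedType.Exports.
Local Open Scope classical_set_scope.
Local Open Scope ring_scope.

(** * Square-integrable real functions *)

Section RealL2.
Context {R : realType}.
Local Notation mu := (@lebesgue_measure R).
Implicit Types (a b f g : R -> R) (D : set R).

(** Functions remain representatives throughout: [H1norm] is a complete seminorm, and equations hold
    up to seminorm zero until [aeeq_H1] turns them into almost everywhere equalities. The fixed
    point argument sees the free evolution only through [propagator]: a bound [C], a Lipschitz
    estimate and strong continuity at each time. From these alone the Duhamel integrand
    [S (t - tau) (F (v tau))] needs its own antiderivative for every [t], and continuity in [t] of
    the integral rests on compactness in [tau] (see [step_good]). A constant [C] above 1 is harmless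
    because the weight [lam = 2 * C * L] absorbs it. On the Fourier side a complex transform is
    split into cosine and sine transforms of the real and imaginary parts. For the L^2 bound cosine
    and sine must be treated together, since only [cos cos + sin sin] gives a kernel in [x - y]. The
    space variable is truncated to [[-c, c]] and the frequency to [[-M, M]], and the bound depends
    on neither; this makes the truncated transforms converge in L^2. *)

Lemma ae_imp (P Q : R -> Prop) : (forall x, P x -> Q x) ->
  {ae mu, forall x, P x} -> {ae mu, forall x, Q x}.
Proof. by move=> PQ; apply: negligibleS => x /= nQ Px; apply: nQ; exact: PQ. Qed.

Lemma ae_and (P Q : R -> Prop) : {ae mu, forall x, P x} ->
  {ae mu, forall x, Q x} -> {ae mu, forall x, P x /\ Q x}.
Proof.
move=> hP hQ; have := negligibleU hP hQ; apply: negligibleS => x /= nPQ.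
by have [Px|] := pselect (P x); [right => Qx; exact: nPQ | left].
Qed.

Definition intg D f := mu.-integrable D (EFin \o f).

Lemma intg_meas D f : measurable D -> intg D f -> measurable_fun D f.
Proof. by move=> mD /(measurable_int mu)/measurable_EFinP. Qed.

Lemma intgD D f g : measurable D -> intg D f -> intg D g ->
  intg D (fun x => f x + g x).
Proof. by move=> mD; exact: integrableD. Qed.

Lemma intgN D f : intg D f -> intg D (fun x => - f x).
Proof. exact: integrableN. Qed.

Lemma intgB D f g : measurable D -> intg D f -> intg D g ->
  intg D (fun x => f x - g x).
Proof. by move=> mD hf hg; apply: intgD => //; exact: intgN. Qed.

Lemma intgZ D k f : measurable D -> intg D f -> intg D (fun x => k * f x).
Proof. by move=> mD; exact: integrableZl. Qed.

Lemma intg_le D f g : measurable D -> measurable_fun D f ->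
  (forall x, D x -> `|f x| <= `|g x|) -> intg D g -> intg D f.
Proof.
move=> mD mf le ig; apply: le_integrable ig => //; first exact/measurable_EFinP.
Qed.

Lemma intg_norm D f : intg D f -> intg D (fun x => `|f x|).
Proof. exact: integrable_norm. Qed.

Lemma intg_sub (E D : set R) f : measurable E -> measurable D -> D `<=` E ->
  intg E f -> intg D f.
Proof. by move=> mE mD DE; apply: integrableS. Qed.

Lemma eq_intg D f g : measurable D -> (forall x, D x -> f x = g x) ->
  intg D f -> intg D g.
Proof.
move=> mD e; apply: eq_integrable => // x /set_mem Dx /=; by rewrite e.
Qed.

Lemma intg_bndM D f g : measurable D -> measurable_fun D f ->
  (exists M, forall x, D x -> `|f x| <= M) -> intg D g ->
  intg D (fun x => f x * g x).
Proof.
move=> mD mf [M hM] ig; have mg := intg_meas mD ig.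
apply: (@intg_le _ _ (fun x => M * g x)) => //.
- exact: measurable_funM.
- move=> x Dx; rewrite !normrM ler_wpM2r//; apply: le_trans (hM _ Dx) _.
  exact: ler_norm.
- exact: intgZ.
Qed.

Lemma Rint_abs_eq0 D f : measurable D -> intg D f ->
  \int[mu]_(x in D) `|f x| = 0 -> ae_eq mu D f (cst 0).
Proof.
move=> mD idf h0.
have mf := intg_meas mD idf.
have /integrableP[_ fin] := intg_norm idf.
have : (\int[mu]_(x in D) `|(f x)%:E| = 0)%E.
  apply/eqP; rewrite eq_le integral_ge0 // andbT.
  rewrite -[leLHS]fineK; last first.
    rewrite ge0_fin_numE ?integral_ge0//.
    by under eq_integral do rewrite /= -[`|_|%R]normr_id.
  by rewrite lee_fin; move: h0; rewrite /Rintegral => ->.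
move/(ae_eq_integral_abs mu mD) => /(_ _).
have me : measurable_fun D (EFin \o f) by exact/measurable_EFinP.
move=> /(_ me); apply: filterS => x H Dx.
by have := H Dx => -[].
Qed.

Lemma ae_Rint D f g : measurable D -> measurable_fun D f -> measurable_fun D g ->
  ae_eq mu D f g -> \int[mu]_(x in D) f x = \int[mu]_(x in D) g x.
Proof.
move=> mD mf mg e; rewrite /Rintegral; congr fine; apply: ae_eq_integral => //.
- exact/measurable_EFinP.
- exact/measurable_EFinP.
by apply: filterS e => x H Dx; rewrite H.
Qed.

Lemma ae_intg D f g : measurable D -> measurable_fun D g ->
  ae_eq mu D f g -> intg D f -> intg D g.
Proof.
move=> mD mg e ifd; have mf := intg_meas mD ifd.
apply/integrableP; split; first exact/measurable_EFinP.
have /integrableP[_] := ifd.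
have -> // : (\int[mu]_(x in D) `|(EFin \o f) x| = \int[mu]_(x in D) `|(EFin \o g) x|)%E.
apply: ae_eq_integral => //.
- by apply: measurableT_comp => //; exact/measurable_EFinP.
- by apply: measurableT_comp => //; exact/measurable_EFinP.
- by apply: filterS e => x H Dx /=; rewrite H.
Qed.

Definition sq a := measurable_fun setT a /\ intg setT (fun x => a x ^+ 2).

(** [Rintegral] sends an infinite integral to 0, so this is the L^2 norm only for functions that
    satisfy [sq]. *)
Definition n2 a : R := Num.sqrt (\int[mu]_x (a x ^+ 2)).

Lemma n2_ge0 a : 0 <= n2 a. Proof. exact: sqrtr_ge0. Qed.

Lemma n2_sqr a : n2 a ^+ 2 = \int[mu]_x (a x ^+ 2).
Proof. by rewrite sqr_sqrtr// Rintegral_ge0// => x _; exact: sqr_ge0. Qed.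

Lemma sq_le a b : measurable_fun setT a -> (forall x, `|a x| <= `|b x|) ->
  sq b -> sq a.
Proof.
move=> ma le [mb ib]; split=> //.
apply: (intg_le _ _ _ ib) => //; first exact: measurable_funX.
by move=> x _; rewrite !normrX lerXn2r ?nnegrE.
Qed.

Lemma n2_le a b : sq a -> sq b -> (forall x, `|a x| <= `|b x|) -> n2 a <= n2 b.
Proof.
move=> [ma ia] [mb ib] le; rewrite ler_sqrt; last first.
  by rewrite Rintegral_ge0// => x _; exact: sqr_ge0.
apply: le_Rintegral => // x _.
by rewrite -[leLHS]real_normK ?num_real// -[leRHS]real_normK ?num_real// lerXn2r ?nnegrE.
Qed.

Lemma sqM_intg a b : sq a -> sq b -> intg setT (fun x => a x * b x).
Proof.
move=> [ma ia] [mb ib].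
apply: (intg_le _ _ _ (intgD _ ia ib)) => //; first exact: measurable_funM.
move=> x _; rewrite [leRHS]ger0_norm ?addr_ge0 ?sqr_ge0//.
rewrite normrM; have := sqr_ge0 (`|a x| - `|b x|).
by rewrite -(real_normK (num_real (a x))) -(real_normK (num_real (b x))); nra.
Qed.

Lemma sqD a b : sq a -> sq b -> sq (fun x => a x + b x).
Proof.
move=> ha hb; have iab := sqM_intg ha hb; case: ha => ma ia; case: hb => mb ib.
split; first exact: measurable_funD.
apply: (@eq_intg _ (fun x => a x ^+ 2 + (2 * (a x * b x)) + b x ^+ 2)) => //.
  by move=> x _; ring.
by do! apply: intgD => //; apply: intgZ.
Qed.

Lemma sqZ k a : sq a -> sq (fun x => k * a x).
Proof.
move=> [ma ia]; split; first exact: measurable_funM.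
apply: (@eq_intg _ (fun x => k ^+ 2 * (a x ^+ 2))) => //.
  by move=> x _; ring.
exact: intgZ.
Qed.

Lemma sqN a : sq a -> sq (fun x => - a x).
Proof. by move=> /(sqZ (-1)); under eq_fun do rewrite mulN1r. Qed.

Lemma sqB a b : sq a -> sq b -> sq (fun x => a x - b x).
Proof. by move=> ha hb; apply: sqD => //; exact: sqN. Qed.

Lemma sq0 : sq (fun=> 0).
Proof.
split => //; apply: (@eq_intg _ (fun=> 0)) => //; first by move=> x; rewrite expr0n.
exact: integrable0.
Qed.

Lemma sq_norm a : sq a -> sq (fun x => `|a x|).
Proof.
move=> sa; apply: (sq_le _ _ sa) => [|x]; last by rewrite normr_id.
by apply: measurableT_comp => //; case: sa.
Qed.

Lemma n2_norm a : n2 (fun x => `|a x|) = n2 a.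
Proof. by rewrite /n2; under eq_Rintegral do rewrite real_normK ?num_real//. Qed.

Lemma n2Z k a : sq a -> n2 (fun x => k * a x) = `|k| * n2 a.
Proof.
move=> [ma ia]; rewrite /n2.
under eq_Rintegral do rewrite exprMn.
rewrite RintegralZl// sqrtrM ?sqr_ge0// sqrtr_sqr//.
Qed.

Lemma n2N a : n2 (fun x => - a x) = n2 a.
Proof. by rewrite /n2; under eq_Rintegral do rewrite sqrrN. Qed.

Lemma n2_subC a b : n2 (fun x => a x - b x) = n2 (fun x => b x - a x).
Proof. by rewrite -n2N; congr n2; apply/funext => x; rewrite opprB. Qed.

Lemma n2_0 : n2 (fun=> 0) = 0.
Proof.
rewrite /n2; under eq_Rintegral do rewrite expr0n /=.
by rewrite /Rintegral integral0 sqrtr0.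
Qed.

Lemma n2D_sqr a b : sq a -> sq b -> n2 (fun x => a x + b x) ^+ 2 =
  n2 a ^+ 2 + 2 * (\int[mu]_x (a x * b x)) + n2 b ^+ 2.
Proof.
move=> ha hb; have iab := sqM_intg ha hb; case: ha => ma ia; case: hb => mb ib.
rewrite !n2_sqr.
transitivity (\int[mu]_x (a x ^+ 2 + (2 * (a x * b x)) + b x ^+ 2)).
  by apply: eq_Rintegral => x _; ring.
rewrite RintegralD//; last by apply: intgD => //; exact: intgZ.
rewrite RintegralD//; last exact: intgZ.
by rewrite RintegralZl.
Qed.

(** The quadratic [t |-> n2 (a + t b) ^+ 2] is nonnegative; its value at the vertex [t = - I / B]
    gives the inequality. *)
Lemma cauchy_schwarz a b : sq a -> sq b ->
  `|\int[mu]_x (a x * b x)| <= n2 a * n2 b.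
Proof.
move=> ha hb; set I := \int[mu]_x _.
have Q t : 0 <= n2 a ^+ 2 + 2 * (t * I) + t ^+ 2 * n2 b ^+ 2.
  have := sqr_ge0 (n2 (fun x => a x + t * b x)).
  rewrite n2D_sqr//; last exact: sqZ.
  rewrite n2Z// exprMn real_normK ?num_real//.
  under eq_Rintegral do rewrite mulrCA.
  by rewrite RintegralZl//; exact: sqM_intg.
rewrite -ler_sqr ?nnegrE ?mulr_ge0 ?n2_ge0// real_normK ?num_real// exprMn.
have := sqr_ge0 (n2 a); have := sqr_ge0 (n2 b).
move: (n2 a ^+ 2) (n2 b ^+ 2) Q => A B Q B0 A0.
have [B00|Bn0] := eqVneq B 0.
  rewrite B00 mulr0; have [->|In0] := eqVneq I 0; first by rewrite expr0n.
  (* For [B = 0] the quadratic is affine in [t], and unless [I = 0] it would take the value -1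
     here. *)
  have := Q (- (A + 1) / (2 * I)).
  have -> : A + 2 * (- (A + 1) / (2 * I) * I) + (- (A + 1) / (2 * I)) ^+ 2 * B = -1.
    by rewrite B00; field.
  by rewrite ler0N1.
have := Q (- I / B).
have -> : A + 2 * (- I / B * I) + (- I / B) ^+ 2 * B = (A * B - I ^+ 2) / B by field.
by rewrite pmulr_lge0 ?invr_gt0 ?lt_neqAle 1?eq_sym ?Bn0// subr_ge0.
Qed.

Lemma n2_triangle a b : sq a -> sq b -> n2 (fun x => a x + b x) <= n2 a + n2 b.
Proof.
move=> ha hb; rewrite -ler_sqr ?nnegrE ?addr_ge0 ?n2_ge0// n2D_sqr//.
have := cauchy_schwarz ha hb; have := n2_ge0 a; have := n2_ge0 b.
have := ler_norm (\int[mu]_x (a x * b x)); nra.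
Qed.

Lemma n2_triangleB a b c : sq a -> sq b -> sq c ->
  n2 (fun x => a x - c x) <= n2 (fun x => a x - b x) + n2 (fun x => b x - c x).
Proof.
move=> ha hb hc; have := n2_triangle (sqB ha hb) (sqB hb hc).
by under eq_fun do rewrite addrA subrK.
Qed.

Lemma sq_ae a b : measurable_fun setT b -> a = b %[ae mu] -> sq a -> sq b.
Proof.
move=> mb e [ma ia]; split => //; apply: ae_intg ia => //.
  exact: measurable_funX.
by apply: ae_imp e => x + Dx => ->.
Qed.

Lemma n2_ae a b : measurable_fun setT a -> measurable_fun setT b ->
  a = b %[ae mu] -> n2 a = n2 b.
Proof.
move=> ma mb e; rewrite /n2 (@ae_Rint _ _ (fun x => b x ^+ 2))//.
- exact: measurable_funX.
- exact: measurable_funX.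
by apply: ae_imp e => x + Dx => ->.
Qed.

Lemma n2_eq0 a : sq a -> n2 a = 0 -> a = cst 0 %[ae mu].
Proof.
move=> [ma ia] h; have := n2_sqr a; rewrite h expr0n/= => /esym h0.
have : ae_eq mu setT (fun x => a x ^+ 2) (cst 0).
  apply: Rint_abs_eq0 => //; transitivity (\int[mu]_x (a x ^+ 2)) => //.
  apply: eq_Rintegral => x _; by rewrite ger0_norm// sqr_ge0.
by apply: filterS => x /(_ I) /= /eqP; rewrite sqrf_eq0 => /eqP + _.
Qed.

End RealL2.

(** * Dominated convergence and Fatou's lemma in L^2 *)

Section RealL2Limits.
Context {R : realType}.
Local Notation mu := (@lebesgue_measure R).
Implicit Types (a b f g : R -> R) (D : set R).

Lemma Rint_EFin D f : measurable D -> intg D f ->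
  (\int[mu]_(x in D) (f x)%:E)%E = (\int[mu]_(x in D) f x)%:E.
Proof. by move=> mD If; rewrite /Rintegral fineK//; exact: integrable_fin_num. Qed.

Lemma RintD D f g : measurable D -> intg D f -> intg D g ->
  \int[mu]_(x in D) (f x + g x) = \int[mu]_(x in D) f x + \int[mu]_(x in D) g x.
Proof. by move=> mD If Ig; rewrite RintegralD. Qed.

Lemma RintB D f g : measurable D -> intg D f -> intg D g ->
  \int[mu]_(x in D) (f x - g x) = \int[mu]_(x in D) f x - \int[mu]_(x in D) g x.
Proof. by move=> mD If Ig; rewrite RintegralB. Qed.

Lemma RintZ D k f : measurable D -> intg D f ->
  \int[mu]_(x in D) (k * f x) = k * \int[mu]_(x in D) f x.
Proof. by move=> mD If; rewrite RintegralZl. Qed.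

Lemma Rint_le D f g : measurable D -> intg D f -> intg D g ->
  (forall x, D x -> f x <= g x) ->
  \int[mu]_(x in D) f x <= \int[mu]_(x in D) g x.
Proof. by move=> mD If Ig le; apply: le_Rintegral. Qed.

Lemma Rint_norm D f : measurable D -> intg D f ->
  `|\int[mu]_(x in D) f x| <= \int[mu]_(x in D) `|f x|.
Proof. by move=> mD If; apply: le_normr_Rintegral. Qed.

Lemma dct D (f_ : nat -> R -> R) f g : measurable D ->
  (forall n, measurable_fun D (f_ n)) ->
  (forall x, D x -> f_ n x @[n --> \oo] --> f x) -> intg D g ->
  (forall n x, D x -> `|f_ n x| <= g x) ->
  intg D f /\ \int[mu]_(x in D) f_ n x @[n --> \oo] --> \int[mu]_(x in D) f x.
Proof.
move=> mD mf cf ig le.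
have mf0 : measurable_fun D f by apply: measurable_fun_cvg cf.
have [| | | | |i0 _ ci] := @dominated_convergence _ _ _ mu D mD
  (fun n x => (f_ n x)%:E) (EFin \o f) (EFin \o g).
- by move=> n; apply/measurable_EFinP; exact: mf.
- exact/measurable_EFinP.
- by apply: aeW => x Dx /=; apply: cvg_EFin; [near=> n|exact: cf].
- exact: ig.
- by apply: aeW => x n Dx /=; rewrite lee_fin le.
split=> //; apply: fine_cvg; rewrite -Rint_EFin//.
Unshelve. all: by end_near. Qed.

Lemma n2_dct (a_ : nat -> R -> R) a g : (forall n, sq (a_ n)) ->
  (forall x, a_ n x @[n --> \oo] --> a x) -> sq g ->
  (forall n x, `|a_ n x| <= g x) ->
  sq a /\ n2 (fun x => a_ n x - a x) @[n --> \oo] --> 0.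
Proof.
move=> sa ca sg le.
have ma : measurable_fun setT a.
  by apply: (@measurable_fun_cvg _ _ _ _ a_) => // n; case: (sa n).
have lea x : `|a x| <= g x.
  apply: (@closed_cvg _ _ \oo _ (fun n => `|a_ n x|) (fun y => y <= g x)).
  - exact: closed_le.
  - by near=> n; exact: le.
  - exact: cvg_norm.
have sqa : sq a.
  by apply: (sq_le ma _ sg) => x; apply: le_trans (lea x) (ler_norm _).
split=> //.
have K : \int[mu]_x ((a_ n x - a x) ^+ 2) @[n --> \oo] --> 0.
  (* Both [a_ n] and the limit are bounded by [g], so the squared difference is at most
     [(2 g) ^ 2]. *)
  have [] := @dct setT (fun n x => (a_ n x - a x) ^+ 2) (fun=> 0)
    (fun x => 4 * g x ^+ 2) measurableT.
  - move=> n; apply: measurable_funX; apply: measurable_funB => //.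
    by case: (sa n).
  - move=> x _; have : (a_ n x - a x) ^+ 2 @[n --> \oo] --> (a x - a x) ^+ 2.
      have H : a_ n x - a x @[n --> \oo] --> a x - a x.
        by apply: cvgB => //; exact: cvg_cst.
      exact: (cvgM H H).
    by rewrite subrr expr0n.
  - by apply: intgZ => //; case: sg.
  - move=> n x _; rewrite ger0_norm ?sqr_ge0//.
    have := le n x; have := lea x; rewrite !ler_norml => /andP[? ?] /andP[? ?]; nra.
  by move=> _; rewrite {2}/Rintegral integral0.
by rewrite -[X in _ --> X](@sqrtr0 R); exact: cvg_comp K (@sqrt_continuous R 0).
Unshelve. all: by end_near. Qed.

Lemma limn_einf_le (u : nat -> \bar R) e : (forall n, u n <= e)%E -> (limn_einf u <= e)%E.
Proof.
move=> le; rewrite limn_einf_lim; apply: lime_le; first exact: is_cvg_einfs.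
near=> n; apply: le_trans (le n); apply: ereal_inf_lbound; exists n => //=.
Unshelve. all: by end_near. Qed.

(** Fatou's lemma for squares. It serves to identify the limit in [sq_complete] and to pass from
    frequency windows to the whole line in [trigT_sq]. *)
Lemma n2_fatou (b_ : nat -> R -> R) b e : (forall n, sq (b_ n)) ->
  (forall x, b_ n x @[n --> \oo] --> b x) -> 0 <= e ->
  (forall n, n2 (b_ n) <= e) -> sq b /\ n2 b <= e.
Proof.
move=> sb cb e0 hn.
have mb : measurable_fun setT b.
  by apply: (@measurable_fun_cvg _ _ _ _ b_) => // n; case: (sb n).
have H : (\int[mu]_x ((b x) ^+ 2)%:E <= (e ^+ 2)%:E)%E.
  have -> : (fun x => (b x ^+ 2)%:E) = (fun x => limn_einf (fun n => (b_ n x ^+ 2)%:E)).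
    apply/funext => x; apply/esym.
    have : (b_ n x ^+ 2)%:E @[n --> \oo] --> (b x ^+ 2)%:E.
      apply: cvg_EFin; first by near=> n.
      exact: (cvgM (cb x) (cb x)).
    by move=> /cvg_limn_einf_sup[].
  have := @fatou _ _ _ mu setT measurableT (fun n x => ((b_ n x) ^+ 2)%:E).
  move=> H; apply: le_trans (H _ _) _.
  - by move=> n; apply/measurable_EFinP; apply: measurable_funX; case: (sb n).
  - by move=> n x _; rewrite lee_fin sqr_ge0.
  apply: limn_einf_le => n; rewrite Rint_EFin//; last by case: (sb n).
  by rewrite lee_fin -n2_sqr lerXn2r ?nnegrE ?n2_ge0.
have i2 : intg setT (fun x => b x ^+ 2).
  apply/integrableP; split; first by apply/measurable_EFinP; exact: measurable_funX.
  under eq_integral do rewrite /= ger0_norm ?sqr_ge0//.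
  exact: le_lt_trans H (ltry _).
split; first by split.
rewrite -ler_sqr ?nnegrE ?n2_ge0// n2_sqr -lee_fin -Rint_EFin//.
Unshelve. all: by end_near. Qed.

End RealL2Limits.

(** * Completeness of L^2 *)

Section RieszFischer.
Context {R : realType}.
Local Notation mu := (@lebesgue_measure R).
Implicit Types (a b f g : R -> R) (D : set R).

Lemma measurable_intg (f : R -> \bar R) : mu.-integrable setT f ->
  measurable [set x | f x \is a fin_num].
Proof.
move=> /integrableP[mf _].
by have := emeasurable_fin_num measurableT mf; rewrite setTI.
Qed.

(** Monotone convergence applied to [G n ^ 2]: the limit has a finite integral, hence is finite
    almost everywhere, and there [G n] is bounded and increasing. *)
Lemma n2_ge0_mono_bounded (G : nat -> R -> R) M : (forall n, sq (G n)) ->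
  (forall n x, 0 <= G n x) -> (forall n x, G n x <= G n.+1 x) ->
  (forall n, n2 (G n) <= M) ->
  exists E : set R, [/\ measurable E, {ae mu, forall x, E x} &
    forall x, E x -> cvgn (fun n => G n x)].
Proof.
move=> sG G0 Gi GM.
pose h n x := ((G n x) ^+ 2)%:E.
have hm n : measurable_fun setT (h n).
  by apply/measurable_EFinP; apply: measurable_funX; case: (sG n).
have h0 n x : (0 <= h n x)%E by rewrite lee_fin sqr_ge0.
have hi x : {homo h^~ x : n m / (n <= m)%N >-> (n <= m)%E}.
  apply/nondecreasing_seqP => n; rewrite lee_fin lerXn2r ?nnegrE//.
pose H x := limn (h^~ x).
have cH x : h n x @[n --> \oo] --> H x.
  by apply: ereal_nondecreasing_is_cvgn; exact: hi.
have mH : measurable_fun setT H.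
  by apply: (@emeasurable_fun_cvg _ _ _ _ h) => // x _; exact: cH.
have H0 x : (0 <= H x)%E by apply: lime_ge => //; exact: nearW.
have IH : (\int[mu]_x H x <= (M ^+ 2)%:E)%E.
  have := @cvg_monotone_convergence _ _ _ mu setT measurableT h.
  move=> /(_ hm (fun n x _ => h0 n x) (fun x _ => hi x)) cI.
  rewrite -(cvg_lim _ cI)//; apply: lime_le; first exact: cvgP cI.
  apply: nearW => n; rewrite Rint_EFin//; last by case: (sG n).
  rewrite lee_fin -n2_sqr lerXn2r ?nnegrE ?n2_ge0//.
  exact: le_trans (n2_ge0 _) (GM n).
have iH : mu.-integrable setT H.
  apply/integrableP; split => //; under eq_integral do rewrite gee0_abs//.
  exact: le_lt_trans IH (ltry _).
exists [set x | H x \is a fin_num]; split.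
- exact: measurable_intg.
- by have := integrable_ae measurableT iH; apply: ae_imp => x; exact.
move=> x /= fx; apply: nondecreasing_is_cvgn.
  exact/nondecreasing_seqP.
(* [G ^ 2 <= H] implies [G <= H + 1]. *)
exists (fine (H x) + 1) => _ [n _ <-].
have : (h n x <= H x)%E.
  apply: lime_ge; first exact: cH.
  by exists n => // m /= nm; exact: hi.
rewrite -(fineK fx) lee_fin; have := G0 n x; nra.
Qed.

Lemma n2_eq_ae a b : sq a -> measurable_fun setT b -> a = b %[ae mu] ->
  sq b /\ n2 (fun x => a x - b x) = 0.
Proof.
move=> [ma ia] mb e; split; first exact: sq_ae e _.
rewrite -(@n2_0 R); apply: n2_ae => //; first exact: measurable_funB.
by apply: ae_imp e => x /(_ I) -> _; rewrite subrr.
Qed.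

(** The classical Riesz-Fischer argument: along a subsequence with gaps at most [2^-j] the sum of
    the absolute increments is bounded in L^2, so the subsequence converges almost everywhere;
    Fatou's lemma then upgrades this to L^2. *)
Lemma sq_complete (a_ : nat -> R -> R) : (forall n, sq (a_ n)) ->
  (forall e, 0 < e -> exists N, forall m n, (N <= m)%N -> (N <= n)%N ->
     n2 (fun x => a_ m x - a_ n x) <= e) ->
  exists b, sq b /\ n2 (fun x => a_ n x - b x) @[n --> \oo] --> 0.
Proof.
move=> sa ca.
have /choice[K hK] j : exists N, forall m n, (N <= m)%N -> (N <= n)%N ->
     n2 (fun x => a_ m x - a_ n x) <= 2^-1 ^+ j.
  by apply: ca; rewrite exprn_gt0// invr_gt0.
(* Partial sums of the thresholds are nondecreasing and exceed each [K j]. *)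
pose k j := (\sum_(i < j.+1) K i)%N.
have kS j : (k j <= k j.+1)%N by rewrite /k [leqRHS]big_ord_recr /= leq_addr.
have kK j : (K j <= k j)%N by rewrite /k big_ord_recr /= leq_addl.
have kmono i j : (i <= j)%N -> (k i <= k j)%N.
  by move=> ij; rewrite -(subnK ij); elim: (j - i)%N => // d; move/leq_trans; apply; exact: kS.
pose b j := a_ (k j).
have sb j : sq (b j) by exact: sa.
pose G n x := \sum_(j < n) `|b j.+1 x - b j x|.
have GS n x : G n.+1 x = G n x + `|b n.+1 x - b n x|.
  by rewrite /G big_ord_recr.
(* The right-hand side is the geometric sum of [2^-j] over [j < n]. *)
have sG n : sq (G n) /\ n2 (G n) <= 2 - 2 * 2^-1 ^+ n.
  elim: n => [|n [s1 s2]].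
    have -> : G 0%N = fun=> 0 by apply/funext => x; rewrite /G big_ord0.
    by split; [exact: sq0|rewrite n2_0 expr0 mulr1 subrr].
  have -> : G n.+1 = fun x => G n x + `|b n.+1 x - b n x| by apply/funext.
  have s3 : sq (fun x => `|b n.+1 x - b n x|) by apply: sq_norm; exact: sqB.
  split; first exact: sqD.
  apply: le_trans (n2_triangle _ _) _ => //; rewrite n2_norm.
  have := hK n (k n.+1) (k n) (leq_trans (kK n) (kS n)) (kK n).
  rewrite -/(b n.+1) -/(b n) exprS; move: s2; move: (2^-1 ^+ n) => y; lra.
have [E [mE aE cE]] : exists E : set R, [/\ measurable E, {ae mu, forall x, E x} &
    forall x, E x -> cvgn (fun n => G n x)].
  apply: (@n2_ge0_mono_bounded _ 2).
  - by move=> n; case: (sG n).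
  - by move=> n x; apply: sumr_ge0.
  - by move=> n x; rewrite GS lerDl.
  - move=> n; case: (sG n) => _ h; apply: le_trans h _.
    by rewrite gerBl mulr_ge0// exprn_ge0// invr_ge0.
(* Putting the functions to 0 off [E] makes the sequence converge at every point, so the limit is
   measurable without further choices. *)
pose b' j x := b j x * \1_E x.
have b'E j x : E x -> b' j x = b j x by move=> Ex; rewrite /b' indicE mem_set// mulr1.
have mb' j : measurable_fun setT (b' j).
  by apply: measurable_funM; [case: (sb j)|exact: measurable_indic].
have aeb j : b j = b' j %[ae mu] by apply: ae_imp aE => x Ex _; rewrite b'E.
have sb' j : sq (b' j) by case: (n2_eq_ae (sb j) (mb' j) (aeb j)).
have nb' j : n2 (fun x => b j x - b' j x) = 0.
  by case: (n2_eq_ae (sb j) (mb' j) (aeb j)).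
have cb' x : cvgn (fun n => b' n x).
  have [Ex|nEx] := pselect (E x); last first.
    have -> : (fun n => b' n x) = fun=> 0.
      by apply/funext => n; rewrite /b' indicE memNset// mulr0.
    exact: is_cvg_cst.
  have -> : (fun n => b' n x) = (fun n => b 0%N x) + series (fun j => b j.+1 x - b j x).
    apply/funext => n; rewrite fctD b'E// /series /= telescope_sumr//.
    by rewrite addrC subrK.
  apply: is_cvgD; first exact: is_cvg_cst.
  apply: normed_cvg.
  suff -> : [normed series (fun j => b j.+1 x - b j x)]%classic = (fun n => G n x) by exact: cE.
  by apply/funext => n; rewrite /G /normed_series_of /series /= big_mkord.
pose B x := lim (b' n x @[n --> \oo]).
(* Fatou's lemma in [n] for the differences [b' j - b' (j + n)], all of norm at most [2^-j]. *)
have hB j : sq (fun x => b' j x - B x) /\ n2 (fun x => b' j x - B x) <= 2^-1 ^+ j.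
  apply: (@n2_fatou _ (fun n x => b' j x - b' (j + n)%N x)).
  - by move=> n; exact: sqB.
  - move=> x; apply: cvgB; first exact: cvg_cst.
    have h : (fun n => b' (j + n)%N x) = (fun n => b' (n + j)%N x).
      by apply/funext => n; rewrite addnC.
    by rewrite h (cvg_shiftn j (b'^~ x)); exact: cb'.
  - by rewrite exprn_ge0// invr_ge0.
  move=> n.
  have <- : n2 (fun x => b j x - b (j + n)%N x) = n2 (fun x => b' j x - b' (j + n)%N x).
    apply: n2_ae; [by case: (sqB (sb j) (sb (j+n)%N))|by case: (sqB (sb' j) (sb' (j+n)%N))|].
    by apply: ae_imp aE => x Ex _; rewrite !b'E.
  apply: hK; first exact: kK.
  by apply: leq_trans (kK j) _; apply: kmono; exact: leq_addr.
have sB : sq B.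
  have := sqB (sb' 0%N) (hB 0%N).1; congr sq; apply/funext => x.
  by rewrite opprB addrC subrK.
exists B; split=> //; apply/cvgrPdist_le => e e0.
have : (2^-1 : R) ^+ n @[n --> \oo] --> 0 by apply: cvg_expr; rewrite ger0_norm ?invf_lt1 ?ltr1n// invr_ge0.
have e20 : 0 < e / 2 by rewrite divr_gt0.
move=> /cvgrPdist_le /(_ _ e20)[j _ /(_ j (leqnn _))].
rewrite sub0r normrN ger0_norm ?exprn_ge0 ?invr_ge0// => hj.
exists (k j) => // m /= jm; rewrite sub0r normrN ger0_norm ?n2_ge0//.
have h1 := hK j m (k j) (leq_trans (kK j) jm) (kK j).
apply: le_trans (n2_triangleB (sa m) (sb j) sB) _.
have h2 := n2_triangleB (sb j) (sb' j) sB; rewrite nb' add0r in h2.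
have := (hB j).2; lra.
Qed.

End RieszFischer.

(** * Truncated cosine and sine transforms *)

Section Fubini.
Context {R : realType}.
Local Notation mu := (@lebesgue_measure R).
Implicit Types (a b f g h : R -> R) (D E : set R).

Lemma Rint_restrict D f : \int[mu]_(x in D) f x = \int[mu]_x (f x * \1_D x).
Proof.
rewrite Rintegral_mkcond; apply: eq_Rintegral => x _.
rewrite patchE indicE; case: ifPn => /=; by rewrite ?mulr1 ?mulr0.
Qed.

Lemma intg_restrict D f : measurable D -> intg D f <-> intg setT (fun x => f x * \1_D x).
Proof.
move=> mD; have e : (EFin \o f) \_ D = EFin \o (fun x => f x * \1_D x); last first.
  by rewrite /intg -e; exact: integrable_mkcond.
apply/funext => x; rewrite /= patchE indicE; case: ifPn => /=; by rewrite ?mulr1 ?mulr0.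
Qed.

(** The integrand on the plane is dominated by [M |h x| |g y|]. Integrability of the outer integrand
    is recorded as well, because iterated integrals of this kind are added later. *)
Lemma fubini_mul_setT (h g : R -> R) (k : R -> R -> R) (M : R) :
  intg setT h -> intg setT g ->
  measurable_fun [set: R * R] (fun z => k z.1 z.2) -> (forall x y, `|k x y| <= M) ->
  \int[mu]_x (h x * \int[mu]_y (k x y * g y)) =
    \int[mu]_y (g y * \int[mu]_x (k x y * h x)) /\
  intg setT (fun x => h x * \int[mu]_y (k x y * g y)).
Proof.
move=> ih ig mk kM.
have mh := intg_meas measurableT ih; have mg := intg_meas measurableT ig.
pose F (z : R * R) := (h z.1 * (k z.1 z.2 * g z.2))%:E.
have mkx x : measurable_fun setT (k x).
  exact: (measurableT_comp mk (measurable_pair1 x)).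
have mky y : measurable_fun setT (k^~ y).
  exact: (measurableT_comp mk (measurable_pair2 y)).
have ikx x : intg setT (fun y => k x y * g y).
  by apply: intg_bndM => //; exists M.
have iky y : intg setT (fun x => k x y * h x).
  by apply: intg_bndM => //; exists M.
have mF : measurable_fun setT F.
  apply/measurable_EFinP; apply: measurable_funM.
    exact: (measurableT_comp mh measurable_fst).
  by apply: measurable_funM => //; exact: (measurableT_comp mg measurable_snd).
have iF : (mu \x mu)%E.-integrable setT F.
  apply/integrable12ltyP => //.
  apply: le_lt_trans (ltry (M * (\int[mu]_x `|h x|) * (\int[mu]_y `|g y|))).
  have -> : (M * (\int[mu]_x `|h x|) * (\int[mu]_y `|g y|))%:E =
     (\int[mu]_x ((M * \int[mu]_y `|g y|) * `|h x|)%:E)%E.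
    rewrite Rint_EFin//; last by apply: intgZ => //; exact: intg_norm.
    by rewrite RintegralZl//; [congr EFin; ring|exact: intg_norm].
  apply: ge0_le_integral => //.
  - by move=> x _; exact: integral_ge0.
  - apply: (@measurable_fun_fubini_tonelli_F _ _ _ _ _ mu (fun z => `|F z|%E)) => //.
    exact: measurableT_comp.
  - apply/measurable_EFinP; apply: measurable_funM => //.
    exact: measurableT_comp.
  move=> x _.
  have -> : (\int[mu]_y `|F (x, y)| = (`|h x| * \int[mu]_y `|k x y * g y|)%:E)%E.
    rewrite -RintegralZl//; last exact: intg_norm.
    rewrite -Rint_EFin//; last by apply: intgZ => //; exact: intg_norm.
    by apply: eq_integral => y _; rewrite /F /= normrM.
  rewrite lee_fin mulrC ler_wpM2r//.
  rewrite -RintegralZl//; last exact: intg_norm.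
  apply: le_Rintegral => //; [exact: intg_norm|by apply: intgZ => //; exact: intg_norm|].
  by move=> y _; rewrite normrM ler_wpM2r.
have := Fubini iF.
have -> : (\int[mu]_x \int[mu]_y F (x, y) = \int[mu]_x (h x * \int[mu]_y (k x y * g y))%:E)%E.
  apply: eq_integral => x _; rewrite /F /= Rint_EFin//; last by apply: intgZ.
  by rewrite RintegralZl//; exact: ikx.
have -> : (\int[mu]_y \int[mu]_x F (x, y) = \int[mu]_y (g y * \int[mu]_x (k x y * h x))%:E)%E.
  apply: eq_integral => y _; rewrite -(RintegralZl (g y) measurableT (iky y)) -Rint_EFin//; last by apply: intgZ.
  by apply: eq_integral => x _; rewrite /F /=; congr EFin; ring.
move=> FF; split; first by rewrite /Rintegral FF.
have := integrable_fubini_F iF; apply: eq_integrable => // x _.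
rewrite /fubini_F /F /= Rint_EFin//; last by apply: intgZ.
by rewrite RintegralZl//; exact: ikx.
Qed.
Lemma fubini_mul D E (h g : R -> R) (k : R -> R -> R) (M : R) :
  measurable D -> measurable E -> intg D h -> intg E g ->
  measurable_fun [set: R * R] (fun z => k z.1 z.2) -> (forall x y, `|k x y| <= M) ->
  \int[mu]_(x in D) (h x * \int[mu]_(y in E) (k x y * g y)) =
    \int[mu]_(y in E) (g y * \int[mu]_(x in D) (k x y * h x)) /\
  intg D (fun x => h x * \int[mu]_(y in E) (k x y * g y)).
Proof.
move=> mD mE /(intg_restrict _ mD) ih /(intg_restrict _ mE) ig mk kM.
have eD x : (h x * \int[mu]_(y in E) (k x y * g y)) * \1_D x =
    (h x * \1_D x) * \int[mu]_y (k x y * (g y * \1_E y)).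
  by rewrite (Rint_restrict E); under [in RHS]eq_Rintegral do rewrite mulrA; ring.
have eE y : (g y * \int[mu]_(x in D) (k x y * h x)) * \1_E y =
    (g y * \1_E y) * \int[mu]_x (k x y * (h x * \1_D x)).
  by rewrite (Rint_restrict D); under [in RHS]eq_Rintegral do rewrite mulrA; ring.
have [H1 H2] := fubini_mul_setT ih ig mk kM; split.
  rewrite Rint_restrict [RHS]Rint_restrict.
  under eq_Rintegral do rewrite eD; under [RHS]eq_Rintegral do rewrite eE.
  exact: H1.
apply/intg_restrict => //; move: H2; congr (intg _ _).
by apply/funext => x; rewrite eD.
Qed.

End Fubini.

(** * Rules of differentiation and the fundamental theorem of calculus *)

Section FTC.
Context {R : realType}.
Local Notation mu := (@lebesgue_measure R).

Implicit Types (f g : R -> R).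

(** The rules are restated for explicit functions and the product of [R], so that a derivative is
    assembled as one term and then adjusted by [is_derive_val]. *)
Lemma is_derive_add f g (x a b : R) : is_derive x 1 f a -> is_derive x 1 g b ->
  is_derive x 1 (fun y => f y + g y) (a + b).
Proof. exact: is_deriveD. Qed.

Lemma is_derive_mul f g (x a b : R) : is_derive x 1 f a -> is_derive x 1 g b ->
  is_derive x 1 (fun y => f y * g y) (a * g x + f x * b).
Proof.
by move=> fa gb; apply: is_derive_eq; rewrite addrC mulrC.
Qed.

Lemma is_derive_scale f (x a k : R) : is_derive x 1 f a ->
  is_derive x 1 (fun y => k * f y) (k * a).
Proof. by move=> fa; exact: is_deriveZ. Qed.

Lemma is_derive_opp f (x a : R) : is_derive x 1 f a ->
  is_derive x 1 (fun y => - f y) (- a).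
Proof. exact: is_deriveN. Qed.

Lemma is_derive_compose f g (x a b : R) : is_derive (g x) 1 f a ->
  is_derive x 1 g b -> is_derive x 1 (fun y => f (g y)) (a * b).
Proof. exact: is_derive1_comp. Qed.

Lemma is_derive_const (k x : R) : is_derive x 1 (fun=> k) 0.
Proof. exact: is_derive_cst. Qed.

Lemma is_derive_val f (x a b : R) : is_derive x 1 f a -> a = b -> is_derive x 1 f b.
Proof. by move=> H <-. Qed.

Lemma is_derive_continuous f (x a : R) : is_derive x 1 f a -> {for x, continuous f}.
Proof.
by case=> H _; apply: differentiable_continuous; apply/derivable1_diffP.
Qed.

Lemma intg_cont (f : R -> R) (a b : R) : continuous f -> intg `[a, b] f.
Proof.
move=> cf; apply: continuous_compact_integrable; first exact: segment_compact.
exact: continuous_subspaceT.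
Qed.

Lemma FTC (F f : R -> R) (a b : R) : a <= b -> (forall x : R, is_derive x 1 F (f x)) ->
  continuous f -> \int[mu]_(x in `[a, b]) f x = F b - F a.
Proof.
rewrite le_eqVlt => /predU1P[->|ab] dF cf.
  by rewrite set_itv1 Rintegral_set1 subrr.
have dFx x : derivable F x 1 by case: (dF x).
have cF : continuous F.
  by move=> x; apply: differentiable_continuous; apply/derivable1_diffP.
rewrite /Rintegral (@continuous_FTC2 _ f F)//.
- exact: continuous_subspaceT.
- split; first by move=> x _.
  + exact: cvg_at_right_filter (cF a).
  + exact: cvg_at_left_filter (cF b).
- by move=> x _; rewrite derive1E; case: (dF x).
Qed.

Lemma normr_sin_le (u : R) : `|sin u| <= `|u|.
Proof.
wlog u0 : u / 0 <= u => [H|].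
  have [/H//|/ltW u0] := leP 0 u.
  by rewrite -normrN -sinN -[leRHS]normrN; apply: H; rewrite oppr_ge0.
have [|c _] := @MVT_segment R sin cos 0 u u0 (fun x _ => is_derive_sin x).
  by apply: continuous_subspaceT; exact: continuous_sin.
rewrite sin0 !subr0 => ->; rewrite normrM ler_piMl//.
by rewrite ler_norml cos_geN1 cos_le1.
Qed.

End FTC.

(** * The kernel of the weighted frequency cutoff *)

Section Kernel.
Context {R : realType}.
Local Notation mu := (@lebesgue_measure R).

(* M^2 times the Fourier transform of the weight [1 - (xi / M)^2] on [[-M, M]]. *)
Definition fejer (M z : R) := \int[mu]_(xi in `[- M, M]) (cos (z * xi) * (M ^+ 2 - xi ^+ 2)).

Lemma continuous_Kint (M z : R) : continuous (fun xi : R => cos (z * xi) * (M ^+ 2 - xi ^+ 2)).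
Proof.
move=> x; apply: cvgM.
  apply: continuous_comp; last exact: continuous_cos.
  by apply: cvgM; [exact: cvg_cst|exact: cvg_id].
by apply: cvgB; [exact: cvg_cst|apply: (cvgM cvg_id cvg_id)].
Qed.

Lemma K_cst (M z : R) : 0 < M -> `|fejer M z| <= 2 * M ^+ 3.
Proof.
move=> M0.
have i1 := @intg_cont R _ (-M) M (@continuous_Kint M z).
apply: le_trans (le_normr_Rintegral _ _) _ => //.
apply: (@le_trans _ _ (\int[mu]_(x in `[- M, M]) M ^+ 2)).
  apply: le_Rintegral => //.
  - exact: intg_norm.
  - by apply: intg_cont; exact: cst_continuous.
  move=> x; rewrite /= in_itv /= => /andP[x1 x2]; rewrite normrM.
  have x3 : 0 <= M ^+ 2 - x ^+ 2 by nra.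
  rewrite (ger0_norm x3).
  have : `|cos (z * x)| <= 1 by rewrite ler_norml cos_geN1 cos_le1.
  nra.
have dF (x : R) : is_derive x 1 (fun x => M ^+ 2 * x) (M ^+ 2).
  by apply: (is_derive_val (is_derive_scale _ (is_derive_id x 1))); rewrite mulr1.
have MM : - M <= M by lra.
rewrite (FTC MM dF); last exact: cst_continuous.
by rewrite le_eqVlt; apply/orP; left; apply/eqP; ring.
Qed.

(** The weight vanishes at the endpoints, so the boundary term of order [1 / z] drops out and the
    kernel decays like [z^-2]. The unweighted cutoff has kernel [2 sin (M z) / z], which is not
    absolutely integrable. *)
Lemma K_val (M z : R) : 0 < M -> z != 0 ->
  fejer M z = 4 * sin (z * M) / z ^+ 3 - 4 * M * cos (z * M) / z ^+ 2.
Proof.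
move=> M0 z0.
(* Primitive found by integrating by parts twice; its first term is zero at both endpoints. *)
pose F x := (M ^+ 2 - x ^+ 2) * (z^-1 * sin (z * x)) - (2 * x) * (z^-2 * cos (z * x))
   + (2 * z^-1 ^+ 3) * sin (z * x).
have dF (x : R) : is_derive x 1 F (cos (z * x) * (M ^+ 2 - x ^+ 2)).
  have dl : is_derive x 1 (fun x => z * x) z.
    by apply: (is_derive_val (is_derive_scale z (is_derive_id x 1))); rewrite mulr1.
  have ds : is_derive x 1 (fun x => sin (z * x)) (cos (z * x) * z).
    exact: (is_derive_compose (is_derive_sin (z * x)) dl).
  have dc : is_derive x 1 (fun x => cos (z * x)) (- sin (z * x) * z).
    exact: (is_derive_compose (is_derive_cos (z * x)) dl).
  have dq : is_derive x 1 (fun x => M ^+ 2 - x ^+ 2) (0 - (1 * x + x * 1)).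
    exact: (is_derive_add (is_derive_const (M ^+ 2) x) (is_derive_opp (is_derive_mul (is_derive_id x 1) (is_derive_id x 1)))).
  have d2 : is_derive x 1 (fun x => 2 * x) (2 * 1) by exact: (is_derive_scale 2 (is_derive_id x 1)).
  apply: (is_derive_val (is_derive_add (is_derive_add
     (is_derive_mul dq (is_derive_scale _ ds))
     (is_derive_opp (is_derive_mul d2 (is_derive_scale _ dc)))) (is_derive_scale _ ds))).
  by field.
have MM : - M <= M by lra.
rewrite /fejer (FTC MM dF); last exact: continuous_Kint.
by rewrite /F mulrN sinN cosN; field.
Qed.

(** Sum of two estimates: [|fejer M z| <= 2 M ^ 3] from the size of the integrand, and
    [|fejer M z| (M z) ^ 2 <= 8 M ^ 3] from the closed form together with [|sin u| <= |u|]. *)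
Lemma K_bound (M z : R) : 0 < M -> `|fejer M z| <= 10 * M ^+ 3 / (1 + (M * z) ^+ 2).
Proof.
move=> M0; rewrite ler_pdivlMr; last by rewrite ltr_wpDr ?sqr_ge0.
rewrite mulrDr mulr1; have h1 := @K_cst M z M0.
suff h2 : `|fejer M z| * (M * z) ^+ 2 <= 8 * M ^+ 3 by lra.
have [->|z0] := eqVneq z 0; first by rewrite mulr0 expr0n mulr0 mulr_ge0// exprn_ge0// ltW.
suff h2 : `|fejer M z| * z ^+ 2 <= 8 * M.
  have := ler_wpM2l (sqr_ge0 M) h2; lra.
rewrite -(ger0_norm (sqr_ge0 z)) -normrM K_val//.
have -> : (4 * sin (z * M) / z ^+ 3 - 4 * M * cos (z * M) / z ^+ 2) * z ^+ 2 =
   4 * (sin (z * M) / z) - 4 * M * cos (z * M) by field.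
apply: le_trans (ler_normB _ _) _.
have h3 : `|sin (z * M) / z| <= M.
  rewrite normrM normfV ler_pdivrMr ?normr_gt0//.
  by apply: le_trans (normr_sin_le _) _; rewrite normrM mulrC (gtr0_norm M0).
have h4 : `|cos (z * M)| <= 1 by rewrite ler_norml cos_geN1 cos_le1.
have -> : `|4 * (sin (z * M) / z)| = 4 * `|sin (z * M) / z|.
  by rewrite normrM ger0_norm.
have -> : `|4 * M * cos (z * M)| = 4 * M * `|cos (z * M)|.
  by rewrite normrM ger0_norm// mulr_ge0// ltW.
nra.
Qed.

Definition fejer_bound (M z : R) := 10 * M ^+ 3 / (1 + (M * z) ^+ 2).

Lemma kk_ge0 M z : 0 < M -> 0 <= fejer_bound M z.
Proof.
move=> M0; rewrite /fejer_bound divr_ge0 ?mulr_ge0 ?exprn_ge0 ?(ltW M0)//.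
by rewrite addr_ge0 ?sqr_ge0.
Qed.

Lemma kk_cont M : continuous (fejer_bound M).
Proof.
move=> z; rewrite /fejer_bound; apply: cvgM; first exact: cvg_cst.
apply: cvgV; first by rewrite gt_eqF// ltr_wpDr ?sqr_ge0.
apply: cvgD; first exact: cvg_cst.
have h : M * y @[y --> z] --> M * z by apply: cvgM; [exact: cvg_cst|exact: cvg_id].
exact: (cvgM h h).
Qed.

(** The row sum for Schur's test. An arctangent is a primitive and its variation is at most [pi], so
    the bound depends neither on [x] nor on [c]. *)
Lemma kk_int M x c : 0 < M -> 0 <= c ->
  \int[mu]_(y in `[-c, c]) fejer_bound M (x - y) <= 10 * pi * M ^+ 2.
Proof.
move=> M0 c0.
have dF (y : R) : is_derive y 1 (fun y => (- (10 * M ^+ 2)) * atan (M * (x - y))) (fejer_bound M (x - y)).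
  have dl : is_derive y 1 (fun y => M * (x - y)) (M * (0 - 1)).
    exact: (is_derive_scale M (is_derive_add (is_derive_const x y) (is_derive_opp (is_derive_id y 1)))).
  apply: (is_derive_val (is_derive_scale _ (is_derive_compose (is_derive1_atan _) dl))).
  rewrite /fejer_bound; field; by rewrite gt_eqF// ltr_wpDr ?sqr_ge0.
have cc : - c <= c by lra.
rewrite (FTC cc dF).
  have := atan_ltpi2 (M * (x - - c)); have := atan_gtNpi2 (M * (x - c)).
  have : 0 < M ^+ 2 by rewrite exprn_gt0.
  move: (atan _) (atan _) (M ^+ 2) => u v m; nra.
move=> y; apply: (@continuous_comp _ _ _ (fun y => x - y) (fejer_bound M)); last exact: kk_cont.
by apply: cvgB; [exact: cvg_cst|exact: cvg_id].
Qed.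

End Kernel.

(** * Truncated transforms and Schur's test *)

Section TrigTransform.
Context {R : realType}.
Local Notation mu := (@lebesgue_measure R).

Definition trigT (tr : R -> R) (c : R) (a : R -> R) (xi : R) : R :=
  \int[mu]_(x in `[- c, c]) (tr (x * xi) * a x).

Definition trig (tr : R -> R) := continuous tr /\ forall x, `|tr x| <= 1.

Lemma trig_cos : trig cos.
Proof.
split; first exact: continuous_cos.
by move=> x; rewrite ler_norml cos_geN1 cos_le1.
Qed.

Lemma trig_sin : trig sin.
Proof.
split; first exact: continuous_sin.
by move=> x; rewrite ler_norml sin_geN1 sin_le1.
Qed.

Lemma half_le (u v w : R) : u <= w -> v <= w -> 2^-1 * (u + v) <= w.
Proof. lra. Qed.

(** The inequality [2 |p| |q| <= p ^ 2 + q ^ 2] weighted by [k]. The factor 1 stays visible because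
    both halves are then instances of one Fubini statement, with one of the two functions equal to
    1. *)
Lemma schur_pointwise (k p q : R) : 0 <= k ->
  `|p| * (k * `|q|) <= 2^-1 * (p ^+ 2 * (k * 1) + k * q ^+ 2).
Proof.
move=> k0; rewrite -(real_normK (num_real p)) -(real_normK (num_real q)).
move: (`|p|) (`|q|) => {}p {}q; have := mulr_ge0 k0 (sqr_ge0 (p - q)); lra.
Qed.

Section fixed.
Variables (tr : R -> R) (c : R) (a : R -> R).
Hypotheses (htr : trig tr) (ia : intg `[- c, c] a).

Lemma trig_meas2 : measurable_fun [set: R * R] (fun z => tr (z.1 * z.2)).
Proof.
apply: (measurableT_comp (f := tr)); first exact: continuous_measurable_fun htr.1.
by apply: measurable_funM; [exact: measurable_fst|exact: measurable_snd].
Qed.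

Lemma trig_meas2' : measurable_fun [set: R * R] (fun z => tr (z.2 * z.1)).
Proof.
apply: (measurableT_comp (f := tr)); first exact: continuous_measurable_fun htr.1.
by apply: measurable_funM; [exact: measurable_snd|exact: measurable_fst].
Qed.

Lemma trig_mul_cont (x : R) : continuous (fun y : R => tr (x * y)).
Proof.
move=> y; apply: (@continuous_comp _ _ _ (fun y : R => x * y) tr); last exact: htr.1.
by apply: cvgM; [exact: cvg_cst|exact: cvg_id].
Qed.

Lemma trig_mul_cont' (x : R) : continuous (fun y : R => tr (y * x)).
Proof. by under eq_fun do rewrite mulrC; exact: trig_mul_cont. Qed.

Lemma trigT_intg xi : intg `[- c, c] (fun x => tr (x * xi) * a x).
Proof.
apply: intg_bndM => //.
  by apply: measurable_funTS; apply: continuous_measurable_fun; exact: trig_mul_cont'.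
by exists 1 => x _; exact: htr.2.
Qed.

Lemma trigT_cont : continuous (trigT tr c a).
Proof.
move=> xi.
have := @continuity_under_integral R _ _ mu (fun l x => tr (x * l) * a x)
  `[- c, c]%classic _ (xi - 1) (xi + 1) _ _ (fun x => `|a x|) _ _.
apply => //.
- by move=> l _; exact: trigT_intg.
- apply: aeW => x _ l _.
  apply: cvgM; last exact: cvg_cst.
  exact: trig_mul_cont.
- exact: intg_norm.
- move=> l _; apply: aeW => x _; rewrite normrM ler_piMl//; exact: htr.2.
- by rewrite inE /= in_itv /=; apply/andP; split; lra.
Qed.

End fixed.

Section bound.
Variables (c M : R) (a : R -> R).
Hypotheses (c0 : 0 <= c) (M0 : 0 < M) (ia : intg `[- c, c] a)
  (ia2 : intg `[- c, c] (fun x => a x ^+ 2)).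
Let w (xi : R) := M ^+ 2 - xi ^+ 2.

Let w_cont : continuous w.
Proof.
by move=> x; apply: cvgB; [exact: cvg_cst|apply: (cvgM cvg_id cvg_id)].
Qed.

Let Kt tr x y := \int[mu]_(xi in `[- M, M]) (tr (y * xi) * (tr (x * xi) * w xi)).

Let iw tr x : trig tr -> intg `[- M, M] (fun xi => tr (x * xi) * w xi).
Proof.
move=> ht; apply: intg_cont => xi; apply: cvgM; last exact: w_cont.
exact: trig_mul_cont.
Qed.

Let iww tr x y : trig tr -> intg `[- M, M] (fun xi => tr (y * xi) * (tr (x * xi) * w xi)).
Proof.
move=> ht; apply: intg_cont => xi; apply: cvgM; first exact: trig_mul_cont.
by apply: cvgM; [exact: trig_mul_cont|exact: w_cont].
Qed.

Let inner tr x : trig tr ->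
  \int[mu]_(xi in `[- M, M]) (tr (x * xi) * (w xi * trigT tr c a xi)) =
  \int[mu]_(y in `[- c, c]) (a y * Kt tr x y) /\
  intg `[- c, c] (fun y => a y * Kt tr x y).
Proof.
move=> ht.
have [e i] := @fubini_mul R `[- c, c] `[- M, M] a (fun xi => tr (x * xi) * w xi)
  (fun y xi => tr (y * xi)) 1 (measurable_itv _) (measurable_itv _) ia (iw x ht)
  (trig_meas2 ht) (fun x y => ht.2 _).
split; last exact: i.
by rewrite e; apply: eq_Rintegral => xi _; rewrite mulrA.
Qed.

(** One factor of the square is written as an integral and exchanged, and [inner] treats the other
    factor in the same way: the weighted energy becomes a quadratic form in [a] with kernel [Kt]. *)
Let outer tr : trig tr ->
  \int[mu]_(xi in `[- M, M]) (w xi * trigT tr c a xi ^+ 2) =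
  \int[mu]_(x in `[- c, c]) (a x * \int[mu]_(y in `[- c, c]) (a y * Kt tr x y)) /\
  intg `[- c, c] (fun x => a x * \int[mu]_(y in `[- c, c]) (a y * Kt tr x y)).
Proof.
move=> ht.
have ig : intg `[- M, M] (fun xi => w xi * trigT tr c a xi).
  apply: intg_cont => xi; apply: cvgM; first exact: w_cont.
  exact: trigT_cont.
have [e i] := @fubini_mul R `[- c, c] `[- M, M] a _ (fun y xi => tr (y * xi)) 1
  (measurable_itv _) (measurable_itv _) ia ig (trig_meas2 ht) (fun x y => ht.2 _).
have E x : \int[mu]_(y in `[- M, M]) (tr (x * y) * (w y * trigT tr c a y)) =
  \int[mu]_(y in `[- c, c]) (a y * Kt tr x y) by case: (inner x ht).
split; last by move: i; congr (intg _ _); apply/funext => x; rewrite E.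
transitivity (\int[mu]_(x in `[- c, c]) (a x * \int[mu]_(y in `[- M, M]) (tr (x * y) * (w y * trigT tr c a y)))).
  by rewrite e; apply: eq_Rintegral => xi _; rewrite expr2 mulrA.
by apply: eq_Rintegral => x _; rewrite E.
Qed.

(** By the addition formula the cosine and sine kernels depend on [x - y] only after summation; this
    is why both transforms are estimated at once. *)
Let KtD x y : Kt cos x y + Kt sin x y = fejer M (x - y).
Proof.
rewrite /Kt -RintegralD//; [|exact: (iww _ _ trig_cos)|exact: (iww _ _ trig_sin)].
apply: eq_Rintegral => xi _; rewrite mulrBl cosB; rewrite /w; ring.
Qed.

Let kk_meas2 : measurable_fun [set: R * R] (fun z => fejer_bound M (z.1 - z.2)).
Proof.
apply: (measurableT_comp (f := fejer_bound M)).
  by apply: continuous_measurable_fun; exact: kk_cont.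
by apply: measurable_funB; [exact: measurable_fst|exact: measurable_snd].
Qed.

Let kk_bnd x y : `|fejer_bound M (x - y)| <= 10 * M ^+ 3.
Proof.
rewrite ger0_norm ?kk_ge0// /fejer_bound ler_pdivrMr; last by rewrite ltr_wpDr ?sqr_ge0.
have : 0 < M ^+ 3 by rewrite exprn_gt0.
by have := sqr_ge0 (M * (x - y)); nra.
Qed.

Let kkE z : fejer_bound M (- z) = fejer_bound M z.
Proof. by rewrite /fejer_bound mulrN sqrrN. Qed.

Let ikk x f : intg `[- c, c] f -> intg `[- c, c] (fun y => fejer_bound M (x - y) * f y).
Proof.
move=> If; apply: intg_bndM => //.
  exact: measurable_funTS (measurableT_comp kk_meas2 (measurable_pair1 x)).
by exists (10 * M ^+ 3) => y _; exact: kk_bnd.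
Qed.

Let i1 : intg `[- c, c] (fun=> 1 : R).
Proof. by apply: intg_cont; exact: cst_continuous. Qed.

Let Fk h g (ih : intg `[- c, c] h) (ig : intg `[- c, c] g) :=
  @fubini_mul R `[- c, c] `[- c, c] h g (fun x y => fejer_bound M (x - y)) _
   (measurable_itv _) (measurable_itv _) ih ig kk_meas2 kk_bnd.

(** Schur's test: the pointwise inequality replaces the quadratic form by two integrals of [a ^ 2]
    against row and column sums of the dominating kernel. *)
Lemma schur : `|\int[mu]_(x in `[- c, c]) (a x * \int[mu]_(y in `[- c, c]) (a y * fejer M (x - y)))|
  <= 10 * pi * M ^+ 2 * \int[mu]_(x in `[- c, c]) (a x ^+ 2).
Proof.
have [e1 o1] := outer trig_cos; have [e2 o2] := outer trig_sin.
have Ein x : \int[mu]_(y in `[- c, c]) (a y * Kt cos x y) +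
    \int[mu]_(y in `[- c, c]) (a y * Kt sin x y) =
    \int[mu]_(y in `[- c, c]) (a y * fejer M (x - y)).
  rewrite -(RintD (measurable_itv _) (inner x trig_cos).2 (inner x trig_sin).2).
  by apply: eq_Rintegral => y _; rewrite -mulrDr KtD.
have iin x : intg `[- c, c] (fun y => a y * fejer M (x - y)).
  have := intgD (measurable_itv _) (inner x trig_cos).2 (inner x trig_sin).2.
  by congr (intg _ _); apply/funext => y; rewrite -mulrDr KtD.
have iout : intg `[- c, c] (fun x => a x * \int[mu]_(y in `[- c, c]) (a y * fejer M (x - y))).
  have := intgD (measurable_itv _) o1 o2.
  by congr (intg _ _); apply/funext => y; rewrite -mulrDr Ein.
apply: le_trans (le_normr_Rintegral _ _) _ => //.
(* [F1] contains a row sum. [F2] is reduced to the same estimate by Fubini and the evenness of the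
   kernel. *)
pose F1 x := a x ^+ 2 * \int[mu]_(y in `[- c, c]) (fejer_bound M (x - y) * 1).
pose F2 x := 1 * \int[mu]_(y in `[- c, c]) (fejer_bound M (x - y) * (a y ^+ 2)).
have iF1 : intg `[- c, c] F1 by exact: (Fk ia2 i1).2.
have iF2 : intg `[- c, c] F2 by exact: (Fk i1 ia2).2.
apply: (@le_trans _ _ (\int[mu]_(x in `[- c, c]) (2^-1 * (F1 x + F2 x)))).
  apply: le_Rintegral => //; first exact: intg_norm.
    by apply: intgZ => //; exact: intgD.
  move=> x _; rewrite normrM.
  apply: (@le_trans _ _ (`|a x| * \int[mu]_(y in `[- c, c]) (fejer_bound M (x - y) * `|a y|))).
    rewrite ler_wpM2l//; have H := @le_normr_Rintegral _ _ R mu `[- c, c] _ (measurable_itv _) (iin x).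
    apply: (le_trans H).
    apply: le_Rintegral => //; first exact: intg_norm.
      by apply: ikk; exact: intg_norm.
    move=> y _; rewrite normrM mulrC ler_wpM2r//; exact: K_bound.
  rewrite -RintegralZl//; last by apply: ikk; exact: intg_norm.
  rewrite /F1 /F2 mul1r -RintegralZl//; last exact: ikk.
  rewrite -RintegralD//; [|by apply: intgZ => //; exact: ikk|exact: ikk].
  rewrite -RintegralZl//; last by apply: intgD => //; [apply: intgZ => //|]; exact: ikk.
  apply: le_Rintegral => //.
  - by apply: intgZ => //; apply: ikk; exact: intg_norm.
  - by apply: intgZ => //; apply: intgD => //; [apply: intgZ => //|]; exact: ikk.
  move=> y _; have k0 := kk_ge0 (x - y) M0.
  exact: schur_pointwise.
rewrite (RintZ _ (measurable_itv _) (intgD (measurable_itv _) iF1 iF2)).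
rewrite (RintD (measurable_itv _) iF1 iF2).
have pM : 0 <= 10 * pi * M ^+ 2 by rewrite !mulr_ge0// ?pi_ge0// ltW.
have H1 : \int[mu]_(x in `[- c, c]) F1 x <= 10 * pi * M ^+ 2 * \int[mu]_(x in `[- c, c]) (a x ^+ 2).
  rewrite -RintegralZl//; apply: le_Rintegral => //; first exact: intgZ.
  move=> x _; rewrite /F1 mulrC ler_wpM2r ?sqr_ge0//.
  by under eq_Rintegral do rewrite mulr1; exact: kk_int.
have H2 : \int[mu]_(x in `[- c, c]) F2 x <= 10 * pi * M ^+ 2 * \int[mu]_(x in `[- c, c]) (a x ^+ 2).
  rewrite /F2 (Fk i1 ia2).1.
  rewrite -RintegralZl//; apply: le_Rintegral => //.
  - have := (Fk ia2 i1).2; congr (intg _ _); apply/funext => y; congr (_ * _).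
    by apply: eq_Rintegral => x _; rewrite -opprB kkE.
  - exact: intgZ.
  move=> x _; rewrite mulrC ler_wpM2r ?sqr_ge0//.
  by under eq_Rintegral do rewrite mulr1 -opprB kkE; exact: kk_int.
exact: (half_le H1 H2).
Qed.

Lemma trigT_weight_bound :
  \int[mu]_(xi in `[- M, M]) (w xi * (trigT cos c a xi ^+ 2 + trigT sin c a xi ^+ 2))
  <= 10 * pi * M ^+ 2 * \int[mu]_(x in `[- c, c]) (a x ^+ 2).
Proof.
have [e1 o1] := outer trig_cos; have [e2 o2] := outer trig_sin.
have iT tr : trig tr -> intg `[- M, M] (fun xi => w xi * trigT tr c a xi ^+ 2).
  move=> ht; apply: intg_cont => xi; apply: cvgM; first exact: w_cont.
  by apply: cvgM; exact: trigT_cont.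
under eq_Rintegral do rewrite mulrDr.
rewrite RintegralD//; [|exact: (iT _ trig_cos)|exact: (iT _ trig_sin)].
rewrite e1 e2 -(RintD (measurable_itv _) o1 o2).
apply: le_trans (ler_norm _) _; apply: le_trans _ schur.
rewrite le_eqVlt; apply/orP; left; apply/eqP; congr (`| _ |).
apply: eq_Rintegral => x _; rewrite -mulrDr; congr (_ * _).
rewrite -(RintD (measurable_itv _) (inner x trig_cos).2 (inner x trig_sin).2).
by apply: eq_Rintegral => y _; rewrite -mulrDr KtD.
Qed.

End bound.
End TrigTransform.

Opaque Rintegral n2.

(** * Limits in L^2 *)

Section L2lim.
Context {R : realType}.
Local Notation mu := (@lebesgue_measure R).
Implicit Types (a b f g : R -> R).

Lemma cvgD0 (u v : nat -> R) : u n @[n --> \oo] --> 0 -> v n @[n --> \oo] --> 0 ->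
  u n + v n @[n --> \oo] --> 0.
Proof. by move=> cu cv; rewrite -[X in _ --> X]addr0; exact: cvgD. Qed.

Lemma cvgM0 (k : R) (u : nat -> R) : u n @[n --> \oo] --> 0 ->
  k * u n @[n --> \oo] --> 0.
Proof.
by move=> cu; rewrite -[X in _ --> X](mulr0 k); apply: cvgM => //; exact: cvg_cst.
Qed.

Lemma cvg0_ge (u : nat -> R) c : u n @[n --> \oo] --> 0 -> (forall n, c <= u n) -> c <= 0.
Proof.
move=> cu le; rewrite -(cvg_lim _ cu)//; apply: limr_ge; first exact: cvgP cu.
exact: nearW.
Qed.

Lemma cvg0_le (u v : nat -> R) : (forall n, 0 <= u n <= v n) ->
  v n @[n --> \oo] --> 0 -> u n @[n --> \oo] --> 0.
Proof.
move=> le cv; apply: squeeze_cvgr cv; last exact: cvg_cst.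
exact: nearW.
Qed.

Definition L2lim (f_ : nat -> R -> R) a := sq a /\ n2 (fun x => f_ n x - a x) @[n --> \oo] --> 0.

Lemma L2lim_le (f_ : nat -> R -> R) a (e_ : nat -> R) : sq a -> (forall n, n2 (fun x => f_ n x - a x) <= e_ n) ->
  e_ n @[n --> \oo] --> 0 -> L2lim f_ a.
Proof.
move=> sa le ce; split=> //; apply: cvg0_le ce => n.
by rewrite n2_ge0 le.
Qed.

Lemma L2lim_unique (f_ : nat -> R -> R) a b : (forall n, sq (f_ n)) -> L2lim f_ a -> L2lim f_ b ->
  a = b %[ae mu].
Proof.
move=> sf [sa ca] [sb cb].
have : n2 (fun x => a x - b x) = 0.
  apply/eqP; rewrite eq_le n2_ge0 andbT.
  apply: (cvg0_ge (cvgD0 ca cb)) => n.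
  by rewrite [X in X + _]n2_subC; exact: n2_triangleB.
move=> /(n2_eq0 (sqB sa sb)); apply: ae_imp => x /(_ I) /= /eqP.
by rewrite subr_eq0 => /eqP.
Qed.

Lemma L2limD (f_ g_ : nat -> R -> R) a b : (forall n, sq (f_ n)) -> (forall n, sq (g_ n)) ->
  L2lim f_ a -> L2lim g_ b -> L2lim (fun n x => f_ n x + g_ n x) (fun x => a x + b x).
Proof.
move=> sf sg [sa ca] [sb cb]; apply: (L2lim_le (sqD sa sb)) (cvgD0 ca cb).
move=> n /=; have := n2_triangle (sqB (sf n) sa) (sqB (sg n) sb).
by congr (n2 _ <= _); apply/funext => x; ring.
Qed.

Lemma L2limZ (f_ : nat -> R -> R) a k : (forall n, sq (f_ n)) ->
  L2lim f_ a -> L2lim (fun n x => k * f_ n x) (fun x => k * a x).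
Proof.
move=> sf [sa ca]; apply: (L2lim_le (sqZ k sa) (e_ := fun n => `|k| * n2 (fun x => f_ n x - a x))).
  move=> n; rewrite -n2Z; last exact: sqB.
  by under eq_fun do rewrite -mulrBr.
exact: cvgM0.
Qed.

Lemma L2limB (f_ g_ : nat -> R -> R) a b : (forall n, sq (f_ n)) -> (forall n, sq (g_ n)) ->
  L2lim f_ a -> L2lim g_ b -> L2lim (fun n x => f_ n x - g_ n x) (fun x => a x - b x).
Proof.
move=> sf sg la lb; have := L2limD sf (fun n => sqZ (-1) (sg n)) la (L2limZ (-1) sg lb).
congr L2lim; first by apply/funext => n; apply/funext => x; rewrite mulN1r.
by apply/funext => x; rewrite mulN1r.
Qed.

Lemma L2lim_bound (f_ : nat -> R -> R) a e : (forall n, sq (f_ n)) -> L2lim f_ a ->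
  (forall n, n2 (f_ n) <= e) -> n2 a <= e.
Proof.
move=> sf [sa ca] le.
have h n : n2 a <= n2 (fun x => f_ n x - a x) + e.
  apply: le_trans (_ : n2 (fun x => f_ n x - a x) + n2 (f_ n) <= _); last by rewrite lerD2l.
  have := n2_triangle (sqN (sqB (sf n) sa)) (sf n); rewrite n2N.
  by congr (n2 _ <= _); apply/funext => x; ring.
rewrite -subr_le0; apply: (cvg0_ge ca) => n.
by rewrite lerBlDr.
Qed.

Lemma indic_itv_sqr (D : set R) (x : R) : (\1_D x : R) ^+ 2 = \1_D x.
Proof. by rewrite indicE; case: (_ \in _); rewrite ?expr1n ?expr0n. Qed.

Lemma indic_le1 (D : set R) (x : R) : `|\1_D x : R| <= 1.
Proof. by rewrite indicE; case: (_ \in _); rewrite ?normr1 ?normr0. Qed.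

Lemma sq_indic D a : measurable D -> sq a -> sq (fun x => a x * \1_D x).
Proof.
move=> mD sa; apply: (sq_le _ _ sa).
  by apply: measurable_funM; [case: sa|exact: measurable_indic].
by move=> x; rewrite normrM ler_piMr// indic_le1.
Qed.

Lemma n2_indic_le D a : measurable D -> sq a -> n2 (fun x => a x * \1_D x) <= n2 a.
Proof.
move=> mD sa; apply: n2_le => //; first exact: sq_indic.
by move=> x; rewrite normrM ler_piMr// indic_le1.
Qed.

Lemma n2_indic D a : n2 (fun x => a x * \1_D x) ^+ 2 = \int[mu]_(x in D) (a x ^+ 2).
Proof.
rewrite n2_sqr [RHS]Rint_restrict; apply: eq_Rintegral => x _.
by rewrite exprMn indic_itv_sqr.
Qed.

Lemma intg_itv_cst (u v k : R) : intg `[u, v] (fun=> k).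
Proof. by apply: intg_cont; exact: cst_continuous. Qed.

Lemma sq_intg (u v : R) a : sq a -> intg `[u, v] a.
Proof.
move=> [ma ia]; apply: (@intg_le _ _ _ (fun x => 1 + a x ^+ 2)) => //.
- exact: measurable_funTS.
- move=> x _; rewrite [leRHS]ger0_norm ?addr_ge0 ?sqr_ge0//.
  by have := sqr_ge0 (`|a x| - 1); rewrite -(real_normK (num_real (a x))); nra.
apply: intgD => //; first exact: intg_itv_cst.
exact: intg_sub ia.
Qed.

Lemma sq_intg2 D a : measurable D -> sq a -> intg D (fun x => a x ^+ 2).
Proof. by move=> mD [ma ia]; exact: intg_sub ia. Qed.

Lemma sq_bounded_itv (u v : R) f : continuous f -> sq (fun x => f x * \1_(`[u, v]%classic) x).
Proof.
move=> cf; have mf := continuous_measurable_fun cf.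
split; first by apply: measurable_funM => //; exact: measurable_indic.
under eq_fun do rewrite exprMn indic_itv_sqr.
have c2 : continuous (fun x => f x ^+ 2) by move=> x; exact: (cvgM (cf x) (cf x)).
exact/(intg_restrict _ (measurable_itv _))/(intg_cont u v c2).
Qed.

Lemma Nball_ge (x : R) : \forall n \near \oo, x \in `[- n%:R, n%:R].
Proof.
near=> n; rewrite in_itv /= -ler_norml; near: n; exact: nbhs_infty_ger.
Unshelve. all: by end_near. Qed.

Lemma cvg_indic (x : R) : (\1_(`[- n%:R, n%:R]%classic) x : R) @[n --> \oo] --> (1 : R).
Proof.
apply: cvg_near_cst; near=> n; rewrite indicE mem_set//=.
by near: n; exact: Nball_ge.
Unshelve. all: by end_near. Qed.

Lemma L2lim_trunc a : sq a -> L2lim (fun n x => a x * \1_(`[- n%:R, n%:R]%classic) x) a.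
Proof.
move=> sa; split=> //.
apply: (n2_dct _ _ (sq_norm sa) _).2.
- by move=> n; exact: sq_indic.
- move=> x; rewrite -[X in _ --> X]mulr1; apply: cvgM; first exact: cvg_cst.
  exact: cvg_indic.
- by move=> n x; rewrite normrM ler_piMr// indic_le1.
Qed.

End L2lim.

(** * Boundedness and convergence of the cosine and sine transforms on L^2 *)

Section Plancherel.
Context {R : realType}.
Local Notation mu := (@lebesgue_measure R).
Implicit Types (a b : R -> R).

(** Under the root: the Schur constant [10 pi (2 M) ^ 2] at scale [2 M], divided by the lower bound
    [3 M ^ 2] of the weight. *)
Definition CF : R := Num.sqrt (40 * pi / 3).

Lemma CF_ge0 : 0 <= CF. Proof. exact: sqrtr_ge0. Qed.

(** The weight of scale [2 M] is nonnegative on [[-2 M, 2 M]] and at least [3 M ^ 2] on [[-M, M]],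
    so the weighted bound at scale [2 M] controls the sharp cutoff at [M]. *)
Lemma trigT_half_bound (c M : R) a : 0 <= c -> 0 < M -> sq a ->
  \int[mu]_(xi in `[- M, M]) (trigT cos c a xi ^+ 2 + trigT sin c a xi ^+ 2) <=
  40 * pi / 3 * \int[mu]_(x in `[- c, c]) (a x ^+ 2).
Proof.
move=> c0 M0 sa.
have ia := sq_intg (- c) c sa.
have ia2 : intg `[- c, c] (fun x => a x ^+ 2) by exact: sq_intg2.
have M20 : 0 < 2 * M by rewrite mulr_gt0.
pose f (xi : R) := trigT cos c a xi ^+ 2 + trigT sin c a xi ^+ 2.
pose g (xi : R) := ((2 * M) ^+ 2 - xi ^+ 2) * f xi.
have H : \int[mu]_(xi in `[- (2 * M), 2 * M]) g xi <=
   10 * pi * (2 * M) ^+ 2 * \int[mu]_(x in `[- c, c]) (a x ^+ 2).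
  exact: trigT_weight_bound c0 M20 ia ia2.
have cT (tr : R -> R) : trig tr -> continuous (fun xi => trigT tr c a xi ^+ 2).
  by move=> ht xi; apply: cvgM; exact: trigT_cont.
have cTT : continuous f.
  by move=> xi; apply: cvgD; apply: cT; [exact: trig_cos|exact: trig_sin].
have cw : continuous (fun xi : R => (2 * M) ^+ 2 - xi ^+ 2).
  by move=> x; apply: cvgB; [exact: cvg_cst|apply: (cvgM cvg_id cvg_id)].
have cwf : continuous g.
  by move=> xi; apply: cvgM; [exact: cw|exact: cTT].
have f0 xi : 0 <= f xi by rewrite addr_ge0// sqr_ge0.
have : 3 * M ^+ 2 * \int[mu]_(xi in `[- M, M]) f xi <=
   10 * pi * (2 * M) ^+ 2 * \int[mu]_(x in `[- c, c]) (a x ^+ 2).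
  apply: le_trans H; rewrite -RintZ//; last exact: intg_cont.
  rewrite Rint_restrict [leRHS]Rint_restrict.
  apply: Rint_le => //.
  - by apply: (intg_restrict _ (measurable_itv _)).1; apply: intgZ => //; exact: intg_cont.
  - by apply: (intg_restrict _ (measurable_itv _)).1; exact: intg_cont.
  move=> x _; rewrite /g !indicE.
  have [xM|xM] := boolP (x \in `[- M, M]%classic); last first.
    rewrite mulr0; have [xM2|_] := boolP (_ \in _); last by rewrite mulr0.
    rewrite mulr1 mulr_ge0//.
    move: xM2; rewrite inE /= in_itv /= => /andP[? ?].
    have : 0 <= (2 * M - x) * (2 * M + x) by rewrite mulr_ge0//; lra.
    lra.
  move: xM; rewrite inE /= in_itv /= => /andP[x1 x2].
  rewrite mem_set /=; last by rewrite in_itv /=; apply/andP; split; lra.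
  have : 0 <= (M - x) * (M + x) by rewrite mulr_ge0//; lra.
  by rewrite !mulr1 => h; rewrite ler_wpM2r//; lra.
have M2 : 0 < M ^+ 2 by rewrite exprn_gt0.
suff h (u v : R) : 3 * M ^+ 2 * u <= 10 * pi * (2 * M) ^+ 2 * v -> u <= 40 * pi / 3 * v.
  exact: h.
by move=> uv; rewrite -(ler_pM2l M2); lra.
Qed.

(** The previous bound does not depend on the frequency window; Fatou's lemma removes the window. *)
Lemma trigT_sq (tr : R -> R) (c : R) a : tr = cos \/ tr = sin -> 0 <= c -> sq a ->
  sq (trigT tr c a) /\
  n2 (trigT tr c a) <= CF * n2 (fun x => a x * \1_(`[- c, c]%classic) x).
Proof.
move=> htr c0 sa.
have ht : trig tr by case: htr => ->; [exact: trig_cos|exact: trig_sin].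
have cT : continuous (trigT tr c a) by apply: trigT_cont => //; exact: sq_intg.
apply: (@n2_fatou _ (fun n x => trigT tr c a x * \1_(`[- n%:R, n%:R]%classic) x)).
- by move=> n; exact: sq_bounded_itv.
- move=> x; rewrite -[X in _ --> X]mulr1; apply: cvgM; first exact: cvg_cst.
  exact: cvg_indic.
- by rewrite mulr_ge0 ?CF_ge0 ?n2_ge0.
move=> n; rewrite -ler_sqr ?nnegrE ?mulr_ge0 ?CF_ge0 ?n2_ge0// exprMn !n2_indic.
have p3 : 0 <= 40 * pi / 3 :> R by rewrite divr_ge0// mulr_ge0// pi_ge0.
rewrite sqr_sqrtr//.
case: n => [|n].
  rewrite oppr0 set_itv1 Rintegral_set1 mulr_ge0// Rintegral_ge0// => x _.
  exact: sqr_ge0.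
have n0 : 0 < n.+1%:R :> R by [].
apply: le_trans (trigT_half_bound c0 n0 sa).
have ctr tr' : trig tr' -> continuous (fun xi => trigT tr' c a xi ^+ 2).
  by move=> ht' xi; apply: cvgM; apply: trigT_cont => //; exact: sq_intg.
apply: le_Rintegral => //.
- by apply: intg_cont; exact: ctr.
- apply: intgD => //; apply: intg_cont; apply: ctr; [exact: trig_cos|exact: trig_sin].
by move=> x _; case: htr => ->; rewrite ?lerDl ?lerDr sqr_ge0.
Qed.

(** Continuity and Fubini only use [trig]; the L^2 bound comes from the cosine-sine pair and is
    available for these two functions. *)
Definition costr (tr : R -> R) := tr = cos \/ tr = sin.

Lemma costr_trig tr : costr tr -> trig tr.
Proof. by case=> ->; [exact: trig_cos|exact: trig_sin]. Qed.

Definition trigN tr a (n : nat) := trigT tr n%:R a.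

Lemma trigN_sq tr a n : costr tr -> sq a -> sq (trigN tr a n).
Proof. by move=> ht sa; case: (trigT_sq ht (ler0n R n) sa). Qed.

Lemma trigN_le tr a n : costr tr -> sq a -> n2 (trigN tr a n) <= CF * n2 a.
Proof.
move=> ht sa; case: (trigT_sq ht (ler0n R n) sa) => _ h; apply: le_trans h _.
by rewrite ler_wpM2l ?CF_ge0// n2_indic_le.
Qed.

Lemma trigN_D tr a b n : costr tr -> sq a -> sq b ->
  trigN tr (fun x => a x + b x) n = fun xi => trigN tr a n xi + trigN tr b n xi.
Proof.
move=> /costr_trig ht sa sb; apply/funext => xi; rewrite /trigN /trigT -RintegralD//.
- by apply: eq_Rintegral => x _; rewrite mulrDr.
- by apply: trigT_intg => //; exact: sq_intg.
- by apply: trigT_intg => //; exact: sq_intg.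
Qed.

Lemma trigN_Z tr a k n : costr tr -> sq a ->
  trigN tr (fun x => k * a x) n = fun xi => k * trigN tr a n xi.
Proof.
move=> /costr_trig ht sa; apply/funext => xi; rewrite /trigN /trigT -RintegralZl//.
- by apply: eq_Rintegral => x _; rewrite mulrCA.
- by apply: trigT_intg => //; exact: sq_intg.
Qed.

(** A short truncation is a longer one of a cut-off function, so a difference of two truncations is
    a transform of a difference of functions. *)
Lemma trigN_trunc tr a m n : (m <= n)%N -> trigN tr a m =
  trigN tr (fun x => a x * \1_(`[- m%:R, m%:R]%classic) x) n.
Proof.
move=> mn; apply/funext => xi; rewrite /trigN /trigT Rint_restrict [RHS]Rint_restrict.
apply: eq_Rintegral => x _; rewrite -!mulrA; congr (_ * (_ * _)).
rewrite !indicE; have [xM|xM] := boolP (x \in `[- m%:R, m%:R]%classic); last by rewrite mul0r.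
rewrite mul1r mem_set//; move: xM; rewrite inE /= !in_itv /= -!ler_norml => h.
by apply: le_trans h _; rewrite ler_nat.
Qed.

Opaque trigT trigN.

(** For [m <= n] the truncations differ by the transform at level [n] of [a] minus its cutoff to
    [[-m, m]]. The uniform bound [CF] and the convergence of the cutoffs make the sequence
    Cauchy. *)
Lemma trigN_exists tr a : costr tr -> sq a -> exists A, L2lim (trigN tr a) A.
Proof.
move=> ht sa; apply: sq_complete; first by move=> n; exact: trigN_sq.
have [_ ca] := L2lim_trunc sa.
pose t m x := a x * \1_(`[- m%:R, m%:R]%classic) x.
have st m : sq (t m) by exact: sq_indic.
have key m n : (m <= n)%N -> n2 (fun xi => trigN tr a n xi - trigN tr a m xi) <=
   CF * n2 (fun x => t m x - a x).
  move=> mn; rewrite (trigN_trunc tr a mn) n2_subC.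
  have -> : (fun xi => trigN tr (t m) n xi - trigN tr a n xi) =
     trigN tr (fun x => t m x + (-1) * a x) n.
    rewrite trigN_D//; last exact: sqZ.
    by apply/funext => xi; rewrite trigN_Z// mulN1r.
  have -> : (fun x => t m x - a x) = (fun x => t m x + (-1) * a x).
    by apply/funext => x; rewrite mulN1r.
  by apply: trigN_le => //; apply: sqD => //; exact: sqZ.
move=> e e0.
have e1 : 0 < e / 2 / (CF + 1).
  by rewrite divr_gt0// ?divr_gt0// ltr_wpDl ?CF_ge0.
move/cvgrPdist_le: ca => /(_ _ e1)[N _ HN]; exists N => m n Nm Nn.
have hN : CF * n2 (fun x => t N x - a x) <= e / 2.
  have := HN N (leqnn N); rewrite /= sub0r normrN ger0_norm ?n2_ge0// => h.
  apply: le_trans (_ : CF * (e / 2 / (CF + 1)) <= _); first by rewrite ler_wpM2l ?CF_ge0.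
  rewrite mulrA ler_pdivrMr ?ltr_wpDl ?CF_ge0// mulrC ler_wpM2l//; first by lra.
  by rewrite lerDl.
have km := le_trans (key N m Nm) hN; have kn := le_trans (key N n Nn) hN.
apply: le_trans (n2_triangleB (trigN_sq m ht sa) (trigN_sq N ht sa) (trigN_sq n ht sa)) _.
have kn' : n2 (fun x => trigN tr a N x - trigN tr a n x) <= e / 2.
  rewrite n2_subC.
  exact: kn.
have h := lerD km kn'.
apply: (le_trans h).
rewrite -splitr.
exact: lexx.
Qed.

End Plancherel.

(** * Primitives of locally integrable functions *)

Transparent trigT trigN.

Section Primitive.
Context {R : realType}.
Local Notation mu := (@lebesgue_measure R).
Implicit Types (a f g : R -> R) (u v : R).

Definition locint a := forall u v, intg `[u, v] a.

(** Local absolute continuity of [A] with derivative [a], in integrated form: no pointwise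
    derivative of [A] is involved. *)
Definition prim A a := locint a /\
  forall x y, x <= y -> A y - A x = \int[mu]_(z in `[x, y]) a z.

(** The assumptions are confined to [[u, v]], since the primitives built in [C1_primitive] are
    controlled only to the right of [u]. *)
Lemma FTC_on (F f : R -> R) u v : u <= v ->
  (forall x : R, u <= x <= v -> is_derive x 1 F (f x)) ->
  (forall x : R, u <= x <= v -> {for x, continuous f}) ->
  intg `[u, v] f /\ \int[mu]_(x in `[u, v]) f x = F v - F u.
Proof.
move=> uv dF cf.
have cw : {within `[u, v], continuous f}.
  by apply: continuous_in_subspaceT => x; rewrite inE /= in_itv /=; exact: cf.
have ci : intg `[u, v] f.
  by apply: continuous_compact_integrable => //; exact: segment_compact.
split => //.
move: uv; rewrite le_eqVlt => /predU1P[uv|uv].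
  by rewrite uv set_itv1 Rintegral_set1 subrr.
have cF x : u <= x <= v -> {for x, continuous F}.
  by move=> xuv; exact: is_derive_continuous (dF x xuv).
have := @continuous_FTC2 R f F u v uv cw.
have -> : (\int[mu]_(x in `[u, v]) (f x)%:E)%E = (\int[mu]_(x in `[u, v]) f x)%:E.
  by rewrite Rint_EFin.
move=> h; apply: EFin_inj; rewrite EFinB; apply: h.
- split.
  + move=> x; rewrite in_itv /= => /andP[x1 x2].
    by case: (dF x); rewrite ?(ltW x1) ?(ltW x2).
  + by apply: cvg_at_right_filter; apply: cF; rewrite lexx ltW.
  + by apply: cvg_at_left_filter; apply: cF; rewrite lexx ltW.
- move=> x; rewrite in_itv /= => /andP[x1 x2]; rewrite derive1E.
  by case: (dF x); rewrite ?(ltW x1) ?(ltW x2).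
Qed.

Lemma itv_split f x y z : x <= y -> y <= z -> intg `[x, z] f ->
  \int[mu]_(t in `[x, z]) f t = \int[mu]_(t in `[x, y]) f t + \int[mu]_(t in `[y, z]) f t.
Proof.
move=> xy yz If.
have := @Rintegral_itvB R f (BLeft x) (BRight z) y If; rewrite !bnd_simp => /(_ xy yz) h.
have i2 : intg `]y, z] f.
  apply: (intg_sub _ _ _ If) => // t /=; rewrite !in_itv /= => /andP[t1 ->].
  by rewrite andbT; apply: le_trans xy (ltW t1).
by rewrite -(Rintegral_itv_obnd_cbnd i2) -h addrC subrK.
Qed.

Lemma locint_norm a : locint a -> locint (fun x => `|a x|).
Proof. by move=> la u v; exact: intg_norm. Qed.

Lemma prim_le A a x y u v : prim A a -> u <= x -> x <= y -> y <= v ->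
  `|A y - A x| <= \int[mu]_(z in `[u, v]) `|a z|.
Proof.
move=> [la pa] ux xy yv; rewrite (pa _ _ xy).
apply: le_trans (Rint_norm (measurable_itv _) (la x y)) _.
have iuv := locint_norm la u v.
have xv := le_trans xy yv.
rewrite (itv_split ux xv iuv).
have ixv := locint_norm la x v.
rewrite (itv_split xy yv ixv).
have h1 : 0 <= \int[mu]_(t in `[u, x]) `|a t| by apply: Rintegral_ge0.
have h2 : 0 <= \int[mu]_(t in `[y, v]) `|a t| by apply: Rintegral_ge0.
by apply: le_trans (ler_wpDl h1 (lexx _)); rewrite lerDl.
Qed.

Lemma prim_cont A a : prim A a -> continuous A.
Proof.
move=> [la pa] x.
have x1 : x - 1 <= x + 1 by lra.
have cP := parameterized_integral_continuous x1 (la (x - 1) (x + 1)).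
have xx : x - 1 < x + 1 by lra.
have xin : x \in `]x - 1, x + 1[ by rewrite in_itv /=; apply/andP; split; lra.
have cx := within_continuous_continuous xx cP xin.
have : {for x, continuous (fun y => A (x - 1) + parameterized_integral mu (x - 1) y a)}.
  by apply: cvgD; [exact: cvg_cst|exact: cx].
rewrite /continuous_at => h.
have E y : x - 1 <= y -> A (x - 1) + parameterized_integral mu (x - 1) y a = A y.
  by move=> xy; rewrite /parameterized_integral -(pa _ _ xy) addrC subrK.
rewrite -[X in _ --> X]E; last by lra.
apply: cvg_trans h; apply: near_eq_cvg; near=> y.
apply: E; near: y; exists 1 => //= z; rewrite /= ltr_norml => /andP[]; lra.
Unshelve. all: by end_near. Qed.

Definition locLip (Phi : R -> R -> R) := forall M : R, exists L : R, 0 <= L /\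
  forall p q p' q', `|p| <= M -> `|q| <= M -> `|p'| <= M -> `|q'| <= M ->
  `|Phi p q - Phi p' q'| <= L * (`|p - p'| + `|q - q'|).

Lemma locLip_cont Phi P Q (x : R) : locLip Phi -> {for x, continuous P} ->
  {for x, continuous Q} -> {for x, continuous (fun y => Phi (P y) (Q y))}.
Proof.
move=> lP cP cQ.
have [L [L0 HL]] := lP (`|P x| + `|Q x| + 1).
rewrite /continuous_at; apply/cvgrPdist_le => e e0.
have d0 : 0 < Num.min 1 (e / (2 * (L + 1))).
  by rewrite lt_min ltr01 /= divr_gt0// mulr_gt0// ltr_wpDl.
move/cvgrPdist_le : cP => /(_ _ d0) cP; move/cvgrPdist_le : cQ => /(_ _ d0) cQ.
near=> y.
have hP : `|P x - P y| <= Num.min 1 (e / (2 * (L + 1))) by near: y.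
have hQ : `|Q x - Q y| <= Num.min 1 (e / (2 * (L + 1))) by near: y.
move: hP hQ; rewrite !le_min => /andP[p1 p2] /andP[q1 q2].
have Py : `|P y| <= `|P x| + 1.
  have -> : P y = P x - (P x - P y) by ring.
  by apply: le_trans (ler_normB _ _) _; rewrite lerD2l.
have Qy : `|Q y| <= `|Q x| + 1.
  have -> : Q y = Q x - (Q x - Q y) by ring.
  by apply: le_trans (ler_normB _ _) _; rewrite lerD2l.
have P0 := normr_ge0 (P x); have Q0 := normr_ge0 (Q x).
apply: le_trans (HL _ _ _ _ _ _ _ _) _; [lra|lra|lra|lra|].
apply: le_trans (_ : L * (e / (2 * (L + 1)) + e / (2 * (L + 1))) <= _).
  by rewrite ler_wpM2l// lerD.
have -> : L * (e / (2 * (L + 1)) + e / (2 * (L + 1))) = e * (L / (L + 1)).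
  by field; rewrite gt_eqF// ltr_wpDl.
rewrite -[leRHS]mulr1; apply: ler_wpM2l; first exact: ltW.
by rewrite ler_pdivrMr ?ltr_wpDl// mul1r lerDl.
Unshelve. all: by end_near. Qed.

End Primitive.

Transparent Rintegral.

(** * The chain rule for absolutely continuous functions *)

Section ChainRule.
Context {R : realType}.
Local Notation mu := (@lebesgue_measure R).
Implicit Types (a f g : R -> R) (u v : R).

(** [Phi] is C^1 with locally Lipschitz partial derivatives [Phi1] and [Phi2]. Differentiability is
    expressed along differentiable curves, the form in which it is applied, and this form can be
    checked directly at the origin for the nonlinearity. *)
Record C1pair (Phi Phi1 Phi2 : R -> R -> R) : Prop := {
  C1_lip : locLip Phi;
  C1_lip1 : locLip Phi1;
  C1_lip2 : locLip Phi2;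
  C1_der : forall (P Q : R -> R) (x p' q' : R), is_derive x 1 P p' -> is_derive x 1 Q q' ->
    is_derive x 1 (fun y => Phi (P y) (Q y))
      (Phi1 (P x) (Q x) * p' + Phi2 (P x) (Q x) * q') }.

Lemma L1approx u v a : intg `[u, v] a -> exists g : nat -> R -> R,
  (forall n, continuous (g n)) /\
  \int[mu]_(x in `[u, v]) `|g n x - a x| @[n --> \oo] --> 0.
Proof.
move=> ia.
have fin : (mu `[u, v]%classic < +oo)%E.
  by rewrite lebesgue_measure_itv /=; case: ifPn => _; rewrite ?ltry// -EFinB ltry.
have [g [cg ig lim]] := approximation_continuous_integrable (measurable_itv _) fin ia.
exists g; split => //.
suff -> : (fun n => \int[mu]_(x in `[u, v]) `|g n x - a x|) =
  fine \o (fun n => (\int[mu]_(z in `[u, v]) `|(a z - g n z)%:E|)%E) by exact: fine_cvg lim.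
apply/funext => n; rewrite /Rintegral /=; congr fine; apply: eq_integral => x _.
by rewrite distrC.
Qed.

Lemma C1_primitive u g p0 : continuous g -> exists P : R -> R,
  (forall x, u <= x -> is_derive x 1 P (g x)) /\
  (forall x, u <= x -> P x = p0 + \int[mu]_(z in `[u, x]) g z).
Proof.
move=> cg.
(* Starting the integral at [u - 1] makes [u] an interior point, so the derivative there is
   two-sided. *)
pose F (x : R) := \int[mu]_(z in `[u - 1, x]) g z.
have dF x : u <= x -> is_derive x 1 F (g x).
  move=> ux; have [| | |D1 D2] := @continuous_FTC1_closed R g (u - 1) x (x + 1) _ _ _ (cg x).
  - by lra.
  - exact: intg_cont.
  - by lra.
  - by split; [exact: D1|rewrite -derive1E; exact: D2].
exists (fun x => p0 - F u + F x); split => x ux.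
  apply: (is_derive_val (is_derive_add (is_derive_const (p0 - F u) x) (dF x ux))).
  by rewrite add0r.
have u1 : u - 1 <= u by lra.
by rewrite /F (itv_split u1 ux (intg_cont _ _ cg)); ring.
Qed.

(* Chain rule up to an error: [p], [q] are replaced by C^1 functions [P], [Q] whose
   derivatives [g], [h] are L^1-close to [p', q']. *)
Lemma chain_estimate Phi Phi1 Phi2 (P Q p q : R -> R) g h p' q' u v M L e d :
  locLip Phi1 -> locLip Phi2 ->
  C1pair Phi Phi1 Phi2 -> u <= v ->
  (forall x, u <= x <= v -> is_derive x 1 P (g x)) ->
  (forall x, u <= x <= v -> is_derive x 1 Q (h x)) ->
  continuous g -> continuous h -> continuous p -> continuous q ->
  intg `[u, v] p' -> intg `[u, v] q' ->
  0 <= L -> 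
  (forall Psi, Psi = Phi1 \/ Psi = Phi2 -> forall s t s' t', `|s| <= M -> `|t| <= M -> `|s'| <= M -> `|t'| <= M ->
     `|Psi s t - Psi s' t'| <= L * (`|s - s'| + `|t - t'|) /\ `|Psi s t| <= L) ->
  (forall x, u <= x <= v -> [/\ `|P x| <= M, `|Q x| <= M, `|p x| <= M & `|q x| <= M]) ->
  (forall x, u <= x <= v -> `|P x - p x| <= e /\ `|Q x - q x| <= d) ->
  intg `[u, v] (fun x => Phi1 (p x) (q x) * p' x + Phi2 (p x) (q x) * q' x) /\
  `|(Phi (P v) (Q v) - Phi (P u) (Q u)) -
    \int[mu]_(x in `[u, v]) (Phi1 (p x) (q x) * p' x + Phi2 (p x) (q x) * q' x)| <=
  L * (e + d) * (\int[mu]_(x in `[u, v]) (`|p' x| + `|q' x|)) +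
  L * (\int[mu]_(x in `[u, v]) `|g x - p' x| + \int[mu]_(x in `[u, v]) `|h x - q' x|).
Proof.
move=> l1 l2 C uv dP dQ cg ch cp cq ip iq L0 HL HM Hd.
have uu : u <= u <= v by rewrite lexx.
have cPhi Psi : locLip Psi -> forall x, u <= x <= v ->
    {for x, continuous (fun y => Psi (P y) (Q y))}.
  move=> lPsi x xuv; apply: locLip_cont => //.
    exact: is_derive_continuous (dP x xuv).
  exact: is_derive_continuous (dQ x xuv).
pose W x := Phi1 (P x) (Q x) * g x + Phi2 (P x) (Q x) * h x.
pose w x := Phi1 (p x) (q x) * p' x + Phi2 (p x) (q x) * q' x.
have [iW eW] : intg `[u, v] W /\ \int[mu]_(x in `[u, v]) W x = Phi (P v) (Q v) - Phi (P u) (Q u).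
  apply: (@FTC_on _ (fun x => Phi (P x) (Q x))) => //.
    by move=> x xuv; apply: (C1_der C); [exact: dP|exact: dQ].
  by move=> x xuv; apply: cvgD; apply: cvgM; try exact: cPhi; [exact: cg|exact: ch].
have bnd Psi f : locLip Psi -> Psi = Phi1 \/ Psi = Phi2 -> intg `[u, v] f ->
    intg `[u, v] (fun x => Psi (p x) (q x) * f x).
  move=> lPsi hPsi If; apply: intg_bndM => //.
    apply: measurable_funTS; apply: continuous_measurable_fun => x.
    by apply: locLip_cont => //; [exact: cp|exact: cq].
  exists L => x; rewrite /= in_itv /= => /HM[_ _ px qx].
  by case: (HL Psi hPsi _ _ _ _ px qx px qx).
have iw : intg `[u, v] w.
  by apply: intgD => //; apply: bnd => //; [left|right].
split => //.
have ign : intg `[u, v] (fun x => `|g x - p' x|).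
  by apply: intg_norm; apply: intgB => //; exact: intg_cont.
have ihn : intg `[u, v] (fun x => `|h x - q' x|).
  by apply: intg_norm; apply: intgB => //; exact: intg_cont.
have ipq : intg `[u, v] (fun x => `|p' x| + `|q' x|) by apply: intgD => //; exact: intg_norm.
rewrite -eW -(RintB (measurable_itv _) iW iw).
apply: le_trans (Rint_norm (measurable_itv _) (intgB (measurable_itv _) iW iw)) _.
rewrite -(RintZ _ (measurable_itv _) ipq) -(RintD (measurable_itv _) ign ihn).
rewrite -(RintZ _ (measurable_itv _) (intgD (measurable_itv _) ign ihn)).
have i1 := intgZ (L * (e + d)) (measurable_itv _) ipq.
have i2 := intgZ L (measurable_itv _) (intgD (measurable_itv _) ign ihn).
rewrite -(RintD (measurable_itv _) i1 i2).
apply: Rint_le => //.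
- by apply: intg_norm; exact: intgB.
- exact: intgD.
move=> x; rewrite /= in_itv /= => xuv.
have [Px Qx px qx] := HM x xuv; have [ex dx] := Hd x xuv.
have [A1 B1] := HL Phi1 (or_introl erefl) _ _ _ _ Px Qx px qx.
have [A2 B2] := HL Phi2 (or_intror erefl) _ _ _ _ Px Qx px qx.
have ed : L * (`|P x - p x| + `|Q x - q x|) <= L * (e + d) by rewrite ler_wpM2l// lerD.
rewrite /W /w.
have -> : Phi1 (P x) (Q x) * g x + Phi2 (P x) (Q x) * h x -
  (Phi1 (p x) (q x) * p' x + Phi2 (p x) (q x) * q' x) =
  ((Phi1 (P x) (Q x) - Phi1 (p x) (q x)) * p' x + (Phi2 (P x) (Q x) - Phi2 (p x) (q x)) * q' x)
  + (Phi1 (P x) (Q x) * (g x - p' x) + Phi2 (P x) (Q x) * (h x - q' x)) by ring.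
apply: le_trans (ler_normD _ _) _; apply: lerD.
  rewrite mulrDr; apply: le_trans (ler_normD _ _) _; rewrite !normrM; apply: lerD.
    by rewrite ler_wpM2r// (le_trans A1).
  by rewrite ler_wpM2r// (le_trans A2).
rewrite [leRHS]mulrDr; apply: le_trans (ler_normD _ _) _; rewrite !normrM.
by apply: lerD; rewrite ler_wpM2r.
Qed.

(** The derivatives are approximated in L^1 by continuous functions. The corresponding primitives,
    started at the same values at [u], converge uniformly on [[u, v]], so the C^1 identity passes to
    the limit with an error proportional to the L^1 distances. *)
Lemma prim_chain Phi Phi1 Phi2 p p' q q' : C1pair Phi Phi1 Phi2 ->
  prim p p' -> prim q q' ->
  prim (fun x => Phi (p x) (q x)) (fun x => Phi1 (p x) (q x) * p' x + Phi2 (p x) (q x) * q' x).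
Proof.
move=> C hp hq.
suff key u v : u <= v ->
  intg `[u, v] (fun x => Phi1 (p x) (q x) * p' x + Phi2 (p x) (q x) * q' x) /\
  Phi (p v) (q v) - Phi (p u) (q u) =
  \int[mu]_(x in `[u, v]) (Phi1 (p x) (q x) * p' x + Phi2 (p x) (q x) * q' x).
  split; last by move=> x y xy; case: (key x y xy).
  move=> u v; have [uv|vu] := leP u v; first by case: (key u v uv).
  by rewrite set_itv_ge ?bnd_simp -?ltNge//; exact: integrable_set0.
move=> uv.
have [lp pp] := hp; have [lq qq] := hq.
have cp := prim_cont hp; have cq := prim_cont hq.
have [g [cg lg]] := L1approx (lp u v); have [h [ch lh]] := L1approx (lq u v).
set w := fun x => Phi1 (p x) (q x) * p' x + Phi2 (p x) (q x) * q' x.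
have uu : u <= u <= v by rewrite lexx.
have vv : u <= v <= v by rewrite lexx uv.
pose e n := \int[mu]_(x in `[u, v]) `|g n x - p' x|.
pose d n := \int[mu]_(x in `[u, v]) `|h n x - q' x|.
(* The integrals bound [p] and [q] on [[u, v]]; the summand 1 makes room for the approximations once
   their L^1 errors are at most 1. *)
pose M := `|p u| + `|q u| + \int[mu]_(x in `[u, v]) `|p' x| + \int[mu]_(x in `[u, v]) `|q' x| + 1.
have [L [L0 [HL HL0]]] : exists L, 0 <= L /\ (forall Psi, Psi = Phi1 \/ Psi = Phi2 ->
   forall s t s' t', `|s| <= M -> `|t| <= M -> `|s'| <= M -> `|t'| <= M ->
     `|Psi s t - Psi s' t'| <= L * (`|s - s'| + `|t - t'|) /\ `|Psi s t| <= L) /\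
   forall s t s' t', `|s| <= M -> `|t| <= M -> `|s'| <= M -> `|t'| <= M ->
     `|Phi s t - Phi s' t'| <= L * (`|s - s'| + `|t - t'|).
  have [La [La0 HLa]] := C1_lip1 C M; have [Lb [Lb0 HLb]] := C1_lip2 C M.
  have [Lc [Lc0 HLc]] := C1_lip C M.
  pose B (Psi : R -> R -> R) (l : R) := `|Psi 0 0 : R| + l * (M + M).
  exists (La + Lb + Lc + `|B Phi1 La| + `|B Phi2 Lb|).
  have n1 := normr_ge0 (B Phi1 La); have n2' := normr_ge0 (B Phi2 Lb).
  split; first by rewrite !addr_ge0.
  have bd Psi l (s t : R) : (forall s t s' t', `|s| <= M -> `|t| <= M -> `|s'| <= M -> `|t'| <= M ->
     `|Psi s t - Psi s' t'| <= l * (`|s - s'| + `|t - t'|)) -> 0 <= l ->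
     `|s| <= M -> `|t| <= M -> `|Psi s t| <= `|B Psi l|.
    move=> Hl l0 sM tM; have M0 : `|0 : R| <= M by rewrite normr0; exact: le_trans sM.
    have -> : Psi s t = Psi 0 0 + (Psi s t - Psi 0 0) by ring.
    apply: le_trans (ler_normD _ _) _; apply: le_trans (ler_norm _); rewrite lerD2l.
    apply: le_trans (Hl _ _ _ _ sM tM M0 M0) _.
    by rewrite !subr0 ler_wpM2l// lerD.
  split => [Psi [] -> s t s' t' h1 h2 h3 h4|s t s' t' h1 h2 h3 h4].
  - have A := HLa _ _ _ _ h1 h2 h3 h4; split.
      apply: le_trans A _; rewrite ler_wpM2r ?addr_ge0//; lra.
    apply: le_trans (bd _ La _ _ HLa La0 h1 h2) _; lra.
  - have A := HLb _ _ _ _ h1 h2 h3 h4; split.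
      apply: le_trans A _; rewrite ler_wpM2r ?addr_ge0//; lra.
    apply: le_trans (bd _ Lb _ _ HLb Lb0 h1 h2) _; lra.
  - apply: le_trans (HLc _ _ _ _ h1 h2 h3 h4) _; rewrite ler_wpM2r ?addr_ge0//; lra.
have est n : e n <= 1 -> d n <= 1 -> intg `[u, v] w /\
   `|Phi (p v) (q v) - Phi (p u) (q u) - \int[mu]_(x in `[u, v]) w x| <=
   (L * (\int[mu]_(x in `[u, v]) (`|p' x| + `|q' x|)) + L + L) * (e n + d n).
  move=> e1 d1.
  have [P [dP eP]] := C1_primitive u (p u) (cg n).
  have [Q [dQ eQ]] := C1_primitive u (q u) (ch n).
  have close (A A0 g0 a : R -> R) : prim A a -> continuous g0 ->
      (forall x, u <= x -> A0 x = A u + \int[mu]_(z in `[u, x]) g0 z) ->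
      forall x, u <= x <= v -> `|A0 x - A x| <= \int[mu]_(x in `[u, v]) `|g0 x - a x|.
    move=> [la pa] cg0 eA x /andP[ux xv].
    rewrite eA//.
    have -> : A u + \int[mu]_(z in `[u, x]) g0 z - A x = \int[mu]_(z in `[u, x]) (g0 z - a z).
      rewrite (RintB (measurable_itv _) (intg_cont _ _ cg0) (la u x)).
      by rewrite -(pa _ _ ux); ring.
    have iga y z : intg `[y, z] (fun z => g0 z - a z) by exact: (intgB (measurable_itv _) (intg_cont _ _ cg0) (la y z)).
    apply: le_trans (Rint_norm (measurable_itv _) (iga _ _)) _.
    rewrite [leRHS](itv_split ux xv (intg_norm (iga _ _))) lerDl.
    exact: Rintegral_ge0.
  have cP := close p P (g n) p' hp (cg n) eP.
  have cQ := close q Q (h n) q' hq (ch n) eQ.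
  have n1 := normr_ge0 (p u); have n2' := normr_ge0 (q u).
  have n3 : 0 <= \int[mu]_(x in `[u, v]) `|p' x| by exact: Rintegral_ge0.
  have n4 : 0 <= \int[mu]_(x in `[u, v]) `|q' x| by exact: Rintegral_ge0.
  have bA (A a : R -> R) x : prim A a -> u <= x <= v -> `|A x| <= `|A u| + \int[mu]_(x in `[u, v]) `|a x|.
    move=> hA /andP[ux xv]; have -> : A x = A u + (A x - A u) by ring.
    by apply: le_trans (ler_normD _ _) _; rewrite lerD2l; exact: (prim_le hA).
  have HM x : u <= x <= v -> [/\ `|P x| <= M, `|Q x| <= M, `|p x| <= M & `|q x| <= M].
    move=> xuv; have px := bA _ _ _ hp xuv; have qx := bA _ _ _ hq xuv.
    have Px : `|P x| <= `|p x| + 1.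
      have -> : P x = p x + (P x - p x) by ring.
      by apply: le_trans (ler_normD _ _) _; rewrite lerD2l (le_trans (cP x xuv)).
    have Qx : `|Q x| <= `|q x| + 1.
      have -> : Q x = q x + (Q x - q x) by ring.
      by apply: le_trans (ler_normD _ _) _; rewrite lerD2l (le_trans (cQ x xuv)).
    rewrite /M; move: n1 n2' n3 n4 px qx Px Qx.
    move: (\int[mu]_(x in _) `|p' x|) (\int[mu]_(x in _) `|q' x|) => I1 I2.
    by move=> n1 n2' n3 n4 px qx Px Qx; split; lra.
  have [| | |iw E] := @chain_estimate Phi Phi1 Phi2 P Q p q (g n) (h n) p' q' u v M L (e n) (d n)
    (C1_lip1 C) (C1_lip2 C) C uv _ _ (cg n) (ch n) cp cq (lp u v) (lq u v) L0 HL HM _.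
  - by move=> x /andP[ux _]; exact: dP.
  - by move=> x /andP[ux _]; exact: dQ.
  - by move=> x xuv; split; [exact: cP|exact: cQ].
  split => //.
  have Pu : P u = p u by rewrite eP// set_itv1 Rintegral_set1 addr0.
  have Qu : Q u = q u by rewrite eQ// set_itv1 Rintegral_set1 addr0.
  rewrite Pu Qu in E.
  have [Pv Qv pv qv] := HM v vv.
  have E2 : `|Phi (p v) (q v) - Phi (P v) (Q v)| <= L * (e n + d n).
    apply: le_trans (HL0 _ _ _ _ pv qv Pv Qv) _; rewrite ler_wpM2l//.
    by apply: lerD; rewrite distrC; [exact: cP|exact: cQ].
  have -> : Phi (p v) (q v) - Phi (p u) (q u) - \int[mu]_(x in `[u, v]) w x =
    (Phi (p v) (q v) - Phi (P v) (Q v)) +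
    (Phi (P v) (Q v) - Phi (p u) (q u) - \int[mu]_(x in `[u, v]) w x) by ring.
  apply: le_trans (ler_normD _ _) _.
  apply: le_trans (lerD E2 E) _.
  rewrite -/(e n) -/(d n) -subr_ge0.
  by rewrite le_eqVlt; apply/orP; left; apply/eqP; ring.
have lim : e n + d n @[n --> \oo] --> 0 by apply: cvgD0.
have e0 n : 0 <= e n by exact: Rintegral_ge0.
have d0 n : 0 <= d n by exact: Rintegral_ge0.
have [N HN] : exists N, forall n, (N <= n)%N -> e n <= 1 /\ d n <= 1.
  move/cvgrPdist_le: lim => /(_ _ ltr01)[N _ HN]; exists N => n /HN.
  rewrite /= sub0r normrN ger0_norm ?addr_ge0// => h1.
  have := e0 n; have := d0 n; lra.
split; first by have [e1 d1] := HN N (leqnn _); case: (est N e1 d1).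
apply/eqP; rewrite -subr_eq0 -normr_le0.
have := cvgM0 (L * (\int[mu]_(x in `[u, v]) (`|p' x| + `|q' x|)) + L + L) lim.
rewrite -(cvg_shiftn N) => /cvg0_ge; apply => n.
by have [e1 d1] := HN (n + N)%N (leq_addl _ _); case: (est _ e1 d1).
Qed.

End ChainRule.

(** * Weak derivatives *)

Section Bumps.
Context {R : realType}.
Local Notation mu := (@lebesgue_measure R).
Implicit Types (f g phi : R -> R).

(* The functions [y^(-n) e^(-1/y)] (extended by 0), closed under differentiation up to
   linear combinations. *)
Definition expinv (n : nat) (y : R) : R :=
  if 0 < y then (y^-1) ^+ n * expR (- y^-1) else 0.

Lemma expinv_ge0 n y : 0 <= expinv n y.
Proof.
rewrite /expinv; case: ifPn => // y0.
by rewrite mulr_ge0 ?expR_ge0// exprn_ge0// invr_ge0 ltW.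
Qed.

(** The exponential series gives [expR u >= u ^+ n.+1 / n.+1!], used at [u = 1 / y]. The linear
    bound yields continuity at 0 for every [n]. *)
Lemma expinv_le n y : expinv n y <= n.+1`!%:R * `|y|.
Proof.
rewrite /expinv; case: ifPn => [y0|_]; last by rewrite mulr_ge0.
have u0 : 0 < y^-1 by rewrite invr_gt0.
have := expR_ge1Dxn n (ltW u0).
rewrite expRN ler_pdivrMr ?expR_gt0// (gtr0_norm y0) => h.
have f0 : 0 < n.+1`!%:R :> R by rewrite ltr0n fact_gt0.
have h2 : y^-1 ^+ n.+1 <= n.+1`!%:R * expR y^-1.
  rewrite mulrC -ler_pdivrMr//; apply: le_trans h; by rewrite lerDr.
have -> : y^-1 ^+ n = y * y^-1 ^+ n.+1 by rewrite exprS mulrA divff ?mul1r// gt_eqF.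
by rewrite mulrAC mulrC ler_wpM2r// ltW.
Qed.

Lemma is_derive_pow f (x a : R) n : is_derive x 1 f a ->
  is_derive x 1 (fun y => f y ^+ n) (n%:R * f x ^+ n.-1 * a).
Proof.
move=> df; elim: n => [|n IH].
  apply: (is_derive_val (is_derive_const 1 x)); by rewrite !mul0r.
have -> : (fun y => f y ^+ n.+1) = (fun y => f y * f y ^+ n) by apply/funext => y; rewrite exprS.
apply: (is_derive_val (is_derive_mul df IH)).
case: n {IH} => [|n]; rewrite /= ?expr0 ?expr1; first by ring.
by rewrite -!natr1 !exprS; ring.
Qed.

Lemma is_derive_expinv n (y : R) : is_derive y 1 (expinv n) (expinv n.+2 y - n%:R * expinv n.+1 y).
Proof.
have [y0|y0|y0] := ltgtP 0 y.
- have e : \near y, (fun z => z^-1 ^+ n * expR (- z^-1)) y = expinv n y.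
    near=> z; have z0 : 0 < z by near: z; exact: lt_nbhsr.
    by rewrite /expinv z0.
  apply: (near_eq_is_derive e).
  have di : is_derive y 1 (fun z : R => z^-1) (- y ^- 2).
    have := @is_deriveV R id y 1 1 _ (is_derive_id y 1).
    rewrite /= gt_eqF// => /(_ isT) h; apply: (is_derive_val h).
    by rewrite /GRing.scale /= mulr1.
  have dX : is_derive y 1 (fun z : R => z^-1 ^+ n) (n%:R * y^-1 ^+ n.-1 * (- y ^- 2)).
    exact: is_derive_pow di.
  have dE : is_derive y 1 (fun z : R => expR (- z^-1)) (expR (- y^-1) * (- - y ^- 2)).
    exact: (is_derive_compose (is_derive_expR _) (is_derive_opp di)).
  apply: (is_derive_val (is_derive_mul dX dE)).
  rewrite /expinv y0 opprK -exprVn; case: n {e dX} => [|n /=].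
    by ring.
  by rewrite !exprS; ring.
- have e : \near y, (fun=> 0) y = expinv n y.
    near=> z; have z0 : z < 0 by near: z; exists (- y) => /=; [rewrite oppr_gt0|move=> z /=; rewrite ltr_norml => /andP[]; lra].
    by rewrite /expinv ltNge (ltW z0).
  apply: (near_eq_is_derive e).
  have -> : expinv n.+2 y - n%:R * expinv n.+1 y = 0.
    by rewrite /expinv ltNge (ltW y0) /= mulr0 subrr.
  exact: is_derive_const.
- case: _ / y0.
  have -> : expinv n.+2 0 - n%:R * expinv n.+1 0 = 0.
    by rewrite /expinv ltxx mulr0 subrr.
  (* At 0 the difference quotient of [expinv n] is [expinv n.+1], which is continuous there with
     value 0. *)
  apply/is_derive1_caratheodory; exists (expinv n.+1); split.
  + move=> z; rewrite subr0 /expinv ltxx subr0; case: ifPn => z0; last by rewrite mul0r.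
    by rewrite exprS mulrAC [X in _ = X * _]mulrAC mulVf ?mul1r// gt_eqF.
  + apply/cvgrPdist_le => e e0; near=> z.
    rewrite {1}/expinv ltxx sub0r normrN ger0_norm ?expinv_ge0//.
    apply: le_trans (expinv_le _ _) _.
    rewrite mulrC -ler_pdivlMr ?ltr0n ?fact_gt0//.
    near: z; exists (e / n.+2`!%:R) => /=; first by rewrite divr_gt0// ltr0n fact_gt0.
    by move=> z; rewrite /= sub0r normrN => /ltW.
  + by rewrite /expinv ltxx.
Unshelve. all: by end_near. Qed.

(** A syntactic class stable under differentiation: smoothness of its members then follows by
    induction on the order of the derivative. *)
Inductive bumpcls : (R -> R) -> Prop :=
| bump_base n a b : bumpcls (fun x => expinv n (a * x + b))
| bump_add f g : bumpcls f -> bumpcls g -> bumpcls (fun x => f x + g x)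
| bump_mul f g : bumpcls f -> bumpcls g -> bumpcls (fun x => f x * g x)
| bump_scale k f : bumpcls f -> bumpcls (fun x => k * f x).

Lemma bumpcls_derive f : bumpcls f -> exists f', bumpcls f' /\
  forall x : R, is_derive x 1 f (f' x).
Proof.
elim=> {f} [n a b|f g _ [f' [cf df]] _ [g' [cg dg]]|f g cf [f' [cf' df]] cg [g' [cg' dg]]|k f _ [f' [cf df]]].
- exists (fun x => a * (expinv n.+2 (a * x + b) + (- n%:R) * expinv n.+1 (a * x + b))); split.
    by apply: bump_scale; apply: bump_add; [|apply: bump_scale]; exact: bump_base.
  move=> x.
  have da : is_derive x 1 (fun x => a * x + b) (a * 1 + 0).
    exact: (is_derive_add (is_derive_scale a (is_derive_id x 1)) (is_derive_const b x)).
  apply: (is_derive_val (is_derive_compose (is_derive_expinv n _) da)); ring.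
- exists (fun x => f' x + g' x); split; first exact: bump_add.
  by move=> x; exact: is_derive_add.
- exists (fun x => f' x * g x + f x * g' x); split.
    by apply: bump_add; exact: bump_mul.
  by move=> x; exact: is_derive_mul.
- exists (fun x => k * f' x); split; first exact: bump_scale.
  by move=> x; exact: is_derive_scale.
Qed.

Lemma is_derive_derive1 f f' : (forall x : R, is_derive x 1 f (f' x)) -> (f^`())%classic = f'.
Proof. by move=> d; apply/funext => x; rewrite derive1E; case: (d x). Qed.

Lemma bumpcls_smooth f : bumpcls f -> forall n (x : R), derivable (f^`(n))%classic x 1.
Proof.
move=> cf n; suff : bumpcls (f^`(n))%classic.
  by move=> /bumpcls_derive[f' [_ d]] x; case: (d x).
elim: n => [|n]; first by rewrite derive1n0.
by rewrite derive1nS => /bumpcls_derive[f' [cf' /is_derive_derive1 ->]].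
Qed.

(** The product of [e^(-1 / ((n + 1)(x - p)))] and [e^(-1 / ((n + 1)(q - x)))], extended by 0. The
    support stays in [[p, q]] and the values tend to the indicator of []p, q[], so integrals over
    intervals are limits of integrals against test functions. *)
Definition bump (n : nat) (p q x : R) : R :=
  expinv 0 (n.+1%:R * x + (- n.+1%:R * p)) * expinv 0 ((- n.+1%:R) * x + n.+1%:R * q).

Lemma bump_cls n p q : bumpcls (bump n p q).
Proof. by apply: bump_mul; exact: bump_base. Qed.

Lemma expinv0_le1 y : expinv 0 y <= 1.
Proof.
rewrite /expinv; case: ifPn => // y0; rewrite expr0 mul1r -expR0 ler_expR oppr_le0.
by rewrite invr_ge0 ltW.
Qed.

Lemma bump_bnd n p q x : 0 <= bump n p q x <= 1.
Proof.
rewrite /bump mulr_ge0 ?expinv_ge0//=.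
by rewrite -[leRHS]mulr1; apply: ler_pM; rewrite ?expinv_ge0 ?expinv0_le1.
Qed.

Lemma bump_out n p q x : x <= p \/ q <= x -> bump n p q x = 0.
Proof.
have e1 : n.+1%:R * x + (- n.+1%:R * p) = n.+1%:R * (x - p) by ring.
have e2 : - n.+1%:R * x + n.+1%:R * q = n.+1%:R * (q - x) by ring.
rewrite /bump e1 e2 /expinv => -[h|h].
- by rewrite (pmulr_rgt0 (x - p))// subr_gt0 [p < x]ltNge h /= mul0r.
- by rewrite (pmulr_rgt0 (q - x))// subr_gt0 [x < q]ltNge h /= mulr0.
Qed.

Lemma bump_cvg p q x : bump n p q x @[n --> \oo] --> (\1_(`]p, q[%classic) x : R).
Proof.
rewrite indicE; have [xpq|xpq] := boolP (x \in `]p, q[%classic); last first.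
  apply: cvg_near_cst; apply: nearW => n; apply: bump_out.
  move: xpq; rewrite notin_setE /= in_itv /= => /negP; rewrite negb_and -!leNgt => /orP[]; by [left|right].
move: xpq; rewrite inE /= in_itv /= => /andP[px xq].
have lim (d : R) : 0 < d -> expinv 0 (n.+1%:R * d) @[n --> \oo] --> (1 : R).
  move=> d0; have -> : (fun n => expinv 0 (n.+1%:R * d)) = (fun n => expR (- (d^-1 * n.+1%:R^-1))).
    by apply/funext => n; rewrite /expinv pmulr_rgt0// d0 expr0 mul1r invfM mulrC.
  have h : - (d^-1 * n.+1%:R^-1) @[n --> \oo] --> (0 : R).
    rewrite -oppr0; apply: cvgN; rewrite -(mulr0 d^-1); apply: cvgM; first exact: cvg_cst.
    exact: cvg_harmonic.
  by rewrite -[X in _ --> X](@expR0 R); exact: (cvg_comp _ _ h (@continuous_expR R 0)).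
rewrite -[X in _ --> X](mulr1 1).
have -> : (fun n => bump n p q x) = (fun n => expinv 0 (n.+1%:R * (x - p)) * expinv 0 (n.+1%:R * (q - x))).
  by apply/funext => n; rewrite /bump; congr (expinv _ _ * expinv _ _); ring.
by apply: cvgM; apply: lim; rewrite subr_gt0.
Qed.

Lemma bump_cont n p q : continuous (bump n p q).
Proof.
have [f' [_ d]] := bumpcls_derive (bump_cls n p q).
by move=> x; exact: is_derive_continuous (d x).
Qed.

End Bumps.

Opaque bump Rintegral.

(** * Test functions and the lemma of du Bois-Reymond *)

Section WeakDerivative.
Context {R : realType}.
Local Notation mu := (@lebesgue_measure R).
Implicit Types (a b f g h phi : R -> R).

Lemma lim_uniq (s : nat -> R) (l m : R) : s n @[n --> \oo] --> l -> s n @[n --> \oo] --> m -> l = m.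
Proof. exact: (@cvg_unique _ (@Rhausdorff R)). Qed.

Lemma cont_bounded f u v : continuous f -> exists B, forall x, u <= x <= v -> `|f x| <= B.
Proof.
move=> cf.
have := @compact_bounded R R (f @` `[u, v]%classic).
case; first by apply: continuous_compact; [exact: continuous_subspaceT|exact: segment_compact].
move=> B [_ HB]; exists (B + 1) => x xuv.
by apply: (HB (B + 1)); [rewrite ltrDl|exists x => //=; rewrite in_itv].
Qed.

Lemma intg_mulc f a u v : continuous f -> intg `[u, v] a -> intg `[u, v] (fun x => a x * f x).
Proof.
move=> cf ia.
suff : intg `[u, v] (fun x => f x * a x).
  by congr (intg _ _); apply/funext => x; rewrite mulrC.
apply: intg_bndM => //.
  by apply: measurable_funTS; exact: continuous_measurable_fun.
have [B HB] := cont_bounded u v cf; exists B => x.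
by rewrite /= in_itv /=; exact: HB.
Qed.

Lemma intg_supp f M : (forall x, M < `|x| -> f x = 0) -> intg `[- M, M] f ->
  intg setT f /\ \int[mu]_x f x = \int[mu]_(x in `[- M, M]) f x.
Proof.
move=> f0 If.
have e : (fun x => f x * \1_(`[- M, M]%classic) x) = f.
  apply/funext => x; rewrite indicE.
  have [xM|xM] := boolP (x \in `[- M, M]%classic); first by rewrite mulr1.
  rewrite mulr0 f0// ltNge; apply/negP => h; move: xM; rewrite notin_setE /= in_itv /=.
  by rewrite -ler_norml h.
split; first by move: If => /(intg_restrict _ (measurable_itv _)); rewrite e.
by rewrite [RHS]Rint_restrict; apply: eq_Rintegral => x _; rewrite -[in LHS]e.
Qed.

Lemma tf_der phi : test_function phi -> forall x : R, is_derive x 1 phi ((phi^`())%classic x).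
Proof.
move=> [d _] x; have := d 0%N x; rewrite derive1n0 => dx.
by split => //; rewrite derive1E.
Qed.

Lemma tf_cont phi : test_function phi -> continuous phi.
Proof. by move=> t x; exact: is_derive_continuous (tf_der t x). Qed.

Lemma tf_cont' phi : test_function phi -> continuous (phi^`())%classic.
Proof.
move=> [d _] x; have := d 1%N x; rewrite derive1n1 => dx.
by apply: differentiable_continuous; apply/derivable1_diffP.
Qed.

Lemma tf_supp phi : test_function phi -> exists M, 0 < M /\
  forall x, M <= `|x| -> phi x = 0 /\ (phi^`())%classic x = 0.
Proof.
(* With the margin 1 the function vanishes near every point beyond the new bound, hence so does its
   derivative. *)
move=> t; have [_ [M HM]] := t; exists (`|M| + 1); split; first by rewrite ltr_wpDl.
have M1 := ler_norm M.
move=> x xM; split; first by apply: HM; lra.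
have e : \near x, (fun=> 0 : R) x = phi x.
  near=> z; rewrite HM//.
  have : `|x - z| < 1 by near: z; exists 1 => /=.
  by have := ler_distD z x 0; rewrite !subr0; lra.
have d := near_eq_is_derive e (is_derive_const 0 x).
by rewrite derive1E; case: d.
Unshelve. all: by end_near. Qed.

Lemma test_bump n (p q : R) : test_function (bump n p q).
Proof.
split; first exact: bumpcls_smooth (bump_cls n p q).
exists (Num.max `|p| `|q|) => x; rewrite gt_max => /andP[px qx].
apply: bump_out; have [x0|x0] := leP 0 x.
  right; move: qx; rewrite (ger0_norm x0) => /ltW; apply: le_trans; exact: ler_norm.
left; move: px; rewrite (ltr0_norm x0) ltrNr => /ltW /le_trans; apply.
by rewrite lerNl; rewrite -normrN ler_norm.
Qed.

(** The vanishing mean is what makes the primitive vanish to the right of [v], hence compactly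
    supported. *)
Lemma test_primitive b u v : bumpcls b -> u <= v ->
  (forall x, x <= u \/ v <= x -> b x = 0) -> \int[mu]_(x in `[u, v]) b x = 0 ->
  exists phi, test_function phi /\ (phi^`())%classic = b.
Proof.
move=> cb uv b0 Ib.
have [b' [_ db]] := bumpcls_derive cb.
have bcont : continuous b by move=> x; exact: is_derive_continuous (db x).
(* The lower limit [u - 1] keeps every [x >= u] in the interior of the domain of integration. *)
pose phi (x : R) := \int[mu]_(z in `[u - 1, x]) b z.
have phi0 x : x <= u -> phi x = 0.
  move=> xu; rewrite /phi -[RHS](mul0r (\int[mu]_(z in `[u - 1, x]) (1 : R))) -RintZ//; last exact: intg_itv_cst.
  apply: eq_Rintegral => z; rewrite inE /= in_itv /= => /andP[_ zx].
  by rewrite mul0r b0//; left; exact: le_trans xu.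
have dphi (x : R) : is_derive x 1 phi (b x).
  have [xu|ux] := ltP x u.
    have e : \near x, (fun=> 0 : R) x = phi x.
      near=> z; rewrite phi0//; apply: ltW; near: z.
      exists (u - x) => /=; first by rewrite subr_gt0.
      by move=> z /=; rewrite ltr_norml => /andP[]; lra.
    apply: (near_eq_is_derive e); rewrite b0; last by left; exact: ltW.
    exact: is_derive_const.
  have [| | |D1 D2] := @continuous_FTC1_closed R b (u - 1) x (x + 1) _ _ _ (bcont x).
  - by lra.
  - exact: intg_cont.
  - by lra.
  - by split; [exact: D1|rewrite -derive1E; exact: D2].
have Dphi := is_derive_derive1 dphi.
exists phi; split => //; split.
  case=> [|n] x; first by rewrite derive1n0; case: (dphi x).
  by rewrite derive1Sn Dphi; exact: bumpcls_smooth.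
exists (Num.max `|u| `|v|) => x; rewrite gt_max => /andP[ux vx].
have [x0|x0] := leP 0 x; last first.
  apply: phi0; move: ux; rewrite (ltr0_norm x0) ltrNr => /ltW /le_trans; apply.
  by rewrite lerNl; rewrite -normrN ler_norm.
have vx' : v <= x.
  move: vx; rewrite (ger0_norm x0) => /ltW; apply: le_trans; exact: ler_norm.
have u1 : u - 1 <= u by lra.
have ux' := le_trans uv vx'.
have ic y z := intg_cont y z bcont.
rewrite /phi (itv_split u1 ux' (ic _ _)) (itv_split uv vx' (ic _ _)) Ib add0r.
rewrite -/(phi u) phi0// add0r -[RHS](mul0r (\int[mu]_(z in `[v, x]) (1 : R))) -RintZ//; last exact: intg_itv_cst.
apply: eq_Rintegral => z; rewrite inE /= in_itv /= => /andP[vz _].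
by rewrite mul0r b0//; right.
Unshelve. all: by end_near. Qed.

Lemma Rint_open_closed a p q : intg `[p, q] a -> \int[mu]_(x in `]p, q[) a x = \int[mu]_(x in `[p, q]) a x.
Proof.
move=> ia.
have i1 : intg `]p, q[ a.
  by apply: (intg_sub _ _ _ ia) => // x /=; rewrite !in_itv /= => /andP[/ltW -> /ltW ->].
have i2 : intg `]p, q] a.
  by apply: (intg_sub _ _ _ ia) => // x /=; rewrite !in_itv /= => /andP[/ltW -> ->].
by rewrite (Rintegral_itv_bndo_bndc i1) (Rintegral_itv_obnd_cbnd i2).
Qed.

Lemma bump_lim h u v p q : intg `[u, v] h -> u <= p -> q <= v ->
  \int[mu]_(x in `[u, v]) (h x * bump n p q x) @[n --> \oo] --> \int[mu]_(x in `[p, q]) h x.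
Proof.
move=> ih up qv.
have [| | | |_] := @dct R `[u, v] (fun n x => h x * bump n p q x) (fun x => h x * \1_(`]p, q[%classic) x) (fun x => `|h x|) (measurable_itv _).
- move=> n; apply: measurable_funM; first exact: intg_meas ih.
  by apply: measurable_funTS; apply: continuous_measurable_fun; exact: bump_cont.
- by move=> x _; apply: cvgM; [exact: cvg_cst|exact: bump_cvg].
- exact: intg_norm.
- move=> n x _; rewrite normrM ler_piMr//; have /andP[b0 b1] := bump_bnd n p q x.
  by rewrite ger0_norm.
have -> // : \int[mu]_(x in `[u, v]) (h x * \1_(`]p, q[%classic) x) = \int[mu]_(x in `[p, q]) h x.
have sub : `[p, q]%classic `<=` `[u, v]%classic.
  by move=> x /=; rewrite !in_itv /= => /andP[px xq]; rewrite (le_trans up px) (le_trans xq qv).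
rewrite -[RHS]Rint_open_closed; last exact: (intg_sub (measurable_itv _) (measurable_itv _) sub ih).
rewrite Rint_restrict [RHS]Rint_restrict; apply: eq_Rintegral => x _.
rewrite -mulrA; congr (_ * _); rewrite !indicE.
have [xpq|] := boolP (x \in `]p, q[%classic); last by rewrite mul0r.
rewrite mul1r mem_set//; apply: sub; move: xpq; rewrite inE /= !in_itv /=.
by move=> /andP[/ltW -> /ltW ->].
Qed.

(** Lebesgue differentiation: the integral from [-n] vanishes identically, while its derivative is
    [g] at almost every point above [-n]. The half-lines cover the line. *)
Lemma locint_zero g : measurable_fun setT g -> locint g ->
  (forall p q, p < q -> \int[mu]_(x in `[p, q]) g x = 0) -> g = cst 0 %[ae mu].
Proof.
move=> mg lg g0.
have lig : locally_integrable setT g.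
  split => //; first exact: openT.
  move=> K _ cK; have [M [_ HM]] := compact_bounded cK.
  have KM : K `<=` `[- (M + 1), M + 1]%classic.
    move=> x Kx /=; rewrite in_itv /= -ler_norml; apply: (HM (M + 1)) => //.
    by rewrite ltrDl.
  have /integrableP[_] : intg K g.
    by apply: (intg_sub _ _ KM (lg _ _)) => //; exact: compact_measurable.
  by [].
have H n : \forall x \ae mu, - n%:R < x -> g x = 0.
  have := @FTC1 R g (BLeft (- n%:R)) (fun y => lg _ _) lig.
  apply: ae_imp => x H xn.
  have [D <-] := H xn.
  rewrite derive1E.
  have e : \near x, (fun=> 0 : R) x = (fun x : R => \int[mu]_(t in [set` Interval (BLeft (- n%:R)) (BRight x)]) g t) x.
    near=> z; rewrite g0//; near: z; exists (x + n%:R) => /=; first by rewrite -ltrBlDr sub0r.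
    by move=> z /=; rewrite ltr_norml => /andP[]; lra.
  by case: (near_eq_is_derive e (is_derive_const 0 x)).
have := ae_foralln H; apply: ae_imp => x Hx _ /=.
have [n Hn] : exists n : nat, `|x| < n%:R.
  by exists (Num.trunc `|x|).+1; exact: truncnS_gt.
by apply: (Hx n); move: Hn; rewrite ltr_norml => /andP[].
Unshelve. all: by end_near. Qed.

Lemma Mcover (p q : R) : exists M, [/\ 1 <= M, - M <= p & q <= M].
Proof.
exists (1 + `|p| + `|q|).
have := ler_norm q; have := ler_norm (- p); rewrite normrN.
have := normr_ge0 p; have := normr_ge0 q; split; lra.
Qed.

(** Testing against bumps and passing to the limit gives vanishing integrals over all intervals. *)
Lemma wd_zero g : measurable_fun setT g -> locint g ->
  (forall phi, test_function phi -> \int[mu]_x (g x * phi x) = 0) -> g = cst 0 %[ae mu].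
Proof.
move=> mg lg H; apply: locint_zero => // p q pq.
have [M [_ Mp qM]] := Mcover p q.
have := bump_lim (lg (- M) M) Mp qM.
have E n : \int[mu]_(x in `[- M, M]) (g x * bump n p q x) = 0.
  rewrite -(H _ (test_bump n p q)).
  have [||_ <- //] := @intg_supp (fun x => g x * bump n p q x) M.
    move=> x Mx; rewrite bump_out ?mulr0//.
    have [x0|x0] := leP 0 x.
      by right; apply: le_trans qM _; move: Mx; rewrite (ger0_norm x0) => /ltW.
    by left; move: Mx; rewrite (ltr0_norm x0); lra.
  exact: (intg_mulc (@bump_cont R n p q) (lg _ _)).
have -> : (fun n => \int[mu]_(x in `[- M, M]) (g x * bump n p q x)) = fun=> 0 by apply/funext.
by move=> h; exact: lim_uniq h (cvg_cst 0).
Qed.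

(** The combination of a bump on []p, q[] and a bump on []0, 1[] with zero total integral is the
    derivative of a test function. In the limit the mean of [h] over [[p, q]] equals its mean over
    [[0, 1]]. *)
Lemma du_bois_reymond h : measurable_fun setT h -> locint h ->
  (forall phi, test_function phi -> \int[mu]_x (h x * (phi^`())%classic x) = 0) ->
  exists c, h = cst c %[ae mu].
Proof.
move=> mh lh H; pose c := \int[mu]_(x in `[0, 1]) h x; exists c.
have l1 : locint (fun=> 1 : R) by move=> u v; exact: intg_itv_cst.
have lc : locint (fun=> c) by move=> u v; exact: intg_itv_cst.
have int1 (p q : R) : p <= q -> \int[mu]_(x in `[p, q]) (1 : R) = q - p.
  by move=> pq; rewrite (FTC pq (F := id) (fun x => is_derive_id x 1))//; exact: cst_continuous.
suff : (fun x => h x - c) = cst 0 %[ae mu].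
  by apply: ae_imp => x + _ => /(_ I) /eqP; rewrite subr_eq0 => /eqP.
apply: locint_zero; first exact: measurable_funB.
  by move=> u v; exact: intgB.
move=> p q pq; rewrite (RintB (measurable_itv _) (lh p q) (lc p q)).
have -> : \int[mu]_(x in `[p, q]) c = c * (q - p).
  rewrite -int1 ?(ltW pq)// -(RintZ c (measurable_itv _) (l1 p q)).
  by apply: eq_Rintegral => x _; rewrite mulr1.
have [M [M1 Mp qM]] := Mcover p q.
have M0 : - M <= 0 by lra.
have MM : - M <= M by lra.
pose S n := \int[mu]_(x in `[- M, M]) (1 * bump n p q x).
pose T n := \int[mu]_(x in `[- M, M]) (1 * bump n 0 1 x).
pose Sh n := \int[mu]_(x in `[- M, M]) (h x * bump n p q x).
pose Th n := \int[mu]_(x in `[- M, M]) (h x * bump n 0 1 x).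
have cS := bump_lim (l1 (- M) M) Mp qM; rewrite int1 ?(ltW pq)// in cS.
have cT := bump_lim (l1 (- M) M) M0 M1; rewrite int1 ?subr0// in cT.
have cSh := bump_lim (lh (- M) M) Mp qM.
have cTh := bump_lim (lh (- M) M) M0 M1.
have E n : T n * Sh n = S n * Th n.
  pose b x := T n * bump n p q x + (- S n) * bump n 0 1 x.
  have out x : x <= - M \/ M <= x -> b x = 0.
    rewrite /b => hx; rewrite !bump_out ?mulr0 ?addr0//; case: hx => hx; [left|right|left|right]; lra.
  have ib r s a : locint a -> intg `[- M, M] (fun x => a x * bump n r s x).
    by move=> la; exact: (intg_mulc (@bump_cont R n r s) (la _ _)).
  have lin a : locint a -> \int[mu]_(x in `[- M, M]) (a x * b x) =
     T n * \int[mu]_(x in `[- M, M]) (a x * bump n p q x) - S n * \int[mu]_(x in `[- M, M]) (a x * bump n 0 1 x).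
    move=> la; have i1 := ib p q a la; have i2 := ib 0 1 a la.
    rewrite -(RintZ (T n) (measurable_itv _) i1) -(RintZ (S n) (measurable_itv _) i2).
    rewrite -(RintB (measurable_itv _) (intgZ (T n) (measurable_itv _) i1) (intgZ (S n) (measurable_itv _) i2)).
    by apply: eq_Rintegral => x _; rewrite /b; ring.
  have [||phi [tphi dphi]] := @test_primitive b (- M) M _ MM out.
  - by apply: bump_add; apply: bump_scale; exact: bump_cls.
  - have := lin _ l1; rewrite -/(S n) -/(T n) [S n * _]mulrC subrr => <-.
    by apply: eq_Rintegral => x _; rewrite mul1r.
  have := H _ tphi; rewrite dphi.
  have [||_ ->] := @intg_supp (fun x => h x * b x) M.
  - move=> x Mx; rewrite out ?mulr0//.
    have [x0|x0] := leP 0 x.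
      by right; move: Mx; rewrite (ger0_norm x0) => /ltW.
    by left; move: Mx; rewrite (ltr0_norm x0); lra.
  - apply: (intg_mulc _ (lh _ _)) => x.
    by apply: cvgD; apply: cvgM; try exact: cvg_cst; exact: bump_cont.
  by rewrite lin// -/(Sh n) -/(Th n) => /eqP; rewrite subr_eq0 => /eqP.
have c1 : T n * Sh n @[n --> \oo] --> 1 * \int[mu]_(x in `[p, q]) h x by exact: cvgM cT cSh.
have c2 : S n * Th n @[n --> \oo] --> (q - p) * \int[mu]_(x in `[0, 1]) h x by exact: cvgM cS cTh.
have e12 : (fun n => T n * Sh n) = (fun n => S n * Th n) by apply/funext.
have c3 : T n * Sh n @[n --> \oo] --> (q - p) * \int[mu]_(x in `[0, 1]) h x.
  by rewrite e12; exact: c2.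
have := lim_uniq c1 c3; rewrite mul1r => ->; rewrite -/c; ring.
Qed.

End WeakDerivative.

Transparent n2 bump Rintegral.

Lemma Rint_eq0 (R : realType) (D : set R) (f : R -> R) : (forall x, f x = 0) ->
  \int[@lebesgue_measure R]_(x in D) f x = 0.
Proof. by move=> f0; rewrite /Rintegral integral0_eq// => x _; rewrite f0. Qed.

Opaque n2 bump Rintegral.

(** * Real functions of class H^1 on the line *)

Section RealH1.
Context {R : realType}.
Local Notation mu := (@lebesgue_measure R).
Implicit Types (a b f g h phi A : R -> R).

Definition wd a a' := forall phi, test_function phi ->
  \int[mu]_x (a x * (phi^`())%classic x) = - \int[mu]_x (a' x * phi x).

Lemma cont_locint f : continuous f -> locint f.
Proof. by move=> cf u v; exact: intg_cont. Qed.

Lemma sq_locint a : sq a -> locint a.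
Proof. by move=> sa u v; exact: sq_intg. Qed.

Lemma locintB f g : locint f -> locint g -> locint (fun x => f x - g x).
Proof. by move=> lf lg u v; apply: (intgB (measurable_itv _) (lf u v) (lg u v)). Qed.

(** Makes the product rule, and thus integration by parts, a case of [prim_chain]. *)
Lemma C1pair_mul : C1pair (fun p q : R => p * q) (fun _ q => q) (fun p _ => p).
Proof.
split.
- move=> M; exists (Num.max M 0); split; first by rewrite le_max lexx orbT.
  move=> p q p' q' hp hq hp' hq'.
  have -> : p * q - p' * q' = (p - p') * q + p' * (q - q') by ring.
  apply: le_trans (ler_normD _ _) _; rewrite !normrM mulrDr [X in X + _]mulrC.
  by apply: lerD; rewrite ler_wpM2r// le_max ?hq ?hp'.
- by move=> M; exists 1; split => // p q p' q' _ _ _ _; rewrite mul1r lerDr.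
- by move=> M; exists 1; split => // p q p' q' _ _ _ _; rewrite mul1r lerDl.
- move=> P Q x p' q' dP dQ; apply: (is_derive_val (is_derive_mul dP dQ)); ring.
Qed.

Lemma prim_C1 f f' : (forall x : R, is_derive x 1 f (f' x)) -> continuous f' -> prim f f'.
Proof.
move=> df cf; split; first exact: cont_locint.
by move=> x y xy; rewrite (FTC xy df).
Qed.

Lemma prim_mul (p p' q q' : R -> R) : prim p p' -> prim q q' ->
  prim (fun x => p x * q x) (fun x => q x * p' x + p x * q' x).
Proof. exact: (prim_chain C1pair_mul). Qed.

Lemma tf_prim phi : test_function phi -> prim phi (phi^`())%classic.
Proof. by move=> t; apply: prim_C1; [exact: tf_der|exact: tf_cont']. Qed.

Lemma tf_int phi M a : test_function phi -> locint a ->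
  (forall x, M <= `|x| -> phi x = 0 /\ (phi^`())%classic x = 0) ->
  (intg setT (fun x => a x * phi x) /\
   \int[mu]_x (a x * phi x) = \int[mu]_(x in `[- M, M]) (a x * phi x)) /\
  (intg setT (fun x => a x * (phi^`())%classic x) /\
  \int[mu]_x (a x * (phi^`())%classic x) = \int[mu]_(x in `[- M, M]) (a x * (phi^`())%classic x)).
Proof.
move=> t la HM; split; apply: intg_supp.
- by move=> x /ltW /HM[-> _]; rewrite mulr0.
- exact: (intg_mulc (tf_cont t) (la _ _)).
- by move=> x /ltW /HM[_ ->]; rewrite mulr0.
- exact: (intg_mulc (tf_cont' t) (la _ _)).
Qed.

Lemma prim_wd A a : prim A a -> wd A a.
Proof.
move=> pA phi t; have [M [M0 HM]] := tf_supp t.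
have la : locint a by case: pA.
have lA : locint A by apply: cont_locint; exact: prim_cont pA.
have [[i1 e1] _] := tf_int t la HM; have [_ [i2 e2]] := tf_int t lA HM.
rewrite e1 e2.
have [_ /(_ (- M) M)] := prim_mul pA (tf_prim t).
have -> : phi M = 0 by case: (HM M); rewrite // gtr0_norm.
have -> : phi (- M) = 0 by case: (HM (- M)); rewrite // normrN gtr0_norm.
rewrite !mulr0 subr0 => /(_ _)/esym h.
have MM : - M <= M by lra.
have := h MM.
have j1 : intg `[- M, M] (fun x => phi x * a x).
  have := intg_mulc (tf_cont t) (la (- M) M); congr (intg _ _).
  by apply/funext => x; rewrite mulrC.
have j2 : intg `[- M, M] (fun x => A x * (phi^`())%classic x).
  exact: (intg_mulc (tf_cont' t) (lA _ _)).
rewrite (RintD (measurable_itv _) j1 j2) => /eqP; rewrite addrC addr_eq0 => /eqP ->.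
by congr (- _); apply: eq_Rintegral => x _; rewrite mulrC.
Qed.

(** The oriented integral from 0 to [x]: for [x] different from 0 one of the two intervals is
    empty. *)
Definition prim0 a (x : R) := \int[mu]_(z in `[0, x]) a z - \int[mu]_(z in `[x, 0]) a z.

Lemma Rint_empty a (u v : R) : v <= u -> \int[mu]_(z in `[u, v]) a z = 0.
Proof.
rewrite le_eqVlt => /predU1P[->|uv]; first by rewrite set_itv1 Rintegral_set1.
by rewrite set_itv_ge ?Rintegral_set0// bnd_simp -ltNge.
Qed.

Lemma prim0P a : locint a -> prim (prim0 a) a.
Proof.
move=> la; split => // x y xy; rewrite /prim0.
have [x0|x0] := leP 0 x.
  rewrite (Rint_empty a x0) (Rint_empty a (le_trans x0 xy)) !subr0.
  by rewrite (itv_split x0 xy (la _ _)); ring.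
rewrite (Rint_empty a (ltW x0)).
have [y0|y0] := leP 0 y.
  by rewrite (Rint_empty a y0) (itv_split (ltW x0) y0 (la _ _)); ring.
by rewrite (Rint_empty a (ltW y0)) (itv_split xy (ltW y0) (la _ _)); ring.
Qed.

Lemma prim_addc A a c : prim A a -> prim (fun x => A x + c) a.
Proof. by move=> [la pa]; split => // x y xy; rewrite -pa//; ring. Qed.

Lemma wdB a a' b b' : locint a -> locint a' -> locint b -> locint b' ->
  wd a a' -> wd b b' -> wd (fun x => a x - b x) (fun x => a' x - b' x).
Proof.
move=> la la' lb lb' wa wb phi t; have [M [M0 HM]] := tf_supp t.
have [[i1 _] _] := tf_int t la' HM; have [_ [i2 _]] := tf_int t la HM.
have [[i3 _] _] := tf_int t lb' HM; have [_ [i4 _]] := tf_int t lb HM.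
under eq_Rintegral do rewrite mulrBl.
under [in RHS]eq_Rintegral do rewrite mulrBl.
rewrite (RintB measurableT i2 i4) (RintB measurableT i1 i3) (wa _ t) (wb _ t).
by rewrite opprD.
Qed.

Lemma wd_unique a b c : measurable_fun setT b -> measurable_fun setT c ->
  locint b -> locint c -> wd a b -> wd a c -> b = c %[ae mu].
Proof.
move=> mb mc lb lc wb wc.
suff : (fun x => b x - c x) = cst 0 %[ae mu].
  by apply: ae_imp => x + _ => /(_ I) /eqP; rewrite subr_eq0 => /eqP.
apply: wd_zero; [exact: measurable_funB|exact: locintB|move=> phi t].
have [M [M0 HM]] := tf_supp t.
have [[i1 _] _] := tf_int t lb HM; have [[i3 _] _] := tf_int t lc HM.
under eq_Rintegral do rewrite mulrBl.
rewrite (RintB measurableT i1 i3).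
by have := wb _ t; rewrite (wc _ t) => /oppr_inj ->; rewrite subrr.
Qed.

Lemma wd_ae a b a' b' : measurable_fun setT a -> measurable_fun setT b ->
  measurable_fun setT a' -> measurable_fun setT b' ->
  a = b %[ae mu] -> a' = b' %[ae mu] -> wd a a' -> wd b b'.
Proof.
move=> ma mb ma' mb' e e' wa phi t.
have mphi := continuous_measurable_fun (tf_cont t).
have mphi' := continuous_measurable_fun (tf_cont' t).
have := wa _ t.
rewrite (@ae_Rint _ _ _ (fun x => b x * (phi^`())%classic x))//; try exact: measurable_funM.
  rewrite (@ae_Rint _ _ (fun x => a' x * _) (fun x => b' x * phi x))//; try exact: measurable_funM.
  by apply: ae_imp e' => x + h => ->.
by apply: ae_imp e => x + h => ->.
Qed.

(** The difference between [a] and the primitive of [a'] has zero weak derivative, so it is constant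
    by du Bois-Reymond: an H^1 function has an absolutely continuous representative. *)
Lemma wd_prim a a' : measurable_fun setT a -> locint a -> locint a' -> wd a a' ->
  exists A, prim A a' /\ a = A %[ae mu].
Proof.
move=> ma la la' wa.
have pA := prim0P la'; have cA := prim_cont pA.
have mA := continuous_measurable_fun cA.
have [|||c hc] := @du_bois_reymond R (fun x => a x - prim0 a' x).
- exact: measurable_funB.
- by apply: locintB => //; exact: cont_locint.
- move=> phi t; have := wdB la la' (cont_locint cA) la' wa (prim_wd pA) t.
  by move=> ->; rewrite Rint_eq0 ?oppr0// => x; rewrite subrr mul0r.
exists (fun x => prim0 a' x + c); split; first exact: prim_addc.
by apply: ae_imp hc => x + _ => /(_ I) /= <-; rewrite addrC subrK.
Qed.

Lemma L2lim_pair (f_ : nat -> R -> R) a psi : (forall n, sq (f_ n)) -> L2lim f_ a -> sq psi ->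
  \int[mu]_x (f_ n x * psi x) @[n --> \oo] --> \int[mu]_x (a x * psi x).
Proof.
move=> sf [sa ca] sp.
have c0 : n2 psi * n2 (fun x => f_ n x - a x) @[n --> \oo] --> 0 by exact: cvgM0.
apply/cvgrPdist_le => e e0; move/cvgrPdist_le: c0 => /(_ _ e0).
apply: filterS => n; rewrite sub0r normrN ger0_norm ?mulr_ge0 ?n2_ge0// => h.
rewrite distrC -(RintB measurableT (sqM_intg (sf n) sp) (sqM_intg sa sp)).
apply: le_trans h; rewrite mulrC.
apply: le_trans (cauchy_schwarz (sqB (sf n) sa) sp).
by under eq_Rintegral do rewrite -mulrBl.
Qed.

Lemma tf_sq phi : test_function phi -> sq phi /\ sq (phi^`())%classic.
Proof.
move=> t; have [M [M0 HM]] := tf_supp t.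
have key f : continuous f -> (forall x, M <= `|x| -> f x = 0) -> sq f.
  move=> cf f0; have := sq_bounded_itv (- M) M cf; congr sq; apply/funext => x.
  rewrite indicE; have [xM|xM] := boolP (x \in `[- M, M]%classic); first by rewrite mulr1.
  rewrite mulr0 f0//; move: xM; rewrite notin_setE /= in_itv /= -ler_norml => /negP.
  by rewrite -ltNge => /ltW.
by split; apply: key; [exact: tf_cont|by move=> x /HM[]|exact: tf_cont'|by move=> x /HM[]].
Qed.

(** Both sides of the defining identity are continuous in L^2, test functions being square
    integrable: the weak derivative is a closed operator. *)
Lemma wd_lim (f_ g_ : nat -> R -> R) a b : (forall n, sq (f_ n)) -> (forall n, sq (g_ n)) ->
  (forall n, wd (f_ n) (g_ n)) -> L2lim f_ a -> L2lim g_ b -> wd a b.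
Proof.
move=> sf sg w la lb phi t; have [s1 s2] := tf_sq t.
have c1 := L2lim_pair sf la s2; have c2 := cvgN (L2lim_pair sg lb s1).
apply: lim_uniq c1 _.
have E : (fun n => \int[mu]_x (f_ n x * (phi^`())%classic x)) =
  (fun n => - \int[mu]_x (g_ n x * phi x)).
  by apply/funext => n; rewrite (w n _ t).
by rewrite E; exact: c2.
Qed.

Lemma n2_unit_itv (x : R) : n2 (\1_(`[x, x + 1]%classic)) = 1.
Proof.
have x1 : x <= x + 1 by lra.
suff : n2 (\1_(`[x, x + 1]%classic)) ^+ 2 = 1.
  by move=> /eqP; rewrite -[X in _ == X](expr1n _ 2) eqrXn2 ?n2_ge0// => /eqP.
have := n2_indic `[x, x + 1]%classic (fun=> 1 : R).
under [X in n2 X]eq_fun do rewrite mul1r.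
move=> ->; under eq_Rintegral do rewrite expr1n.
rewrite (FTC x1 (F := id) (fun x => is_derive_id x 1)); last exact: cst_continuous.
by rewrite addrAC subrr add0r.
Qed.

Lemma Rint_unit_le (x : R) a : sq a ->
  \int[mu]_(y in `[x, x + 1]) `|a y| <= n2 (fun y => a y * \1_(`[x, x + 1]%classic) y).
Proof.
move=> sa; set I := `[x, x + 1]%classic.
have si : sq (\1_I : R -> R).
  have := sq_bounded_itv x (x + 1) (@cst_continuous R R 1).
  by congr sq; apply/funext => y; rewrite mul1r.
have := cauchy_schwarz (sq_norm (sq_indic (measurable_itv `[x, x + 1]) sa)) si.
rewrite n2_unit_itv mulr1 n2_norm; apply: le_trans.
rewrite Rint_restrict; apply: le_trans (ler_norm _).
rewrite le_eqVlt; apply/orP; left; apply/eqP; apply: eq_Rintegral => y _.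
by rewrite normrM -mulrA; congr (_ * _); rewrite indicE; case: (_ \in _); rewrite ?normr1 ?normr0 ?mulr1 ?mulr0.
Qed.

(** Average [|A x| <= |A y| + |A y - A x|] over [y] in a unit interval and apply Cauchy-Schwarz,
    where the indicator has norm 1. Keeping the norms local yields decay at infinity as well as
    boundedness. *)
Lemma sobolev_loc A a x : prim A a -> sq A -> sq a ->
  `|A x| <= n2 (fun y => A y * \1_(`[x, x + 1]%classic) y) +
            n2 (fun y => a y * \1_(`[x, x + 1]%classic) y).
Proof.
move=> pA sA sa; apply: le_trans (lerD (Rint_unit_le x sA) (Rint_unit_le x sa)).
have x1 : x <= x + 1 by lra.
set c := \int[mu]_(y in `[x, x + 1]) `|a y|.
have int1 (k : R) : \int[mu]_(y in `[x, x + 1]) k = k.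
  have dF (y : R) : is_derive y 1 (fun y => k * y) k.
    by apply: (is_derive_val (is_derive_scale k (is_derive_id y 1))); rewrite mulr1.
  by rewrite (FTC x1 dF); [ring|exact: cst_continuous].
have iA : intg `[x, x + 1] (fun y => `|A y|) by apply: intg_norm; exact: sq_intg.
have E2 : \int[mu]_(y in `[x, x + 1]) `|A y| + c = \int[mu]_(y in `[x, x + 1]) (`|A y| + c).
  by rewrite (RintD (measurable_itv _) iA (intg_itv_cst _ _ c)) int1.
rewrite E2 -[leLHS]int1.
apply: Rint_le => //; first exact: intg_itv_cst.
  exact: (intgD (measurable_itv _) iA (intg_itv_cst _ _ c)).
move=> y; rewrite /= in_itv /= => /andP[xy yx].
have -> : A x = A y - (A y - A x) by ring.
apply: le_trans (ler_normB _ _) _; rewrite lerD2l.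
exact: (prim_le pA (lexx x) xy yx).
Qed.

Lemma sobolev A a x : prim A a -> sq A -> sq a -> `|A x| <= n2 A + n2 a.
Proof.
move=> pA sA sa; apply: le_trans (sobolev_loc x pA sA sa) _.
by apply: lerD; exact: n2_indic_le.
Qed.

Lemma n2_unit_decay (s_ : nat -> R) a : sq a -> (forall x, \forall n \near \oo, x \notin `[s_ n, s_ n + 1]) ->
  n2 (fun y => a y * \1_(`[s_ n, s_ n + 1]%classic) y) @[n --> \oo] --> 0.
Proof.
move=> sa far.
have [| | | |_] := @n2_dct R (fun n y => a y * \1_(`[s_ n, s_ n + 1]%classic) y) (fun=> 0) (fun x => `|a x|).
- by move=> n; exact: sq_indic.
- move=> x; apply: cvg_near_cst; near=> n; rewrite indicE memNset ?mulr0//=.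
  by apply/negP; near: n; exact: far.
- exact: sq_norm.
- by move=> n x; rewrite normrM ler_piMr// indic_le1.
have E : (fun n => n2 (fun x => a x * \1_(`[s_ n, s_ n + 1]%classic) x - 0)) =
  (fun n => n2 (fun x => a x * \1_(`[s_ n, s_ n + 1]%classic) x)).
  by apply/funext => n; congr n2; apply/funext => x; rewrite subr0.
by rewrite E.
Unshelve. all: by end_near. Qed.

(** The unit intervals eventually leave every point, so the local norms tend to 0 by dominated
    convergence. This removes the boundary terms when parts are integrated over [[-n, n]]. *)
Lemma sobolev_decay (s_ : nat -> R) A a : prim A a -> sq A -> sq a ->
  (forall x, \forall n \near \oo, x \notin `[s_ n, s_ n + 1]) ->
  A (s_ n) @[n --> \oo] --> 0.
Proof.
move=> pA sA sa far.
have c := cvgD0 (n2_unit_decay sA far) (n2_unit_decay sa far).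
apply/cvgrPdist_le => e e0; move/cvgrPdist_le: c => /(_ _ e0).
apply: filterS => n; rewrite !sub0r !normrN [X in X <= _ -> _]ger0_norm ?addr_ge0 ?n2_ge0//.
by apply: le_trans; exact: sobolev_loc.
Qed.

End RealH1.

(** * Derivatives of cosine and sine transforms *)

Transparent Rintegral.

Section TrigDerivative.
Context {R : realType}.
Local Notation mu := (@lebesgue_measure R).
Implicit Types (a b f g A : R -> R).

(** Multiplication by [xi] is unbounded on L^2, so the limit is taken on each [[-m, m]], where it is
    bounded by [m]; the remainder [r_ n] is uniform in [xi]. The identity then holds almost
    everywhere on the union of these intervals. *)
Lemma L2lim_multiplier (f_ g_ : nat -> R -> R) (r_ : nat -> R) F G (k : R) :
  (forall n, sq (f_ n)) -> (forall n, sq (g_ n)) -> L2lim f_ F -> L2lim g_ G ->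
  (forall n xi, `|f_ n xi - k * xi * g_ n xi| <= r_ n) -> r_ n @[n --> \oo] --> 0 ->
  F = (fun xi => k * xi * G xi) %[ae mu].
Proof.
move=> sf sg [sF cF] [sG cG] Hr cr.
have mF := sF.1; have mG := sG.1.
have mkG : measurable_fun setT (fun xi => k * xi * G xi).
  by apply: measurable_funM => //; exact: measurable_funM.
suff H m : \forall x \ae mu, x \in `[- m%:R, m%:R]%classic -> F x - k * x * G x = 0.
  have := ae_foralln H; apply: ae_imp => x Hx _.
  apply/eqP; rewrite -subr_eq0; apply/eqP.
  apply: (Hx (Num.trunc `|x|).+1); rewrite inE /= in_itv /= -ler_norml ltW//.
  exact: truncnS_gt.
set J := `[- m%:R, m%:R]%classic.
have mI : measurable J by exact: measurable_itv.
have bndM f : sq f -> sq (fun xi => k * xi * f xi * \1_J xi) /\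
    n2 (fun xi => k * xi * f xi * \1_J xi) <= `|k| * m%:R * n2 f.
  move=> s.
  have le xi : `|k * xi * f xi * \1_J xi| <= `|(`|k| * m%:R) * f xi|.
    rewrite indicE; have [xI|_] := boolP (xi \in J); last by rewrite mulr0 normr0.
    rewrite mulr1 !normrM normr_id; apply: ler_wpM2r => //; apply: ler_wpM2l => //.
    rewrite [leRHS]ger0_norm//.
    by move: xI; rewrite /J inE /= in_itv /= -ler_norml.
  have sk := sqZ (`|k| * m%:R) s.
  have s1 : sq (fun xi => k * xi * f xi * \1_J xi).
    apply: (sq_le _ le sk).
    apply: measurable_funM; last by apply: measurable_indic.
    apply: measurable_funM; last by case: s.
    by apply: measurable_funM.
  split => //; apply: le_trans (n2_le s1 sk le) _.
  by rewrite n2Z// ger0_norm// mulr_ge0.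
pose D xi := (F xi - k * xi * G xi) * \1_J xi.
have sD : sq D.
  have := sqB (sq_indic mI sF) (bndM _ sG).1.
  by congr sq; apply/funext => xi; rewrite /D mulrBl.
have s1 : sq (\1_J : R -> R).
  have := sq_bounded_itv (- m%:R) m%:R (@cst_continuous R R 1).
  by congr sq; apply/funext => y; rewrite mul1r.
have est n : n2 D <= n2 (fun x => f_ n x - F x) + (`|k| * m%:R * n2 (fun x => g_ n x - G x) + n2 (\1_J : R -> R) * r_ n).
  pose e1 xi := - (f_ n xi - F xi) * \1_J xi.
  pose e2 xi := k * xi * (g_ n xi - G xi) * \1_J xi.
  pose e3 xi := (f_ n xi - k * xi * g_ n xi) * \1_J xi.
  have se1 : sq e1 by apply: sq_indic => //; apply: sqN; exact: sqB.
  have [se2 ne2] := bndM _ (sqB (sg n) sG).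
  have le3 xi : `|e3 xi| <= `|r_ n * \1_J xi|.
    rewrite /e3 !normrM ler_wpM2r//; apply: le_trans (Hr n xi) (ler_norm _).
  have sr := sqZ (r_ n) s1.
  have se3 : sq e3.
    apply: (sq_le _ le3 sr); apply: measurable_funM; last by apply: measurable_indic.
    apply: measurable_funB; first by case: (sf n).
    by apply: measurable_funM; [exact: measurable_funM|case: (sg n)].
  have r0 : 0 <= r_ n by apply: le_trans (Hr n 0).
  have -> : D = (fun xi => e1 xi + (e2 xi + e3 xi)).
    by apply/funext => xi; rewrite /D /e1 /e2 /e3; ring.
  apply: le_trans (n2_triangle se1 (sqD se2 se3)) _; apply: lerD.
    apply: le_trans (n2_indic_le mI (sqN (sqB (sf n) sF))) _.
    by rewrite n2N.
  apply: le_trans (n2_triangle se2 se3) _; apply: lerD => //.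
  apply: le_trans (n2_le se3 sr le3) _.
  by rewrite n2Z// ger0_norm// mulrC.
have c0 := cvgD0 cF (cvgD0 (cvgM0 (`|k| * m%:R) cG) (cvgM0 (n2 (\1_J : R -> R)) cr)).
have : n2 D = 0 by apply/eqP; rewrite eq_le n2_ge0 andbT; apply: (cvg0_ge c0).
move=> /(n2_eq0 sD); apply: ae_imp => x /(_ I) + xI.
by rewrite /D indicE xI mulr1.
Qed.

(** Integration by parts on [[-c, c]]; the difference consists of the two boundary terms. *)
Lemma parts_cos A a (c xi : R) : 0 <= c -> prim A a ->
  `|trigT cos c a xi - xi * trigT sin c A xi| <= `|A c| + `|A (- c)|.
Proof.
move=> c0 pA.
have dl (x : R) : is_derive x 1 (fun x => x * xi) xi.
  apply: (is_derive_val (is_derive_mul (is_derive_id x 1) (is_derive_const xi x))); ring.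
have dc (x : R) : is_derive x 1 (fun x => cos (x * xi)) (- sin (x * xi) * xi).
  exact: (@is_derive_compose R cos (fun x => x * xi) x _ _ (is_derive_cos (x * xi)) (dl x)).
have cc : continuous (fun x : R => - sin (x * xi) * xi).
  move=> x; apply: cvgM; last exact: cvg_cst.
  by apply: cvgN; apply: trig_mul_cont'; exact: trig_sin.
have [_ /(_ (- c) c)] := prim_mul pA (prim_C1 dc cc).
have cN : - c <= c by lra.
move=> /(_ cN) h.
have lA : locint A by apply: cont_locint; exact: prim_cont pA.
have la : locint a by case: pA.
have i1 : intg `[- c, c] (fun x => cos (x * xi) * a x) by apply: trigT_intg => //; exact: trig_cos.
have i2 : intg `[- c, c] (fun x => sin (x * xi) * A x) by apply: trigT_intg => //; exact: trig_sin.
have -> : trigT cos c a xi - xi * trigT sin c A xi = A c * cos (c * xi) - A (- c) * cos (- c * xi).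
  rewrite h /trigT -(RintZ xi (measurable_itv _) i2).
  rewrite -(RintB (measurable_itv _) i1 (intgZ xi (measurable_itv _) i2)).
  by apply: eq_Rintegral => x _; ring.
apply: le_trans (ler_normB _ _) _; rewrite !normrM.
by apply: lerD; rewrite ler_piMr//; exact: (trig_cos.2).
Qed.

Lemma parts_sin A a (c xi : R) : 0 <= c -> prim A a ->
  `|trigT sin c a xi - - xi * trigT cos c A xi| <= `|A c| + `|A (- c)|.
Proof.
move=> c0 pA.
have dl (x : R) : is_derive x 1 (fun x => x * xi) xi.
  apply: (is_derive_val (is_derive_mul (is_derive_id x 1) (is_derive_const xi x))); ring.
have dc (x : R) : is_derive x 1 (fun x => sin (x * xi)) (cos (x * xi) * xi).
  exact: (@is_derive_compose R sin (fun x => x * xi) x _ _ (is_derive_sin (x * xi)) (dl x)).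
have cc : continuous (fun x : R => cos (x * xi) * xi).
  move=> x; apply: cvgM; last exact: cvg_cst.
  by apply: trig_mul_cont'; exact: trig_cos.
have [_ /(_ (- c) c)] := prim_mul pA (prim_C1 dc cc).
have cN : - c <= c by lra.
move=> /(_ cN) h.
have lA : locint A by apply: cont_locint; exact: prim_cont pA.
have la : locint a by case: pA.
have i1 : intg `[- c, c] (fun x => sin (x * xi) * a x) by apply: trigT_intg => //; exact: trig_sin.
have i2 : intg `[- c, c] (fun x => cos (x * xi) * A x) by apply: trigT_intg => //; exact: trig_cos.
have -> : trigT sin c a xi - - xi * trigT cos c A xi = A c * sin (c * xi) - A (- c) * sin (- c * xi).
  rewrite h /trigT -(RintZ (- xi) (measurable_itv _) i2).
  rewrite -(RintB (measurable_itv _) i1 (intgZ (- xi) (measurable_itv _) i2)).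
  by apply: eq_Rintegral => x _; ring.
apply: le_trans (ler_normB _ _) _; rewrite !normrM.
by apply: lerD; rewrite ler_piMr//; exact: (trig_sin.2).
Qed.

Lemma prim_decay A a : prim A a -> sq A -> sq a ->
  `|A n%:R| + `|A (- n%:R)| @[n --> \oo] --> 0.
Proof.
move=> pA sA sa.
have d1 : A n%:R @[n --> \oo] --> 0.
  apply: (sobolev_decay pA sA sa) => x; near=> n.
  rewrite in_itv /= negb_and -ltNge; apply/orP; left.
  by near: n; exact: nbhs_infty_gtr.
have d2 : A (- n%:R) @[n --> \oo] --> 0.
  apply: (sobolev_decay pA sA sa) => x; near=> n.
  rewrite in_itv /= negb_and -!ltNge; apply/orP; right.
  have : 1 - x < n%:R by near: n; exact: nbhs_infty_gtr.
  lra.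
apply: cvgD0; rewrite -(@normr0 _ R); exact: cvg_norm.
Unshelve. all: by end_near. Qed.

Lemma trig_deriv_cos A a C' S : prim A a -> sq A -> sq a ->
  L2lim (trigN cos a) C' -> L2lim (trigN sin A) S ->
  C' = (fun xi => 1 * xi * S xi) %[ae mu].
Proof.
move=> pA sA sa lC lS.
apply: (L2lim_multiplier _ _ lC lS _ (prim_decay pA sA sa)).
- by move=> n; apply: trigN_sq => //; left.
- by move=> n; apply: trigN_sq => //; right.
- by move=> n xi; rewrite mul1r; exact: parts_cos.
Qed.

Lemma trig_deriv_sin A a C S' : prim A a -> sq A -> sq a ->
  L2lim (trigN sin a) S' -> L2lim (trigN cos A) C ->
  S' = (fun xi => -1 * xi * C xi) %[ae mu].
Proof.
move=> pA sA sa lS lC.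
apply: (L2lim_multiplier _ _ lS lC _ (prim_decay pA sA sa)).
- by move=> n; apply: trigN_sq => //; right.
- by move=> n; apply: trigN_sq => //; left.
- by move=> n xi; rewrite mulN1r; exact: parts_sin.
Qed.

(** Differentiation under the integral sign in integrated form: Fubini reduces it to integrating
    [tr' (x xi) x] in [xi] for fixed [x]. *)
Lemma trig_prim (tr tr' : R -> R) (c : R) g : 
  trig tr -> trig tr' -> (forall x : R, is_derive x 1 tr (tr' x)) ->
  intg `[- c, c] g -> intg `[- c, c] (fun x => x * g x) ->
  prim (trigT tr c g) (trigT tr' c (fun x => x * g x)).
Proof.
move=> ht ht' d ig ixg; split.
  by apply: cont_locint; exact: trigT_cont.
move=> eta zeta ez.
have := @fubini_mul R `[eta, zeta] `[- c, c] (fun=> 1) (fun x => x * g x) (fun xi x => tr' (x * xi)) 1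
  (measurable_itv _) (measurable_itv _) (intg_itv_cst _ _ _) ixg (trig_meas2' ht') (fun x y => ht'.2 _).
move=> [e _].
transitivity (\int[mu]_(x in `[eta, zeta]) (1 * trigT tr' c (fun x => x * g x) x)); last first.
  by apply: eq_Rintegral => x _; rewrite mul1r.
rewrite e /trigT -(RintB (measurable_itv _) (trigT_intg ht ig _) (trigT_intg ht ig _)).
apply: eq_Rintegral => x _.
have dl (xi : R) : is_derive xi 1 (fun xi => x * xi) x.
  by apply: (is_derive_val (is_derive_scale x (is_derive_id xi 1))); rewrite mulr1.
have df (xi : R) : is_derive xi 1 (fun xi => tr (x * xi)) (tr' (x * xi) * x).
  exact: (is_derive_compose (d (x * xi)) (dl xi)).
have cf : continuous (fun xi : R => tr' (x * xi) * x).
  by move=> xi; apply: cvgM; [exact: trig_mul_cont|exact: cvg_cst].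
rewrite -mulrBl -(FTC ez df cf) mulrC -mulrA; have ic := intg_cont eta zeta (@trig_mul_cont R tr' ht' x).
have -> : \int[mu]_(x0 in `[eta, zeta]) (tr' (x * x0) * x) = x * \int[mu]_(x0 in `[eta, zeta]) (tr' (x * x0)).
  by rewrite -(RintZ x (measurable_itv _) ic); apply: eq_Rintegral => z _; rewrite mulrC.
rewrite mulrCA; congr (_ * (_ * _)).
by apply: eq_Rintegral => z _; rewrite mulr1.
Qed.

Lemma trig_wd_sin g S C' : sq g -> sq (fun x => x * g x) ->
  L2lim (trigN sin g) S -> L2lim (trigN cos (fun x => x * g x)) C' -> wd S C'.
Proof.
move=> sg sxg lS lC; apply: (wd_lim _ _ _ lS lC).
- by move=> n; apply: trigN_sq => //; right.
- by move=> n; apply: trigN_sq => //; left.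
- move=> n; apply: prim_wd; apply: trig_prim; try exact: sq_intg.
  + exact: trig_sin.
  + exact: trig_cos.
Qed.

Lemma trig_wd_cos g C S' : sq g -> sq (fun x => x * g x) ->
  L2lim (trigN cos g) C -> L2lim (trigN sin (fun x => x * g x)) S' -> wd C (fun x => - S' x).
Proof.
move=> sg sxg lC lS.
have sN n : sq (trigN sin (fun x => x * g x) n) by apply: trigN_sq => //; right.
have lN : L2lim (fun n x => - trigN sin (fun x => x * g x) n x) (fun x => - S' x).
  have := L2limZ (-1) sN lS; congr L2lim.
    by apply/funext => n; apply/funext => x; rewrite mulN1r.
  by apply/funext => x; rewrite mulN1r.
apply: (wd_lim _ _ _ lC lN).
- by move=> n; apply: trigN_sq => //; left.
- by move=> n; exact: sqN.
- move=> n; apply: prim_wd.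
  have trsN : trig (fun x : R => - sin x).
    split; first by move=> x; apply: cvgN; exact: continuous_sin.
    by move=> x; rewrite normrN; exact: trig_sin.2.
  have := @trig_prim cos (fun x => - sin x) n%:R g trig_cos trsN (fun x => is_derive_cos x) (sq_intg _ _ sg) (sq_intg _ _ sxg).
  congr prim; apply/funext => xi; rewrite /trigN /trigT.
  have i1 := trigT_intg (tr := sin) trig_sin (sq_intg (- n%:R) n%:R sxg) xi.
  rewrite -[RHS]mulN1r -(RintZ (-1) (measurable_itv _) i1).
  by apply: eq_Rintegral => x _; rewrite mulN1r mulNr.
Qed.

End TrigDerivative.

(** * Integration of curves in a complete seminormed space *)

Transparent n2 bump.

Section Abstract.
Context {R : realType}.
Local Notation X := (R -> R[i]).
Implicit Types (u v w : X) (g h : R -> X).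

Definition sc (k : R) u : X := fun y => k%:C%C * u y.

Variables (H : X -> Prop) (N : X -> R).

(** [H] is the carrier and [N] a complete seminorm on it. Functions that agree almost everywhere are
    at distance 0 without being identified, so no quotient is formed. *)
Record seminormed : Prop := {
  sn_0 : H 0;
  sn_D : forall u v, H u -> H v -> H (u + v);
  sn_Z : forall k u, H u -> H (sc k u);
  sn_N0 : forall u, 0 <= N u;
  sn_tri : forall u v, H u -> H v -> N (u + v) <= N u + N v;
  sn_NZ : forall k u, H u -> N (sc k u) = `|k| * N u;
  sn_complete : forall f : nat -> X, (forall n, H (f n)) ->
    (forall e, 0 < e -> exists n0, forall m n, (n0 <= m)%N -> (n0 <= n)%N -> N (f m - f n) <= e) ->
    exists l, H l /\ N (f n - l) @[n --> \oo] --> 0 }.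

Hypothesis sn : seminormed.

Lemma scD k l u : sc (k + l) u = sc k u + sc l u.
Proof. by apply/funext => y; rewrite /sc rmorphD mulrDl. Qed.

Lemma scB k l u : sc (k - l) u = sc k u - sc l u.
Proof. by apply/funext => y; rewrite /sc rmorphB mulrBl. Qed.

Lemma scBr k u v : sc k (u - v) = sc k u - sc k v.
Proof. by apply/funext => y; rewrite /sc -mulrBr. Qed.

Lemma scN1 u : sc (-1) u = - u.
Proof. by apply/funext => y; rewrite /sc rmorphN1 mulN1r. Qed.

Lemma sc0 u : sc 0 u = 0.
Proof. by apply/funext => y; rewrite /sc rmorph0 mul0r. Qed.

Lemma snN u : H u -> H (- u).
Proof. by rewrite -scN1; exact: (sn_Z sn). Qed.

Lemma snB u v : H u -> H v -> H (u - v).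
Proof. by move=> hu hv; apply: (sn_D sn) => //; exact: snN. Qed.

Lemma N00 : N 0 = 0.
Proof. by rewrite -(sc0 0) (sn_NZ sn) ?normr0 ?mul0r//; exact: sn_0. Qed.

Lemma NN u : H u -> N (- u) = N u.
Proof. by move=> hu; rewrite -scN1 (sn_NZ sn)// normrN normr1 mul1r. Qed.

Lemma NC u v : H u -> H v -> N (u - v) = N (v - u).
Proof. by move=> hu hv; rewrite -(NN (snB hu hv)) opprB. Qed.

Lemma NtriB u v w : H u -> H v -> H w -> N (u - w) <= N (u - v) + N (v - w).
Proof.
move=> hu hv hw; have := sn_tri sn (snB hu hv) (snB hv hw).
by rewrite addrA subrK.
Qed.

Lemma NleB u v : H u -> H v -> N u <= N v + N (u - v).
Proof.
move=> hu hv; have := sn_tri sn hv (snB hu hv).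
by rewrite addrC subrK.
Qed.

Lemma NB u v : H u -> H v -> N (u - v) <= N u + N v.
Proof. by move=> hu hv; rewrite -(NN hv); apply: (sn_tri sn) => //; exact: snN. Qed.

Lemma Nsum (I : Type) (r : seq I) (f : I -> X) : (forall i, H (f i)) ->
  H (\sum_(i <- r) f i) /\ N (\sum_(i <- r) f i) <= \sum_(i <- r) N (f i).
Proof.
move=> hf; elim: r => [|i r [h1 h2]].
  by rewrite !big_nil N00; split => //; exact: sn_0.
rewrite !big_cons; split; first exact: (sn_D sn).
by apply: le_trans (sn_tri sn _ _) _ => //; rewrite lerD2l.
Qed.

Lemma N_lim_le (f : nat -> X) l e : (forall n, H (f n)) -> H l ->
  N (f n - l) @[n --> \oo] --> 0 -> (forall n, N (f n) <= e) -> N l <= e.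
Proof.
move=> hf hl cf le; rewrite -subr_le0.
rewrite -(cvg_lim _ cf)//; apply: limr_ge; first exact: cvgP cf.
apply: nearW => n; rewrite lerBlDr; apply: le_trans (NleB hl (hf n)) _.
by rewrite NC// addrC lerD2l.
Qed.

Definition contOn g (al be : R) := forall t, al <= t <= be -> forall e, 0 < e ->
  exists2 d : R, 0 < d & forall s, al <= s <= be -> `|s - t| < d -> N (g s - g t) < e.

Definition Hon g (al be : R) := forall t, al <= t <= be -> H (g t).

(** Compactness of the segment, read as follows: what holds for all small radii near each point
    holds for a common radius at all points. It supplies uniform continuity, boundedness, and the
    uniformity in [tau] in [step_good]. *)
Lemma near_cover (al be : R) (P : R -> R -> Prop) :
  (forall x, al <= x <= be -> exists2 d : R, 0 < d &
     forall y r, al <= y <= be -> `|y - x| < d -> 0 < r -> r < d -> P r y) ->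
  exists2 d : R, 0 < d & forall r y, 0 < r -> r < d -> al <= y <= be -> P r y.
Proof.
move=> HP.
have /compact_near_coveringP/(_ R (0^'+)%classic (fun r y => al <= y <= be -> P r y)) := @segment_compact R al be.
case.
- move=> x; rewrite /= in_itv /= => xab; have [d d0 Hd] := HP x xab.
  exists (ball x d, [set r | 0 < r < d]) => /=.
    split; first exact: nbhsx_ballx.
    near=> r; apply/andP; split; first by near: r; exact: nbhs_right_gt.
    by near: r; exact: nbhs_right_lt.
  move=> [y r] [/= yx /andP[r0 rd]] yab; apply: Hd => //.
  by rewrite distrC.
move=> d /= d0 Hd; exists d => // r y r0 rd yab.
apply: (Hd r) => //=; by rewrite sub0r normrN gtr0_norm.
Unshelve. all: by end_near. Qed.

Lemma unif_cont g al be : Hon g al be -> contOn g al be -> forall e, 0 < e ->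
  exists2 d : R, 0 < d & forall s t, al <= s <= be -> al <= t <= be -> `|s - t| < d -> N (g s - g t) < e.
Proof.
move=> hg cg e e0.
have [|d d0 Hd] := @near_cover al be (fun r t => forall s, al <= s <= be -> `|s - t| < r -> N (g s - g t) < e).
  move=> x xab; have e2 : 0 < e / 2 by rewrite divr_gt0.
  have [d d0 Hd] := cg x xab _ e2.
  exists (d / 2); first by rewrite divr_gt0.
  move=> y r yab yx r0 rd s sab sy.
  have h1 : N (g s - g x) < e / 2.
    apply: Hd => //; have := ler_distD y s x; lra.
  have h2 : N (g y - g x) < e / 2 by apply: Hd => //; lra.
  apply: le_lt_trans (NtriB (hg _ sab) (hg _ xab) (hg _ yab)) _.
  by rewrite (NC (hg _ xab) (hg _ yab)) [e]splitr ltrD.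
exists (d / 2); first by rewrite divr_gt0.
move=> s t sab tab st; apply: (Hd (d / 2)) => //; lra.
Qed.

(** Cut [[s, t]] into equal pieces shorter than [d]; the increments of [L] add up, those of [D] obey
    the triangle inequality. *)
Lemma chain_incr (D : R -> X) (L : R -> R) al be d : Hon D al be -> 0 < d ->
  (forall s t, al <= s -> s <= t -> t <= be -> t - s < d -> N (D t - D s) <= L t - L s) ->
  forall s t, al <= s -> s <= t -> t <= be -> N (D t - D s) <= L t - L s.
Proof.
move=> hD d0 loc s t sa st tb.
have [k hk] : exists k : nat, t - s < k.+1%:R * d.
  exists (Num.trunc ((t - s) / d)); rewrite -ltr_pdivrMr//; exact: truncnS_gt.
elim: k t st tb hk => [|k IH] t st tb hk; first by apply: loc => //; rewrite mul1r in hk.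
(* Split off the last of [k + 2] equal pieces, so that the first [k + 1] fall under the induction
   hypothesis. *)
pose r := t - (t - s) / k.+2%:R.
have k0 : 0 < k.+2%:R :> R by [].
have ts0 : 0 <= (t - s) / k.+2%:R by rewrite divr_ge0 ?subr_ge0.
have h1 : (t - s) / k.+2%:R < d by rewrite ltr_pdivrMr// mulrC.
have h2 : (t - s) / k.+2%:R <= t - s.
  by rewrite ler_pdivrMr// ler_peMr ?subr_ge0// ler1n.
have rs : s <= r by rewrite /r lerBrDr -lerBrDl.
have rt : r <= t by rewrite /r gerBl.
have rb := le_trans rt tb.
have h3 : r - s < k.+1%:R * d.
  have -> : r - s = k.+1%:R * ((t - s) / k.+2%:R).
    have tsq : t - s = k.+2%:R * ((t - s) / k.+2%:R) by rewrite mulrC divfK// gt_eqF.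
    rewrite /r addrAC {1}tsq -(natr1 k.+1).
    by move: ((t - s) / _) => q; ring.
  by rewrite ltr_pM2l.
have := IH r rs rb h3.
have tr : t - r < d by rewrite /r opprB addrC subrK.
have := loc r t (le_trans sa rs) rt tb tr.
have hs : H (D s) by apply: hD; rewrite sa (le_trans st tb).
have ht : H (D t) by apply: hD; rewrite tb (le_trans sa st).
have hr : H (D r) by apply: hD; rewrite rb (le_trans sa rs).
have := NtriB ht hr hs.
by move: (N (D t - D s)) (N (D t - D r)) (N (D r - D s)) => x y z; lra.
Qed.

(* [J] is an antiderivative of [g], as a uniform mean value estimate; this replaces
   the vector-valued integral. *)
Definition is_antiderivative (J g : R -> X) al be := Hon J al be /\
  forall e, 0 < e -> exists2 d : R, 0 < d &
    forall s t xi, al <= s -> s <= xi -> xi <= t -> t <= be -> t - s < d ->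
      N (J t - J s - sc (t - s) (g xi)) <= e * (t - s).

(** The length of the part of [[0, h]] below [z]. With [z = t - tau n k] it is the time spent before
    [t] in the k-th subinterval. *)
Definition clip (h z : R) := if z <= 0 then 0 else if z <= h then z else h.

Lemma clipP (h z : R) : 0 <= h -> [\/ z <= 0 /\ clip h z = 0,
  0 < z /\ (z <= h /\ clip h z = z) | h < z /\ clip h z = h].
Proof.
move=> h0; rewrite /clip; have [z0|z0] := leP z 0; first by constructor 1.
by have [zh|zh] := leP z h; [constructor 2|constructor 3].
Qed.

Section Step.
Variables (g : R -> X) (al be : R).
Hypotheses (ab : al < be) (hg : Hon g al be) (cg : contOn g al be).

Let hh (n : nat) := (be - al) / n.+1%:R.
Let tau (n k : nat) := al + k%:R * hh n.

Let hh0 n : 0 < hh n. Proof. by rewrite divr_gt0 ?subr_gt0. Qed.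

Let ell n k (t : R) := clip (hh n) (t - tau n k).

Let tauS n k : tau n k.+1 = tau n k + hh n.
Proof. by rewrite /tau -natr1; ring. Qed.

Let tau_in n k : (k < n.+1)%N -> al <= tau n k <= be.
Proof.
move=> kn; rewrite lerDl mulr_ge0 ?(ltW (hh0 n))//=.
have -> : be = al + n.+1%:R * hh n.
  by rewrite /hh mulrC divfK ?pnatr_eq0//; ring.
by rewrite lerD2l ler_wpM2r ?(ltW (hh0 n))// ler_nat ltnW.
Qed.

Let ell_mono n k s t : s <= t -> ell n k s <= ell n k t.
Proof.
move=> st; rewrite /ell; move: (hh n) (tau n k) (hh0 n) => h q h0.
case: (@clipP h (s - q) (ltW h0)) => -[? ?]; case: (@clipP h (t - q) (ltW h0)) => -[? ?]; lra.
Qed.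

Let ell_sum n t : al <= t -> forall m, \sum_(k < m) ell n k t = clip (m%:R * hh n) (t - al).
Proof.
move=> at0; elim=> [|m IH].
  by rewrite big_ord0 mul0r /clip; case: ifPn => // h; case: ifPn => // h2; apply/eqP; rewrite eq_le h2 andbT; lra.
rewrite big_ord_recr /= IH /ell /tau -natr1.
have h0 := hh0 n; move: (hh n) h0 => h h0.
have mh0 : 0 <= m%:R * h by rewrite mulr_ge0// ltW.
rewrite mulrDl mul1r opprD addrA.
move: (m%:R * h) mh0 => q q0.
have qh0 : 0 <= q + h by lra.
case: (@clipP q (t - al) q0) => -[? ?]; case: (@clipP h (t - al - q) (ltW h0)) => -[? ?];
 case: (@clipP (q + h) (t - al) qh0) => -[? ?]; lra.
Qed.

(** Only subintervals that meet [[s, t]] carry weight, and their nodes are close to any point of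
    [[s, t]]. *)
Let ell_zero n k s t xi d : s <= xi -> xi <= t -> t - s < d -> hh n < d ->
  ell n k t - ell n k s != 0 -> `|tau n k - xi| < d + d.
Proof.
move=> sx xt ts hd; have h0 := hh0 n; move: h0 hd; rewrite /ell.
move: (hh n) (tau n k) => h q h0 hd; apply: contraR; rewrite -leNgt.
rewrite ler_normr => /orP q0; apply/eqP.
case: (@clipP h (s - q) (ltW h0)) => -[? ?]; case: (@clipP h (t - q) (ltW h0)) => -[? ?]; case: q0 => ?; lra.
Qed.

(** The integral from [al] to [t] of the step function with value [g (tau n k)] on the k-th of
    [n + 1] equal subintervals. *)
Let Jn n (t : R) : X := \sum_(k < n.+1) sc (ell n k t) (g (tau n k)).

Let hgt n (k : 'I_n.+1) : H (g (tau n k)).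
Proof. by apply: hg; apply: tau_in. Qed.

Let hJn n t : H (Jn n t).
Proof. by apply: (Nsum _ _).1 => k; apply: (sn_Z sn). Qed.

(** The estimate is uniform in [n]: nodes that contribute lie within [d / 2 + d / 2] of [xi], where
    [g] varies by less than [e], and the weights sum to [t - s]. *)
Let Jn_est e : 0 < e -> exists2 d : R, 0 < d & forall n, hh n < d ->
  forall s t xi, al <= s -> s <= xi -> xi <= t -> t <= be -> t - s < d ->
    N (Jn n t - Jn n s - sc (t - s) (g xi)) <= e * (t - s).
Proof.
move=> e0; have [d d0 Hd] := unif_cont hg cg e0.
exists (d / 2); first by rewrite divr_gt0.
move=> n hn s t xi sa sx xt tb ts.
have xib : al <= xi <= be by rewrite (le_trans sa sx) (le_trans xt tb).
have at0 : al <= t by exact: le_trans sa (le_trans sx xt).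
have hb : n.+1%:R * hh n = be - al by rewrite /hh mulrC divfK ?pnatr_eq0.
have tsE : t - s = \sum_(k < n.+1) (ell n k t - ell n k s).
  rewrite sumrB !ell_sum// hb.
  have b0 : 0 <= be - al by rewrite subr_ge0 ltW.
  have tl : t - al <= be - al by lra.
  have sl : s - al <= be - al by lra.
  have sl0 : 0 <= s - al by lra.
  case: (@clipP _ (t - al) b0) => -[? ?]; case: (@clipP _ (s - al) b0) => -[? ?]; lra.
have -> : Jn n t - Jn n s - sc (t - s) (g xi) =
    \sum_(k < n.+1) sc (ell n k t - ell n k s) (g (tau n k) - g xi).
  have -> : sc (t - s) (g xi) = \sum_(k < n.+1) sc (ell n k t - ell n k s) (g xi).
    rewrite tsE; elim/big_ind2: _ => //; first by rewrite sc0.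
    by move=> _ k1 _ k2 <- <-; rewrite scD.
  rewrite /Jn -!sumrB; apply: eq_bigr => k _.
  by rewrite scBr !scB.
have hk (k : 'I_n.+1) : H (sc (ell n k t - ell n k s) (g (tau n k) - g xi)).
  by apply: (sn_Z sn); apply: snB => //; exact: hg.
have ll (k : 'I_n.+1) : 0 <= ell n k t - ell n k s.
  by rewrite subr_ge0; apply: ell_mono; exact: le_trans sx xt.
apply: le_trans (Nsum _ hk).2 _.
rewrite tsE mulr_sumr; apply: ler_sum => k _.
rewrite (sn_NZ sn); last by apply: snB => //; exact: hg.
rewrite (ger0_norm (ll k)) mulrC.
have [->|l0] := eqVneq (ell n k t - ell n k s) 0; first by rewrite !mulr0.
apply: ler_wpM2r => //; apply: ltW; apply: Hd => //; first exact: tau_in.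
rewrite [d]splitr; exact: ell_zero sx xt ts hn l0.
Qed.

Let hh_small d : 0 < d -> exists n0, forall n, (n0 <= n)%N -> hh n < d.
Proof.
move=> d0; exists (Num.trunc ((be - al) / d)) => n hn.
rewrite /hh ltr_pdivrMr// mulrC -ltr_pdivrMr//.
by apply: lt_le_trans (truncnS_gt _) _; rewrite ler_nat.
Qed.

Let Jn0 n : Jn n al = 0.
Proof.
apply: big1 => k _; suff -> : ell n k al = 0 by exact: sc0.
have h0 := hh0 n; rewrite /ell.
by rewrite /clip subr_le0 lerDl mulr_ge0// ltW.
Qed.

(** Both [Jn m] and [Jn n] have increments near [sc (t - s) (g s)], so by [chain_incr] their
    difference grows at rate at most [2 * e]. Hence they converge at each [t], and the uniform
    estimate passes to the limit. *)
Lemma antiderivative_exists : exists J, is_antiderivative J g al be.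
Proof.
have diff m n t e d : 0 < d -> (forall n, hh n < d ->
  forall s t xi, al <= s -> s <= xi -> xi <= t -> t <= be -> t - s < d ->
    N (Jn n t - Jn n s - sc (t - s) (g xi)) <= e * (t - s)) ->
   hh m < d -> hh n < d -> al <= t <= be -> N (Jn m t - Jn n t) <= 2 * e * (t - al).
  move=> d0 Hd hm hn /andP[at0 tb].
  have := @chain_incr (fun t => Jn m t - Jn n t) (fun t => 2 * e * t) al be d.
  move=> /(_ _ d0 _ al t (lexx _) at0 tb); rewrite !Jn0 subrr subr0 => h.
  have -> : 2 * e * (t - al) = 2 * e * t - 2 * e * al by ring.
  apply: h; first by move=> r _; exact: snB.
  move=> s r sa sr rb rs.
  have h1 := Hd m hm s r s sa (lexx _) sr rb rs.
  have h2 := Hd n hn s r s sa (lexx _) sr rb rs.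
  have hz : H (sc (r - s) (g s)) by apply: (sn_Z sn); apply: hg; rewrite sa (le_trans sr rb).
  have e1 : Jn m r - Jn n r - (Jn m s - Jn n s) =
    (Jn m r - Jn m s - sc (r - s) (g s)) - (Jn n r - Jn n s - sc (r - s) (g s)).
    by apply/funext => y; rewrite !fctE; ring.
  rewrite e1; apply: le_trans (NB _ _) _; [by do 2 apply: snB => //|by do 2 apply: snB => //|].
  apply: le_trans (lerD h1 h2) _; rewrite le_eqVlt; apply/orP; left; apply/eqP; ring.
have /choice[J HJ] t : exists l, al <= t <= be -> H l /\ N (Jn n t - l) @[n --> \oo] --> 0.
  have [tb|] := boolP (al <= t <= be); last by exists 0.
  have [|l hl] := @sn_complete sn (fun n => Jn n t) (fun n => hJn n t).
    move=> e e0; have e1 : 0 < e / (2 * (be - al)) by rewrite divr_gt0// mulr_gt0// subr_gt0.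
    have [d d0 Hd] := Jn_est e1; have [n0 Hn] := hh_small d0.
    exists n0 => m n n0m n0n.
    apply: le_trans (diff m n t _ d d0 Hd (Hn _ n0m) (Hn _ n0n) tb) _.
    have /andP[at0 tb'] := tb.
    have e3 : 0 < be - al by rewrite subr_gt0.
    have -> : 2 * (e / (2 * (be - al))) * (t - al) = e * ((t - al) / (be - al)).
      by field; rewrite gt_eqF.
    apply: ler_piMr; first exact: ltW.
    by rewrite ler_pdivrMr// mul1r lerD2r.
  by exists l.
exists J; split; first by move=> t tb; case: (HJ t tb).
move=> e e0; have [d d0 Hd] := Jn_est e0; have [n0 Hn] := hh_small d0.
exists d => // s t xi sa sx xt tb ts.
have sb : al <= s <= be by rewrite sa (le_trans sx (le_trans xt tb)).
have tb2 : al <= t <= be by rewrite tb (le_trans sa (le_trans sx xt)).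
have xib : al <= xi <= be by rewrite (le_trans sa sx) (le_trans xt tb).
have [hJt cJt] := HJ t tb2; have [hJs cJs] := HJ s sb.
have hz : H (sc (t - s) (g xi)) by apply: (sn_Z sn); exact: hg.
have hz2 n : H (Jn n t - Jn n s - sc (t - s) (g xi)) by do 2 apply: snB => //.
apply: (@N_lim_le (fun n => Jn (n + n0)%N t - Jn (n + n0)%N s - sc (t - s) (g xi))) => //.
- by do 2 apply: snB => //.
- have c2 : N (Jn n t - J t) + N (Jn n s - J s) @[n --> \oo] --> 0.
    by rewrite -[X in _ --> X]addr0; exact: cvgD.
  rewrite -(cvg_shiftn n0) in c2; apply: squeeze_cvgr c2; last exact: cvg_cst.
  apply: nearW => n; rewrite (sn_N0 sn) /=.
  have -> : Jn (n + n0)%N t - Jn (n + n0)%N s - sc (t - s) (g xi) - (J t - J s - sc (t - s) (g xi))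
     = (Jn (n + n0)%N t - J t) - (Jn (n + n0)%N s - J s).
    by apply/funext => y; rewrite !fctE; ring.
  by apply: NB; exact: snB.
- by move=> n; apply: Hd => //; apply: Hn; exact: leq_addl.
Qed.

End Step.
End Abstract.

(** * Antiderivatives and Riemann sums *)

Section RiemannSums.
Context {R : realType}.
Local Notation X := (R -> R[i]).
Implicit Types (u v w : X) (g : R -> X).
Variables (H : X -> Prop) (N : X -> R).
Hypothesis sn : seminormed H N.

Lemma mv_sub J g al be a b : al <= a -> b <= be -> is_antiderivative H N J g al be -> is_antiderivative H N J g a b.
Proof.
move=> aa bb [hJ HJ]; split.
  by move=> t /andP[at0 tb]; apply: hJ; rewrite (le_trans aa at0) (le_trans tb bb).
move=> e e0; have [d d0 Hd] := HJ e e0; exists d => // s t xi sa sx xt tb.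
by apply: Hd => //; [exact: le_trans aa sa|exact: le_trans tb bb].
Qed.

Lemma mvB J g J' g' a b : Hon H g a b -> Hon H g' a b ->
  is_antiderivative H N J g a b -> is_antiderivative H N J' g' a b ->
  is_antiderivative H N (fun t => J t - J' t) (fun t => g t - g' t) a b.
Proof.
move=> hg hg' [hJ HJ] [hJ' HJ']; split; first by move=> t tab; apply: (snB sn); [exact: hJ|exact: hJ'].
move=> e e0; have e2 : 0 < e / 2 by rewrite divr_gt0.
have [d d0 Hd] := HJ _ e2; have [d' d0' Hd'] := HJ' _ e2.
exists (Num.min d d'); first by rewrite lt_min d0.
move=> s t xi sa sx xt tb; rewrite lt_min => /andP[ts ts'].
have h1 := Hd s t xi sa sx xt tb ts; have h2 := Hd' s t xi sa sx xt tb ts'.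
have sab : a <= s <= b by rewrite sa (le_trans sx (le_trans xt tb)).
have tab : a <= t <= b by rewrite tb (le_trans sa (le_trans sx xt)).
have xab : a <= xi <= b by rewrite (le_trans sa sx) (le_trans xt tb).
have -> : J t - J' t - (J s - J' s) - sc (t - s) (g xi - g' xi) =
  (J t - J s - sc (t - s) (g xi)) - (J' t - J' s - sc (t - s) (g' xi)).
  by rewrite scBr; apply/funext => y; rewrite !fctE; ring.
have k1 : H (J t - J s - sc (t - s) (g xi)).
  by apply: (snB sn); [apply: (snB sn); exact: hJ|apply: (sn_Z sn); exact: hg].
have k2 : H (J' t - J' s - sc (t - s) (g' xi)).
  by apply: (snB sn); [apply: (snB sn); exact: hJ'|apply: (sn_Z sn); exact: hg'].
apply: le_trans (NB sn k1 k2) _; apply: le_trans (lerD h1 h2) _.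
by rewrite -mulrDl -splitr.
Qed.

Lemma eps_le (x y c : R) : 0 <= c -> (forall e, 0 < e -> x <= y + e * c) -> x <= y.
Proof.
move=> c0 h; apply/ler_addgt0Pr => e e0.
have c1 : 0 < c + 1 by rewrite ltr_wpDl.
have e1 : 0 < e / (c + 1) by rewrite divr_gt0.
apply: le_trans (h _ e1) _; rewrite lerD2l mulrAC ler_pdivrMr// ler_wpM2l ?(ltW e0)//.
by rewrite lerDl.
Qed.

(** A mean value inequality with a variable majorant. The sampling point in [is_antiderivative] is
    free in [[s, t]], so it may be the point where [psi] lies below the difference quotient of
    [phi]; for an exponential [phi] this is an endpoint. *)
Lemma mv_incr J g al be (phi psi : R -> R) : Hon H g al be -> is_antiderivative H N J g al be ->
  (forall t, al <= t <= be -> N (g t) <= psi t) ->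
  (forall s t, al <= s -> s <= t -> t <= be -> exists xi, s <= xi <= t /\ psi xi * (t - s) <= phi t - phi s) ->
  forall s t, al <= s -> s <= t -> t <= be -> N (J t - J s) <= phi t - phi s.
Proof.
move=> hg [hJ HJ] gpsi conv s t sa st tb.
apply: (@eps_le _ _ (t - s)); first by rewrite subr_ge0.
move=> e e0; have [d d0 Hd] := HJ e e0.
have := @chain_incr R H N sn J (fun t => phi t + e * t) al be d hJ d0 _ s t sa st tb.
have -> : phi t - phi s + e * (t - s) = phi t + e * t - (phi s + e * s) by ring.
apply=> {}s {}t {}sa {}st {}tb ts.
have [xi [/andP[sx xt] pp]] := conv s t sa st tb.
have := Hd s t xi sa sx xt tb ts.
have sab : al <= s <= be by rewrite sa (le_trans st tb).
have tab : al <= t <= be by rewrite tb (le_trans sa st).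
have xab : al <= xi <= be by rewrite (le_trans sa sx) (le_trans xt tb).
have h1 : H (J t - J s) by apply: (snB sn); exact: hJ.
have h2 : H (sc (t - s) (g xi)) by apply: (sn_Z sn); exact: hg.
have := NleB sn h1 h2; rewrite (sn_NZ sn _ (hg _ xab)) ger0_norm ?subr_ge0//.
have ts0 : 0 <= t - s by rewrite subr_ge0.
have := ler_wpM2l ts0 (gpsi xi xab).
move: (N (J t - J s)) (N (J t - J s - _)) (N (g xi)) => A B G h3 h4 h5.
apply: le_trans h4 _; apply: le_trans (lerD h3 h5) _.
move: pp; lra.
Qed.

Lemma tagged_bounds (a b : R) x xi : tagged_partition a b x xi ->
  let p k := nth a (a :: x) k in
  [/\ p 0%N = a, p (size x) = b & forall k, (k < size x)%N ->
    [/\ a <= p k, p k <= xi k, xi k <= p k.+1 & p k.+1 <= b]].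
Proof.
move=> [[px /eqP lx] tag] p.
have p0 : p 0%N = a by [].
have pn : p (size x) = b by rewrite /p -lx -nth_last; case: x {px lx tag p p0}.
have step k : (k < size x)%N -> p k <= p k.+1.
  by move=> kx; have /andP[h1 h2] := tag k kx; exact: le_trans h1 h2.
have mono j k : (j + k <= size x)%N -> p j <= p (j + k)%N.
  elim: k => [|k IH]; first by rewrite addn0.
  rewrite addnS => jk; apply: le_trans (IH (ltnW jk)) _; exact: step.
split => // k kx; have /andP[h1 h2] := tag k kx; split => //.
  by rewrite -{1}p0; apply: (mono 0%N k); rewrite add0n ltnW.
by rewrite -pn; have := mono k.+1 (size x - k.+1)%N; rewrite subnKC//; apply.
Qed.

(** Each term of the sum is an instance of the mean value estimate at its tag, and the errors
    [e (t - s)] add up to [e (b - a)]. *)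
Lemma riemann_mv J g a b : Hon H g a b -> is_antiderivative H N J g a b -> forall e, 0 < e ->
  exists2 d : R, 0 < d & forall x xi, tagged_partition a b x xi -> mesh_lt d a x ->
    H (riemann_sum g a x xi) /\
    N (riemann_sum g a x xi - (J b - J a)) <= e * (b - a).
Proof.
move=> hg [hJ HJ] e e0; have [d d0 Hd] := HJ e e0; exists d => // x xi tp mesh.
pose p k := nth a (a :: x) k.
have [p0 pn pk] : [/\ p 0%N = a, p (size x) = b & forall k, (k < size x)%N ->
    [/\ a <= p k, p k <= xi k, xi k <= p k.+1 & p k.+1 <= b]] := tagged_bounds tp.
have rE : riemann_sum g a x xi = \sum_(k < size x) sc (p k.+1 - p k) (g (xi k)).
  by apply/funext => y; rewrite /riemann_sum fct_sumE.
have JE : J b - J a = \sum_(k < size x) (J (p k.+1) - J (p k)).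
  by rewrite -(big_mkord xpredT (fun k => J (p k.+1) - J (p k))) telescope_sumr// pn p0.
have bE : b - a = \sum_(k < size x) (p k.+1 - p k).
  by rewrite -(big_mkord xpredT (fun k => p k.+1 - p k)) telescope_sumr// pn p0.
have Hk (k : 'I_(size x)) : H (sc (p k.+1 - p k) (g (xi k))).
  have [h1 h2 h3 h4] := pk k (ltn_ord k).
  by apply: (sn_Z sn); apply: hg; rewrite (le_trans h1 h2) (le_trans h3 h4).
split; first by rewrite rE; exact: (Nsum sn _ Hk).1.
have HJk (k : 'I_(size x)) : H (J (p k.+1) - J (p k)).
  have [h1 h2 h3 h4] := pk k (ltn_ord k); have h23 := le_trans h2 h3.
  by apply: (snB sn); apply: hJ; rewrite ?h4 ?h1 ?(le_trans h1 h23) ?(le_trans h23 h4).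
rewrite rE JE -sumrB bE mulr_sumr.
have Hd2 (k : 'I_(size x)) : H (sc (p k.+1 - p k) (g (xi k)) - (J (p k.+1) - J (p k))) by exact: (snB sn).
apply: le_trans (Nsum sn _ Hd2).2 _; apply: ler_sum => k _.
have [h1 h2 h3 h4] := pk k (ltn_ord k).
by rewrite (NC sn)//; apply: Hd => //; exact: mesh.
Qed.

Lemma fine_partition (a b d : R) : a <= b -> 0 < d ->
  exists x xi, tagged_partition a b x xi /\ mesh_lt d a x.
Proof.
rewrite le_eqVlt => /predU1P[->|ab] d0.
  exists [::], (fun=> b); split; first by split => //; split.
  by move=> k; rewrite ltn0.
pose n := Num.trunc ((b - a) / d); pose h := (b - a) / n.+1%:R.
have n0 : 0 < n.+1%:R :> R by [].
have h0 : 0 < h by rewrite divr_gt0// subr_gt0.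
have hd : h < d by rewrite /h ltr_pdivrMr// mulrC -ltr_pdivrMr// truncnS_gt.
pose x := mkseq (fun k => a + k.+1%:R * h) n.+1.
have nx k : (k < n.+1)%N -> nth a x k = a + k.+1%:R * h by move=> kn; rewrite nth_mkseq.
have nax k : (k < n.+2)%N -> nth a (a :: x) k = a + k%:R * h.
  by case: k => [|k] kn; rewrite /= ?mul0r ?addr0// nx.
have stp k : (k < n.+1)%N -> nth a x k - nth a (a :: x) k = h.
  move=> kn; rewrite nx// nax; last exact: ltnW.
  rewrite -natr1; ring.
exists x, (fun k => nth a (a :: x) k); split; last first.
  by move=> k; rewrite size_mkseq => kn; rewrite stp.
split; last first.
  move=> k; rewrite size_mkseq => kn; rewrite lexx /=.
  by rewrite -subr_ge0 stp// ltW.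
split; first by apply/(pathP a) => k; rewrite size_mkseq => kn; rewrite -subr_gt0 stp.
rewrite -nth_last size_mkseq nx//.
have -> : n.+1%:R * h = b - a by rewrite /h mulrC divfK// gt_eqF.
by rewrite addrC subrK.
Qed.

(** The body of [is_H1_RInt] for an abstract seminorm; at [H1] and [H1norm] the two agree by
    conversion. *)
Definition RInt g a b I := [/\ forall tau, a <= tau <= b -> H (g tau), H I &
  forall e, 0 < e -> exists2 d : R, 0 < d & forall x xi, tagged_partition a b x xi ->
    mesh_lt d a x -> N (riemann_sum g a x xi - I) < e].

Lemma mv_RInt J g a b : a <= b -> Hon H g a b -> is_antiderivative H N J g a b -> RInt g a b (J b - J a).
Proof.
move=> ab hg hJ; split => //.
  by apply: (snB sn); apply: hJ.1; rewrite ?lexx ?ab.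
move=> e e0; have b1 : 0 < b - a + 1 by rewrite ltr_wpDl// subr_ge0.
have e1 : 0 < e / (b - a + 1) by rewrite divr_gt0.
have [d d0 Hd] := riemann_mv hg hJ e1; exists d => // x xi tp mesh.
apply: le_lt_trans (Hd x xi tp mesh).2 _.
by rewrite mulrAC ltr_pdivrMr// ltr_pM2l// ltrDl.
Qed.

(** Both values are compared with one Riemann sum of small mesh, which [fine_partition] supplies. *)
Lemma mv_RInt_unique J g a b I : a <= b -> is_antiderivative H N J g a b -> RInt g a b I ->
  N (I - (J b - J a)) = 0.
Proof.
move=> ab hJ [hg hI HI].
have [_ hJJ HJJ] := mv_RInt ab hg hJ.
apply/eqP; rewrite eq_le (sn_N0 sn) andbT; apply/ler_addgt0Pr => e e0.
have e2 : 0 < e / 2 by rewrite divr_gt0.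
have [d d0 Hd] := HI _ e2; have [d' d0' Hd'] := HJJ _ e2.
have [d1 d10 Hd1] := riemann_mv hg hJ ltr01.
have m0 : 0 < Num.min d (Num.min d' d1) by rewrite !lt_min d0 d0'.
have [x [xi [tp mesh]]] := fine_partition ab m0.
have ml q : Num.min d (Num.min d' d1) <= q -> mesh_lt q a x.
  by move=> le k kx; exact: lt_le_trans (mesh k kx) le.
have m1 : Num.min d (Num.min d' d1) <= d by rewrite ge_min lexx.
have m2 : Num.min d (Num.min d' d1) <= d' by rewrite !ge_min lexx orbT.
have m3 : Num.min d (Num.min d' d1) <= d1 by rewrite !ge_min lexx !orbT.
have h1 := Hd x xi tp (ml d m1); have h2 := Hd' x xi tp (ml d' m2).
have hr := (Hd1 x xi tp (ml d1 m3)).1.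
rewrite add0r; apply: le_trans (NtriB sn hI hr hJJ) _.
rewrite (NC sn hI hr) [e]splitr; apply: lerD; exact/ltW.
Qed.

End RiemannSums.

(** * Picard iteration *)

Section Picard.
Context {R : realType}.
Local Notation X := (R -> R[i]).
Implicit Types (u w : X) (v g : R -> X).
Variables (H : X -> Prop) (N : X -> R).
Hypothesis sn : seminormed H N.

(* [S] is bounded with a constant [C]: [C = 1] would require Plancherel. *)
Record propagator (S : R -> X -> X) (C : R) : Prop := {
  pr_C : 1 <= C;
  pr_H : forall t u, H u -> H (S t u);
  pr_lip : forall t u w, H u -> H w -> N (S t u - S t w) <= C * N (u - w);
  pr_bnd : forall t u, H u -> N (S t u) <= C * N u;
  pr_cont : forall t u, H u -> forall e, 0 < e -> exists2 d : R, 0 < d &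
    forall s, `|s - t| < d -> N (S s u - S t u) < e }.

Record loclip (F : X -> X) : Prop := {
  ll_H : forall u, H u -> H (F u);
  ll_lip : forall M : R, exists L : R, 0 < L /\ forall u w, H u -> H w -> N u <= M -> N w <= M ->
    N (F u - F w) <= L * N (u - w) }.

(** Stands for multiplication by [i] in front of the Duhamel integral. *)
Record isom (Ji : X -> X) : Prop := {
  is_H : forall u, H u -> H (Ji u);
  is_B : forall u w, Ji (u - w) = Ji u - Ji w;
  is_N : forall u, H u -> N (Ji u) = N u }.

Variables (S : R -> X -> X) (C : R) (F : X -> X) (Ji : X -> X).
Hypotheses (HS : propagator S C) (HF : loclip F) (HJi : isom Ji).

Let C0 : 0 < C. Proof. exact: lt_le_trans ltr01 (pr_C HS). Qed.

Definition duh v t tau := S (t - tau) (F (v tau)).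

Definition good v T := Hon H v (- T) T /\ contOn N v (- T) T.

(** A relation rather than a map, because [J] is obtained by existence. It depends on [t], as the
    integrand does, and covers all of [[-T, T]] so that both signs of [t] are treated alike. *)
Definition PicStep w T v v1 := forall t, - T <= t <= T -> exists J,
  is_antiderivative H N J (duh v t) (- T) T /\ v1 t = S t w + Ji (J t - J 0).

Lemma F_cont v T : good v T -> contOn N (fun t => F (v t)) (- T) T.
Proof.
move=> [hv cv] t tT e e0.
have [L [L0 HL]] := ll_lip HF (N (v t) + 1).
have [d1 d10 H1] := cv t tT 1 ltr01.
have eL : 0 < e / L by rewrite divr_gt0.
have [d2 d20 H2] := cv t tT _ eL.
exists (Num.min d1 d2); first by rewrite lt_min d10.
move=> s sT; rewrite lt_min => /andP[sd1 sd2].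
have k1 := H1 s sT sd1; have k2 := H2 s sT sd2.
have hs := hv s sT; have ht := hv t tT.
apply: le_lt_trans (HL _ _ hs ht _ _) _.
- by apply: le_trans (NleB sn hs ht) _; rewrite lerD2l ltW.
- by rewrite lerDl.
by rewrite mulrC -ltr_pdivlMr.
Qed.

Lemma duh_good v T t : good v T -> Hon H (duh v t) (- T) T /\ contOn N (duh v t) (- T) T.
Proof.
move=> gv; have [hv cv] := gv; split.
  by move=> tau tT; apply: (pr_H HS); apply: (ll_H HF); exact: hv.
move=> tau tT e e0.
have hF s : - T <= s <= T -> H (F (v s)) by move=> sT; apply: (ll_H HF); exact: hv.
have e2 : 0 < e / 2 by rewrite divr_gt0.
have eC : 0 < e / 2 / C by rewrite divr_gt0.
have [d1 d10 H1] := F_cont gv tT eC.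
have [d2 d20 H2] := pr_cont HS (t - tau) (hF _ tT) e2.
exists (Num.min d1 d2); first by rewrite lt_min d10.
move=> s sT; rewrite lt_min => /andP[sd1 sd2].
have k1 := H1 s sT sd1.
have k2 : N (S (t - s) (F (v tau)) - S (t - tau) (F (v tau))) < e / 2.
  by apply: H2; rewrite opprB addrC addrA subrK distrC.
rewrite /duh.
have h1 := pr_H HS (t - s) (hF _ sT); have h2 := pr_H HS (t - s) (hF _ tT).
have h3 := pr_H HS (t - tau) (hF _ tT).
apply: le_lt_trans (NtriB sn h1 h2 h3) _.
rewrite [e]splitr; apply: ler_ltD k2.
apply: le_trans (pr_lip HS _ (hF _ sT) (hF _ tT)) _.
by rewrite mulrC -ler_pdivlMr// ltW.
Qed.

Lemma step_exists w T v : 0 < T -> good v T -> exists v1, PicStep w T v v1.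
Proof.
move=> T0 gv; have TT : - T < T by lra.
have /choice[J HJ] t : exists J, is_antiderivative H N J (duh v t) (- T) T.
  have [h c] := duh_good t gv; exact: (antiderivative_exists sn TT h c).
exists (fun t => S t w + Ji (J t t - J t 0)) => t tT; exists (J t); split => //.
Qed.

Lemma Ji_incr J J' s t T : Hon H J (- T) T -> Hon H J' (- T) T -> - T <= s <= T -> - T <= t <= T ->
  N (Ji (J t - J s) - Ji (J' t - J' s)) = N (J t - J' t - (J s - J' s)).
Proof.
move=> hJ hJ' sT tT; rewrite -(is_B HJi) (is_N HJi).
  by congr N; apply/funext => y; rewrite !fctE; ring.
by apply: (snB sn); apply: (snB sn); [exact: hJ|exact: hJ|exact: hJ'|exact: hJ'].
Qed.

(* Increments of the integral of [e^{lam |tau|}] between 0 and [t]: convexity of exp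
   bounds the integrand by the slope taken at the endpoint nearest to 0. *)
Lemma weighted_incr J g (T lam b : R) : 0 < lam -> 0 <= b -> Hon H g (- T) T -> is_antiderivative H N J g (- T) T ->
  (forall tau, - T <= tau <= T -> N (g tau) <= b * expR (lam * `|tau|)) ->
  forall t, - T <= t <= T -> N (J t - J 0) <= b * (expR (lam * `|t|) - 1) / lam.
Proof.
move=> lam0 b0 hg hJ bg t tT; have /andP[t1 t2] := tT.
have slope x y : x <= y -> expR (lam * x) * (y - x) <= (expR (lam * y) - expR (lam * x)) / lam.
  move=> xy; rewrite ler_pdivlMr//.
  have := expR_ge1Dx (lam * (y - x)).
  have -> : expR (lam * y) = expR (lam * x) * expR (lam * (y - x)) by rewrite -expRD; congr expR; ring.
  by have := expR_gt0 (lam * x); nra.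
have [t0|t0] := leP 0 t.
  have T0 : - T <= 0 by lra.
  have hg0 : Hon H g 0 T by move=> s /andP[s0 sT]; apply: hg; rewrite sT andbT (le_trans T0 s0).
  have := mv_incr sn (phi := fun s => b * expR (lam * s) / lam) (psi := fun s => b * expR (lam * s))
    hg0 (mv_sub T0 (lexx _) hJ) _ _ (lexx 0) t0 t2.
  rewrite mulr0 expR0 ger0_norm// => h.
  have -> : b * (expR (lam * t) - 1) / lam = b * expR (lam * t) / lam - b * 1 / lam by ring.
  apply: h.
    move=> s /andP[s0 sT]; apply: le_trans (bg _ _) _; first by rewrite sT andbT (le_trans T0 s0).
    by rewrite ger0_norm.
  move=> s r s0 sr rT; exists s; split; first by rewrite lexx.
  have := ler_wpM2l b0 (slope s r sr).
  by rewrite -mulrBl -mulrBr !mulrA.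
have hT : Hon H g (- T) 0 by move=> s /andP[s0 sT]; apply: hg; rewrite s0 (le_trans sT)//; lra.
have T0 : 0 <= T by lra.
have := mv_incr sn (phi := fun s => - (b * expR (lam * - s) / lam)) (psi := fun s => b * expR (lam * - s))
    hT (mv_sub (lexx _) T0 hJ) _ _ t1 (ltW t0) (lexx 0).
rewrite oppr0 mulr0 expR0 ltr0_norm// => h.
have j0 : H (J t) by apply: hJ.1.
have j1 : H (J 0) by apply: hJ.1; rewrite T0 andbT; lra.
rewrite (NC sn j0 j1).
have -> : b * (expR (lam * - t) - 1) / lam = - (b * 1 / lam) - - (b * expR (lam * - t) / lam) by ring.
apply: h.
  move=> s /andP[sT s0]; apply: le_trans (bg _ _) _; first by rewrite sT (le_trans s0).
  by rewrite ler0_norm.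
move=> s r sT sr r0; exists r; split; first by rewrite lexx andbT.
have rs : - r <= - s by lra.
have := ler_wpM2l b0 (slope (- r) (- s) rs).
have -> : - s - - r = r - s by ring.
have -> : - (b * expR (lam * - r) / lam) - - (b * expR (lam * - s) / lam) =
  b * ((expR (lam * - s) - expR (lam * - r)) / lam) by ring.
by move=> h2; rewrite -mulrA; exact: h2.
Qed.

(** With [lam = 2 * C * L] the integral of the weight contributes the factor [C L / lam = 1 / 2]:
    the Duhamel map halves the weighted distance, whatever the length of the interval. *)
Lemma step_diff (w w' : X) (T M L b : R) v v' v1 v1' : 0 < T -> 0 < L ->
  (forall u w, H u -> H w -> N u <= M -> N w <= M -> N (F u - F w) <= L * N (u - w)) ->
  H w -> H w' -> good v T -> good v' T ->
  (forall t, - T <= t <= T -> N (v t) <= M) -> (forall t, - T <= t <= T -> N (v' t) <= M) ->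
  PicStep w T v v1 -> PicStep w' T v' v1' -> 0 <= b ->
  (forall t, - T <= t <= T -> N (v t - v' t) <= b * expR (2 * C * L * `|t|)) ->
  forall t, - T <= t <= T -> [/\ H (v1 t), H (v1' t) &
    N (v1 t - v1' t) <= (C * N (w - w') + b / 2) * expR (2 * C * L * `|t|)].
Proof.
move=> T0 L0 HL hw hw' gv gv' vM vM' st st' b0 vb t tT.
have [J [hJ ->]] := st t tT; have [J' [hJ' ->]] := st' t tT.
have z0 : - T <= 0 <= T by apply/andP; split; lra.
have lam0 : 0 < 2 * C * L by rewrite !mulr_gt0.
have [hd cd] := duh_good t gv; have [hd' cd'] := duh_good t gv'.
have hjj := mvB sn hd hd' hJ hJ'.
have hj1 : H (Ji (J t - J 0)) by apply: (is_H HJi); apply: (snB sn); exact: hJ.1.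
have hj1' : H (Ji (J' t - J' 0)) by apply: (is_H HJi); apply: (snB sn); exact: hJ'.1.
have hs := pr_H HS t hw; have hs' := pr_H HS t hw'.
split; [exact: (sn_D sn)|exact: (sn_D sn)|].
have hdd : Hon H (fun tau => duh v t tau - duh v' t tau) (- T) T.
  by move=> tau tauT; apply: (snB sn); [exact: hd|exact: hd'].
have b1 : 0 <= C * L * b by rewrite !mulr_ge0// ltW.
have W := weighted_incr lam0 b1 hdd hjj _ tT.
have -> : S t w + Ji (J t - J 0) - (S t w' + Ji (J' t - J' 0)) =
  (S t w - S t w') + (Ji (J t - J 0) - Ji (J' t - J' 0)).
  by apply/funext => y; rewrite !fctE; ring.
apply: le_trans (sn_tri sn (snB sn hs hs') (snB sn hj1 hj1')) _.
rewrite (Ji_incr hJ.1 hJ'.1 z0 tT) mulrDl; apply: lerD.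
  apply: le_trans (pr_lip HS _ hw hw') _.
  rewrite ler_peMr//; last by rewrite -[leLHS]expR0 ler_expR mulr_ge0// ltW.
  by rewrite mulr_ge0 ?(ltW C0)// (sn_N0 sn).
apply: le_trans (W _) _; last first.
  have -> : C * L * b * (expR (2 * C * L * `|t|) - 1) / (2 * C * L) = b / 2 * (expR (2 * C * L * `|t|) - 1).
    by field; rewrite !gt_eqF.
  apply: ler_wpM2l; first by rewrite divr_ge0.
  by rewrite gerBl.
move=> tau tauT.
have hf : H (F (v tau)) by apply: (ll_H HF); exact: gv.1.
have hf' : H (F (v' tau)) by apply: (ll_H HF); exact: gv'.1.
apply: le_trans (pr_lip HS _ hf hf') _.
have -> : C * L * b * expR (2 * C * L * `|tau|) = C * (L * (b * expR (2 * C * L * `|tau|))) by rewrite !mulrA.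
apply: ler_wpM2l; first exact: ltW.
apply: le_trans (HL _ _ (gv.1 _ tauT) (gv'.1 _ tauT) (vM _ tauT) (vM' _ tauT)) _.
by apply: ler_wpM2l; [exact: ltW|exact: vb].
Qed.

End Picard.

(** * A priori estimates and dependence on the data *)

Section Solve.
Context {R : realType}.
Local Notation X := (R -> R[i]).
Implicit Types (u w : X) (v g : R -> X).
Variables (H : X -> Prop) (N : X -> R).
Hypothesis sn : seminormed H N.
Variables (S : R -> X -> X) (C : R) (F : X -> X) (Ji : X -> X).
Hypotheses (HS : propagator H N S C) (HF : loclip H N F) (HJi : isom H N Ji).

Let C0 : 0 < C. Proof. exact: lt_le_trans ltr01 (pr_C HS). Qed.

Lemma contOn_bounded g al be : Hon H g al be -> contOn N g al be ->
  exists M, forall t, al <= t <= be -> N (g t) <= M.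
Proof.
move=> hg cg.
(* The bound [r^-1] relaxes as the radius [r] shrinks, so a common radius turns into a common
   bound. *)
have [|d d0 Hd] := @near_cover R al be (fun r t => N (g t) <= r^-1).
  move=> x xab; have [d d0 Hd] := cg x xab 1 ltr01.
  have n1 : 0 < N (g x) + 1 by rewrite ltr_wpDl// (sn_N0 sn).
  exists (Num.min d (N (g x) + 1)^-1); first by rewrite lt_min d0 invr_gt0.
  move=> y r yab; rewrite !lt_min => /andP[yd _] r0 /andP[_ rn].
  have h := Hd y yab yd.
  apply: le_trans (_ : N (g x) + 1 <= _).
    by apply: le_trans (NleB sn (hg y yab) (hg x xab)) _; rewrite lerD2l ltW.
  by rewrite -[leLHS]invrK lef_pV2 ?posrE ?invr_gt0// ltW.
exists (d / 2)^-1 => t tab; apply: Hd => //; first by rewrite divr_gt0.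
by rewrite ltr_pdivrMr// ltr_pMr// ltr1n.
Qed.

Lemma step_incr v T t (J : R -> X) B : 0 < T -> good H N v T -> is_antiderivative H N J (duh S F v t) (- T) T ->
  (forall tau, - T <= tau <= T -> N (F (v tau)) <= B) -> 0 <= B ->
  forall s r, - T <= s <= T -> - T <= r <= T -> N (J r - J s) <= C * B * `|r - s|.
Proof.
move=> T0 gv hJ FB B0 s r.
have [hd cd] := duh_good sn HS HF t gv.
wlog sr : s r / s <= r => [h sT rT|].
  have [sr|rs] := leP s r; first exact: h.
  by rewrite (NC sn (hJ.1 r rT) (hJ.1 s sT)) distrC; apply: h => //; exact: ltW.
move=> /andP[s1 s2] /andP[r1 r2]; rewrite ger0_norm ?subr_ge0// mulrBr.
apply: (mv_incr sn (phi := fun t => C * B * t) (psi := fun=> C * B) hd hJ) => //.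
  move=> tau tauT; apply: le_trans (pr_bnd HS _ _) _; first by apply: (ll_H HF); exact: gv.1.
  by apply: ler_wpM2l; [exact: ltW|exact: FB].
by move=> x y _ xy _; exists x; rewrite lexx xy -mulrBr.
Qed.

Lemma F_ball M : exists B, 0 <= B /\ forall u, H u -> N u <= M -> N (F u) <= B.
Proof.
have [L [L0 HL]] := ll_lip HF `|M|; exists (N (F 0) + L * `|M|).
have h0 := sn_0 sn.
split; first by rewrite addr_ge0 ?(sn_N0 sn)// mulr_ge0// ltW.
move=> u hu uM.
apply: le_trans (NleB sn (ll_H HF hu) (ll_H HF h0)) _; rewrite lerD2l.
have uM' := le_trans uM (ler_norm M).
apply: le_trans (HL _ _ hu h0 uM' _) _; first by rewrite (N00 sn).
by rewrite subr0; apply: ler_wpM2l; [exact: ltW|].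
Qed.

(** The increment of [v1] from [t] to [s] has three parts: that of the free evolution, the effect of
    changing the time parameter of the integrand from [t] to [s], and the integral of the old
    integrand between [s] and [t]. *)
Lemma step_good w T v v1 : 0 < T -> H w -> good H N v T -> PicStep H N S F Ji w T v v1 ->
  good H N v1 T.
Proof.
move=> T0 hw gv st.
have zT : - T <= 0 <= T by apply/andP; split; lra.
have h1 : Hon H v1 (- T) T.
  move=> t tT; have [J [hJ ->]] := st t tT.
  apply: (sn_D sn); first exact: (pr_H HS).
  by apply: (is_H HJi); apply: (snB sn); exact: hJ.1.
split=> // t tT e e0.
have [M HM] := contOn_bounded gv.1 gv.2.
have [B [B0 HB]] := F_ball M.
have FB tau : - T <= tau <= T -> N (F (v tau)) <= B by move=> h; apply: HB; [exact: gv.1|exact: HM].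
have hF tau : - T <= tau <= T -> H (F (v tau)) by move=> h; apply: (ll_H HF); exact: gv.1.
(* Each of the three parts will be at most [e / 4]. Below, [e2 = e1 / T] bounds the change of the
   integrand, which is integrated over a length of at most [T]. *)
pose e1 := e / 4.
have e10 : 0 < e1 by rewrite divr_gt0.
have [da da0 Ha] := pr_cont HS t hw e10.
pose e2 := e1 / T.
have e20 : 0 < e2 by rewrite divr_gt0.
(* Strong continuity of [S] is only available at one vector. Near [x] the vector [F (v y)] is
   replaced by [F (v x)] at both times, and both times are compared with [t - x]: four errors of
   [e2 / 4]. Compactness then makes the choice uniform in [tau]. *)
have [db db0 Hb] : exists2 d : R, 0 < d & forall s tau, `|s - t| < d -> - T <= tau <= T ->
    N (S (s - tau) (F (v tau)) - S (t - tau) (F (v tau))) <= e2.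
  have [|d d0 Hd] := @near_cover R (- T) T (fun r tau => forall s, `|s - t| < r ->
    N (S (s - tau) (F (v tau)) - S (t - tau) (F (v tau))) <= e2).
    move=> x xT.
    have e40 : 0 < e2 / 4 by rewrite divr_gt0.
    have eC : 0 < e2 / 4 / C by rewrite divr_gt0.
    have [d1 d10 H1] := F_cont sn HF gv xT eC.
    have [d2 d20 H2] := pr_cont HS (t - x) (hF x xT) e40.
    exists (Num.min d1 (d2 / 2)); first by rewrite lt_min d10 divr_gt0.
    move=> y r yT; rewrite !lt_min => /andP[y1 y2] r0 /andP[r1 r2] s st'.
    have k1 := H1 y yT y1.
    have near1 q : `|q - t| < d2 / 2 -> N (S (q - y) (F (v x)) - S (t - x) (F (v x))) < e2 / 4.
      move=> qt; apply: H2.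
      have -> : q - y - (t - x) = (q - t) - (y - x) by ring.
      by apply: le_lt_trans (ler_normB _ _) _; rewrite [d2]splitr ltrD.
    have k2 := near1 s (lt_trans st' r2).
    have k3 : N (S (t - y) (F (v x)) - S (t - x) (F (v x))) < e2 / 4.
      by apply: near1; rewrite subrr normr0 divr_gt0.
    have close q : N (S (q - y) (F (v y)) - S (q - y) (F (v x))) <= e2 / 4.
      apply: le_trans (pr_lip HS _ (hF y yT) (hF x xT)) _.
      by rewrite mulrC -ler_pdivlMr// ltW.
    have hh q z : - T <= z <= T -> H (S q (F (v z))) by move=> zT'; apply: (pr_H HS); exact: hF.
    have t1 := NtriB sn (hh (s - y) y yT) (hh (s - y) x xT) (hh (t - y) y yT).
    have t2 := NtriB sn (hh (s - y) x xT) (hh (t - x) x xT) (hh (t - y) y yT).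
    have t3 := NtriB sn (hh (t - x) x xT) (hh (t - y) x xT) (hh (t - y) y yT).
    have c1 := close s; have := close t.
    rewrite (NC sn (hh (t - y) y yT) (hh (t - y) x xT)) => c2.
    rewrite (NC sn (hh (t - y) x xT) (hh (t - x) x xT)) in k3.
    move: t1 t2 t3 c1 c2 k2 k3.
    move: (N _) (N _) (N _) (N _) (N _) (N _) (N _) => n1 n2 n3 n4 n5 n6 n7; lra.
  exists (d / 2); first by rewrite divr_gt0.
  by move=> s tau sd tauT; apply: (Hd (d / 2) tau) => //; lra.
have CB1 : 0 < C * B + 1 by rewrite ltr_wpDl// mulr_ge0// ltW.
have dc0 : 0 < e1 / (C * B + 1) by rewrite divr_gt0.
exists (Num.min da (Num.min db (e1 / (C * B + 1)))); first by rewrite !lt_min da0 db0.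
move=> s sT; rewrite !lt_min => /and3P[sa sb sc'].
have hs := h1 s sT; have ht := h1 t tT.
have [J [hJ Et]] := st t tT; have [J' [hJ' Es]] := st s sT.
have [hd cd] := duh_good sn HS HF t gv; have [hd' cd'] := duh_good sn HS HF s gv.
have hjj := mvB sn hd' hd hJ' hJ.
have hJa := hJ.1 t tT; have hJb := hJ.1 s sT; have hJc := hJ'.1 s sT; have hJ0 := hJ.1 0 zT; have hJ0' := hJ'.1 0 zT.
have I1 : N (J t - J s) <= e1.
  have := step_incr T0 gv hJ FB B0 sT tT.
  rewrite distrC => h; apply: le_trans h _.
  apply: le_trans (_ : (C * B + 1) * `|s - t| <= _).
    by apply: ler_wpM2r => //; rewrite lerDl.
  by rewrite mulrC -ler_pdivlMr// ltW.
have I2 : N (J' s - J s - (J' 0 - J 0)) <= e1.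
  have b0 : 0 <= e2 by rewrite ltW.
  have bnd tau : - T <= tau <= T -> N (duh S F v s tau - duh S F v t tau) <= e2.
    by move=> tauT; exact: Hb.
  have hdd : Hon H (fun tau => duh S F v s tau - duh S F v t tau) (- T) T.
    by move=> tau tauT; apply: (snB sn); [exact: hd'|exact: hd].
  have lin x y : - T <= x -> x <= y -> y <= T ->
     N (J' y - J y - (J' x - J x)) <= e2 * y - e2 * x.
    apply: (mv_incr sn (phi := fun t => e2 * t) (psi := fun=> e2) hdd hjj) => //.
    by move=> p q _ pq _; exists p; rewrite lexx pq -mulrBr.
  have eT : e2 * T = e1 by rewrite /e2 divfK// gt_eqF.
  have /andP[s1 s2] := sT; have /andP[z1 z2] := zT.
  have [s0|s0] := leP 0 s.
    apply: le_trans (lin 0 s z1 s0 s2) _; rewrite mulr0 subr0 -eT; exact: ler_wpM2l.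
  have hx : H (J' s - J s) by apply: (snB sn).
  have hy : H (J' 0 - J 0) by apply: (snB sn).
  rewrite (NC sn hx hy); apply: le_trans (lin s 0 s1 (ltW s0) z2) _.
  rewrite mulr0 sub0r -mulrN -eT; apply: ler_wpM2l => //; lra.
have I0 := Ha s sa.
rewrite Et Es.
have -> : S s w + Ji (J' s - J' 0) - (S t w + Ji (J t - J 0)) =
  (S s w - S t w) + Ji ((J' s - J s - (J' 0 - J 0)) - (J t - J s)).
  have -> : (J' s - J s - (J' 0 - J 0)) - (J t - J s) = (J' s - J' 0) - (J t - J 0).
    by apply/funext => y; rewrite !fctE; ring.
  rewrite (is_B HJi (J' s - J' 0) (J t - J 0)); move: (S s w) (Ji _) (S t w) (Ji _) => f1 f2 f3 f4.
  by apply/funext => y; rewrite !fctE; ring.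
have q1 : H (J' s - J s - (J' 0 - J 0)) by do 2 apply: (snB sn) => //; apply: (snB sn).
have q2 : H (J t - J s) by apply: (snB sn).
have q3 := snB sn q1 q2.
have q4 := snB sn (pr_H HS s hw) (pr_H HS t hw).
have q5 := sn_tri sn q4 (is_H HJi q3).
rewrite (is_N HJi q3) in q5.
have q6 := NB sn q1 q2.
apply: le_lt_trans q5 _.
have : N (S s w - S t w) + (e1 + e1) < e.
  by apply: lt_le_trans (_ : e1 + (e1 + e1) <= _); [rewrite ltrD2r|rewrite /e1; lra].
apply: le_lt_trans; rewrite lerD2l; apply: le_trans q6 _; exact: lerD.
Qed.

Lemma step_ball w T v v1 m B M : 0 < T -> H w -> good H N v T -> N w <= m ->
  (forall u, H u -> N u <= M -> N (F u) <= B) -> 0 <= B -> C * m + C * B * T <= M ->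
  (forall t, - T <= t <= T -> N (v t) <= M) ->
  PicStep H N S F Ji w T v v1 -> forall t, - T <= t <= T -> N (v1 t) <= M.
Proof.
move=> T0 hw gv wm HB B0 CM vM st t tT.
have zT : - T <= 0 <= T by apply/andP; split; lra.
have [J [hJ ->]] := st t tT.
have hj : H (J t - J 0) by apply: (snB sn); exact: hJ.1.
apply: le_trans (sn_tri sn (pr_H HS t hw) (is_H HJi hj)) _.
rewrite (is_N HJi hj); apply: le_trans CM; apply: lerD.
  apply: le_trans (pr_bnd HS _ hw) _; apply: ler_wpM2l => //; exact: ltW.
have FB tau : - T <= tau <= T -> N (F (v tau)) <= B by move=> h; apply: HB; [exact: gv.1|exact: vM].
apply: le_trans (step_incr T0 gv hJ FB B0 zT tT) _.
apply: ler_wpM2l; first by rewrite mulr_ge0// ltW.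
by rewrite subr0 ler_norml.
Qed.

(** The equation is required up to seminorm zero, which is the abstract form of equality almost
    everywhere. *)
Definition sol w T v := good H N v T /\ forall t, - T <= t <= T -> exists J,
  is_antiderivative H N J (duh S F v t) (- T) T /\ N (v t - (S t w + Ji (J t - J 0))) = 0.

(** Provides an exact Picard step at seminorm distance 0 from the solution, to which [step_diff]
    applies. *)
Lemma sol_step w T v : H w -> 0 < T -> sol w T v -> exists v1, PicStep H N S F Ji w T v v1 /\
  forall t, - T <= t <= T -> N (v t - v1 t) = 0.
Proof.
move=> hw T0 [gv sv].
have /choice[J HJ] t : exists J, - T <= t <= T ->
   is_antiderivative H N J (duh S F v t) (- T) T /\ N (v t - (S t w + Ji (J t - J 0))) = 0.
  have [tT|] := boolP (- T <= t <= T); last by exists (fun=> 0).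
  by have [J hJ] := sv t tT; exists J.
exists (fun t => S t w + Ji (J t t - J t 0)); split.
  by move=> t tT; exists (J t); split => //; case: (HJ t tT).
by move=> t tT; case: (HJ t tT).
Qed.

Lemma geometric0 (a : R) : a * 2^-1 ^+ n @[n --> \oo] --> 0.
Proof.
rewrite -[X in _ --> X](mulr0 a); apply: cvgM; first exact: cvg_cst.
by apply: cvg_expr; rewrite ger0_norm ?invf_lt1 ?ltr1n// invr_ge0.
Qed.

Lemma geometric_lt (a e : R) : 0 < e -> exists n : nat, a * 2^-1 ^+ n < e.
Proof.
move=> e0; have /cvgr0Pnorm_lt/(_ e e0) := geometric0 a.
by case=> n _ /(_ n (leqnn n)) /= h; exists n; apply: le_lt_trans h; exact: ler_norm.
Qed.

Lemma geometric_le (x y a : R) : (forall n : nat, x <= y + a * 2^-1 ^+ n) -> x <= y.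
Proof.
move=> h; apply/ler_addgt0Pr => e e0; have [n hn] := geometric_lt a e0.
by apply: le_trans (h n) _; rewrite lerD2l ltW.
Qed.

(** A Gronwall estimate by iteration: starting from the crude bound [2 M], each use of [step_diff]
    turns a weighted bound [b] into [d + b / 2]. The fixed point is [2 d], and the excess [2 M] is
    halved each time. *)
Lemma sol_dependence M : exists L, 0 < L /\ forall (w w' : X) T v v', 0 < T -> H w -> H w' ->
  sol w T v -> sol w' T v' ->
  (forall t, - T <= t <= T -> N (v t) <= M) -> (forall t, - T <= t <= T -> N (v' t) <= M) ->
  forall t, - T <= t <= T -> N (v t - v' t) <= 2 * C * N (w - w') * expR (L * T).
Proof.
have [L [L0 HL]] := ll_lip HF M.
have lam0 : 0 < 2 * C * L by rewrite !mulr_gt0.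
exists (2 * C * L); split => // w w' T v v' T0 hw hw' sv sv' vM vM'.
have zT : - T <= 0 <= T by apply/andP; split; lra.
have M0 : 0 <= M by apply: le_trans (vM 0 zT); exact: (sn_N0 sn).
have [v1 [st e1]] := sol_step hw T0 sv; have [v1' [st' e1']] := sol_step hw' T0 sv'.
pose d := C * N (w - w').
have d0 : 0 <= d by rewrite mulr_ge0 ?(ltW C0)// (sn_N0 sn).
have bn n : 0 <= 2 * d + 2 * M * 2^-1 ^+ n.
  have q0 : 0 <= (2^-1 : R) ^+ n by rewrite exprn_ge0// invr_ge0.
  by move: (2^-1 ^+ n) q0 => q q0; move: d d0 => d d0; nra.
have key n : forall t, - T <= t <= T ->
    N (v t - v' t) <= (2 * d + 2 * M * 2^-1 ^+ n) * expR (2 * C * L * `|t|).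
  elim: n => [|n IH] t tT.
    apply: le_trans (NB sn (sv.1.1 t tT) (sv'.1.1 t tT)) _.
    apply: le_trans (lerD (vM t tT) (vM' t tT)) _.
    have ex : 1 <= expR (2 * C * L * `|t|) by rewrite -[leLHS]expR0 ler_expR mulr_ge0// ltW.
    rewrite expr0 mulr1; apply: le_trans (_ : 2 * d + 2 * M <= _); first by lra.
    by rewrite ler_peMr// addr_ge0// mulr_ge0.
  have b0 := bn n.
  have [h1 h1' h] := step_diff sn HS HF HJi T0 L0 HL hw hw' sv.1 sv'.1 vM vM' st st' b0 IH tT.
  have hv := sv.1.1 t tT; have hv' := sv'.1.1 t tT.
  have q1 := NtriB sn hv h1 hv'; rewrite (e1 t tT) add0r in q1.
  have q2 := NtriB sn h1 h1' hv'; rewrite (NC sn h1' hv') (e1' t tT) addr0 in q2.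
  apply: le_trans q1 (le_trans q2 (le_trans h _)).
  have -> // : C * N (w - w') + (2 * d + 2 * M * 2^-1 ^+ n) / 2 = 2 * d + 2 * M * 2^-1 ^+ n.+1.
  by rewrite /d exprS; field.
move=> t tT.
apply: (geometric_le (a := 2 * M * expR (2 * C * L * T))) => n.
have -> : 2 * C * N (w - w') * expR (2 * C * L * T) + 2 * M * expR (2 * C * L * T) * 2^-1 ^+ n =
  (2 * d + 2 * M * 2^-1 ^+ n) * expR (2 * C * L * T) by rewrite /d; ring.
apply: le_trans (key n t tT) _; apply: ler_wpM2l.
  exact: bn.
by rewrite ler_expR; apply: ler_wpM2l; rewrite ?(ltW lam0)// ler_norml.
Qed.

End Solve.

(** * Existence on a time interval determined by the size of the data *)

Section Existence.
Context {R : realType}.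
Local Notation X := (R -> R[i]).
Implicit Types (u w : X) (v g : R -> X).
Variables (H : X -> Prop) (N : X -> R).
Hypothesis sn : seminormed H N.
Variables (S : R -> X -> X) (C : R) (F : X -> X) (Ji : X -> X).
Hypotheses (HS : propagator H N S C) (HF : loclip H N F) (HJi : isom H N Ji).

Let C0 : 0 < C. Proof. exact: lt_le_trans ltr01 (pr_C HS). Qed.

Lemma geometric_limit (V : nat -> X) (a : R) : 0 <= a -> (forall n, H (V n)) ->
  (forall n, N (V n.+1 - V n) <= a * 2^-1 ^+ n) ->
  exists l, H l /\ forall n, N (V n - l) <= 2 * a * 2^-1 ^+ n.
Proof.
move=> a0 hV dV.
have q0 n : 0 <= (2^-1 : R) ^+ n by rewrite exprn_ge0// invr_ge0.
have tel m k : N (V (m + k)%N - V m) <= 2 * a * 2^-1 ^+ m - 2 * a * 2^-1 ^+ (m + k).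
  elim: k => [|k IH]; first by rewrite addn0 !subrr (N00 sn).
  apply: le_trans (NtriB sn (hV _) (hV (m + k)%N) (hV _)) _.
  have := dV (m + k)%N; rewrite addnS exprS.
  move: IH; move: (N _) (N _) (2^-1 ^+ (m + k)) (2^-1 ^+ m) => x y p q h h1; lra.
have telle m k : N (V (m + k)%N - V m) <= 2 * a * 2^-1 ^+ m.
  by apply: le_trans (tel m k) _; rewrite gerBl !mulr_ge0.
have [l [hl cl]] : exists l, H l /\ N (V n - l) @[n --> \oo] --> 0.
  apply: (sn_complete sn hV) => e e0.
  have [n0 hn0] := geometric_lt (4 * a) e0.
  exists n0 => m n hm hn.
  apply: le_trans (NtriB sn (hV m) (hV n0) (hV n)) _.
  rewrite (NC sn (hV n0) (hV n)).
  have := telle n0 (m - n0)%N; have := telle n0 (n - n0)%N.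
  rewrite !subnKC//; move: (N _) (N _) hn0 => x y; move: (2^-1 ^+ n0) => q; lra.
exists l; split => // n.
apply/ler_addgt0Pr => e e0.
have /cvgr0Pnorm_lt/(_ e e0)[n1 _ hn1] := cl.
have := hn1 (n + n1)%N (leq_addl _ _) => /= h1.
apply: le_trans (NtriB sn (hV n) (hV (n + n1)%N) hl) _.
rewrite (NC sn (hV n) (hV _)); apply: lerD; first exact: telle.
by apply: le_trans (ler_norm _) _; exact: ltW.
Qed.

Lemma local_existence m : 0 < m -> exists T M, 0 < T /\ forall w, H w -> N w <= m ->
  exists v, sol H N S F Ji w T v /\ forall t : R, - T <= t <= T -> N (v t) <= M.
Proof.
move=> m0; pose M := C * m + 1.
have M0 : 0 < M by rewrite ltr_wpDl// mulr_ge0// ltW.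
have [B [B0 HB]] := F_ball sn HF M.
have CB1 : 0 < C * B + 1 by rewrite ltr_wpDl// mulr_ge0// ltW.
(* This choice gives [C * B * T <= 1], so the Duhamel map preserves the ball of radius
   [M = C * m + 1]. *)
pose T := (C * B + 1)^-1; have T0 : 0 < T by rewrite invr_gt0.
have CM : C * m + C * B * T <= M.
  rewrite /M lerD2l /T ler_pdivrMr// mul1r; lra.
have [L [L0 HL]] := ll_lip HF M.
exists T, M; split => // w hw wm.
have zT : - T <= 0 <= T by apply/andP; split; lra.
pose P v := good H N v T /\ forall t : R, - T <= t <= T -> N (v t) <= M.
(* A choice function on the curves of [P] makes the relation [PicStep] iterable. *)
have /choice[G HG] v : exists v1, P v -> PicStep H N S F Ji w T v v1 /\ P v1.
  have [pv|] := EM (P v); last by exists v.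
  have [v1 st] := step_exists sn Ji HS HF w T0 pv.1; exists v1 => _; split => //; split.
    exact: (step_good sn HS HF HJi T0 hw pv.1 st).
  exact: (step_ball sn HS HF HJi T0 hw pv.1 wm HB B0 CM pv.2 st).
pose V n := iter n G (fun=> 0).
have PV n : P (V n).
  elim: n => [|n IH]; last by have [] := HG _ IH.
  split; first split.
  - by move=> t _; exact: (sn_0 sn).
  - by move=> t _ e e0; exists 1 => // s _ _; rewrite subrr (N00 sn).
  - by move=> t _; rewrite (N00 sn) ltW.
have SV n : PicStep H N S F Ji w T (V n) (V n.+1) by have [] := HG _ (PV n).
pose lam := 2 * C * L.
have lam0 : 0 < lam by rewrite !mulr_gt0.
have ex (t : R) : 1 <= expR (lam * `|t|) by rewrite -[leLHS]expR0 ler_expR mulr_ge0// ltW.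
pose E := expR (lam * T).
have exE (t : R) : - T <= t <= T -> expR (lam * `|t|) <= E.
  by move=> tT; rewrite ler_expR; apply: ler_wpM2l; rewrite ?(ltW lam0)// ler_norml.
have q0 n : 0 <= (2^-1 : R) ^+ n by rewrite exprn_ge0// invr_ge0.
have dV n : forall t : R, - T <= t <= T ->
    N (V n.+1 t - V n t) <= 2 * M * 2^-1 ^+ n * expR (lam * `|t|).
  elim: n => [|n IH] t tT.
    rewrite expr0 mulr1.
    apply: le_trans (NB sn ((PV 1%N).1.1 t tT) ((PV 0%N).1.1 t tT)) _.
    apply: le_trans (lerD ((PV 1%N).2 t tT) ((PV 0%N).2 t tT)) _.
    by move: (expR _) (ex t) => q hq; nra.
  have b0 : 0 <= 2 * M * 2^-1 ^+ n by rewrite !mulr_ge0// ltW.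
  have [_ _] := step_diff sn HS HF HJi T0 L0 HL hw hw (PV n.+1).1 (PV n).1 (PV n.+1).2
    (PV n).2 (SV n.+1) (SV n) b0 IH tT.
  rewrite subrr (N00 sn) mulr0 add0r exprSr mulrA; exact.
pose A := 2 * M * E.
have E0 : 0 <= E by exact: expR_ge0.
have A0 : 0 <= A by rewrite !mulr_ge0// ltW.
have /choice[v Hv] (t : R) : exists l, - T <= t <= T -> H l /\ forall n, N (V n t - l) <= 2 * A * 2^-1 ^+ n.
  have [tT|] := boolP (- T <= t <= T); last by exists 0.
  have [|n|l hl] := @geometric_limit (fun n => V n t) A A0; [by move=> n; exact: (PV n).1.1| |by exists l].
  apply: le_trans (dV n t tT) _; rewrite /A [leRHS]mulrAC; apply: ler_wpM2l => //.
    by rewrite !mulr_ge0// ltW.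
  exact: exE.
have hv : Hon H v (- T) T by move=> t tT; case: (Hv t tT).
have vV (t : R) n : - T <= t <= T -> N (V n t - v t) <= 2 * A * 2^-1 ^+ n by move=> /Hv[].
have gv : good H N v T.
  split=> // t tT e e0.
  have e3 : 0 < e / 3 by rewrite divr_gt0.
  have [n hn] := geometric_lt (2 * A) e3.
  have [d d0 Hd] := (PV n).1.2 t tT _ e3; exists d => // s sT st.
  have h1 := Hd s sT st; have h2 := vV t n tT; have h3 := vV s n sT.
  have hs := (PV n).1.1 s sT; have ht := (PV n).1.1 t tT.
  have t1 := NtriB sn (hv s sT) hs (hv t tT).
  have t2 := NtriB sn hs ht (hv t tT).
  rewrite (NC sn (hv s sT) hs) in t1.
  move: h1 h2 h3 t1 t2 hn; move: (N _) (N _) (N _) (N _) (N _) => n1 n2 n3 n4 n5.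
  by move: (2 * A * _) => q; lra.
have vM (t : R) : - T <= t <= T -> N (v t) <= M.
  move=> tT; apply: (geometric_le (a := 2 * A)) => n.
  have hV := (PV n).1.1 t tT.
  apply: le_trans (NleB sn (hv t tT) hV) _; rewrite (NC sn (hv t tT) hV).
  by apply: lerD; [exact: (PV n).2|exact: vV].
exists v; split => //; split => // t tT.
have [v1 st] := step_exists sn Ji HS HF w T0 gv.
have [J [hJ Ev]] := st t tT; exists J; split => //; rewrite -Ev.
apply/eqP; rewrite eq_le (sn_N0 sn) andbT.
(* The limit is compared with its own Picard step [v1] through the iterate [V n.+1]: convergence
   accounts for [2 * A], and one use of [step_diff] for [A * E]. *)
apply: (geometric_le (a := 2 * A + A * E)) => n; rewrite add0r.
have b0 : 0 <= 2 * A * 2^-1 ^+ n by apply: mulr_ge0 => //; exact: mulr_ge0.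
have vb (s : R) : - T <= s <= T -> N (V n s - v s) <= 2 * A * 2^-1 ^+ n * expR (2 * C * L * `|s|).
  by move=> sT; apply: le_trans (vV s n sT) _; rewrite ler_peMr.
have [hV1 hv1 h] := step_diff sn HS HF HJi T0 L0 HL hw hw (PV n).1 gv (PV n).2 vM (SV n) st b0 vb tT.
rewrite subrr (N00 sn) mulr0 add0r in h.
have t1 := NtriB sn (hv t tT) hV1 hv1; rewrite (NC sn (hv t tT) hV1) in t1.
apply: le_trans t1 _; rewrite [(_ + A * E) * _]mulrDl; apply: lerD.
  apply: le_trans (vV t n.+1 tT) _; apply: ler_wpM2l; first by rewrite mulr_ge0.
  by rewrite exprS ler_piMl// invf_le1// ler1n.
apply: le_trans h _.
have -> : 2 * A * 2^-1 ^+ n / 2 = A * 2^-1 ^+ n by field.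
rewrite [leRHS]mulrAC; apply: ler_wpM2l; [by rewrite mulr_ge0|exact: exE].
Qed.

End Existence.

(** * The space H^1 *)

Opaque n2 trigT trigN bump Rintegral.

Import Normc.
Local Open Scope complex_scope.

Section Complex.
Context {R : realType}.
Local Notation mu := (@lebesgue_measure R).
Local Notation X := (R -> R[i]).
Implicit Types (u v : X) (a b : R) (z w : R[i]).

Definition re u (x : R) : R := complex.Re (u x).
Definition im u (x : R) : R := complex.Im (u x).

Lemma ReD z w : complex.Re (z + w) = complex.Re z + complex.Re w.
Proof. by case: z; case: w. Qed.
Lemma ImD z w : complex.Im (z + w) = complex.Im z + complex.Im w.
Proof. by case: z; case: w. Qed.
Lemma ReB z w : complex.Re (z - w) = complex.Re z - complex.Re w.
Proof. by case: z; case: w. Qed.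
Lemma ImB z w : complex.Im (z - w) = complex.Im z - complex.Im w.
Proof. by case: z; case: w. Qed.
Lemma ReM z w : complex.Re (z * w) = complex.Re z * complex.Re w - complex.Im z * complex.Im w.
Proof. by case: z; case: w. Qed.
Lemma ImM z w : complex.Im (z * w) = complex.Re z * complex.Im w + complex.Im z * complex.Re w.
Proof. by case: z => a b; case: w => c d /=. Qed.

Lemma normc_sqr z : normc z ^+ 2 = complex.Re z ^+ 2 + complex.Im z ^+ 2.
Proof. by case: z => a b; rewrite /= sqr_sqrtr// addr_ge0 ?sqr_ge0. Qed.

(** Used at three levels: the modulus of a complex number, the L^2 norm from those of the real and
    imaginary parts, and the H^1 norm from those of a function and its derivative. *)
Definition pyth (a b : R) := Num.sqrt (a ^+ 2 + b ^+ 2).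

Lemma pyth_ge0 a b : 0 <= pyth a b. Proof. exact: sqrtr_ge0. Qed.

Lemma pyth_sqr a b : pyth a b ^+ 2 = a ^+ 2 + b ^+ 2.
Proof. by rewrite sqr_sqrtr// addr_ge0 ?sqr_ge0. Qed.

Lemma pyth_le a b c d : 0 <= a <= c -> 0 <= b <= d -> pyth a b <= pyth c d.
Proof.
move=> /andP[a0 ac] /andP[b0 bd]; rewrite /pyth ler_wsqrtr// lerD// lerXn2r// nnegrE//.
- exact: le_trans ac.
- exact: le_trans bd.
Qed.

Lemma pyth_tri a b c d : pyth (a + c) (b + d) <= pyth a b + pyth c d.
Proof.
rewrite -ler_sqr ?nnegrE ?addr_ge0 ?pyth_ge0// sqrrD !pyth_sqr.
have : a * c + b * d <= pyth a b * pyth c d.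
  have h0 : 0 <= pyth a b * pyth c d by rewrite mulr_ge0 ?pyth_ge0.
  apply: le_trans (ler_norm _) _; rewrite -ler_sqr ?nnegrE// exprMn !pyth_sqr real_normK ?num_real//.
  by have := sqr_ge0 (a * d - b * c); nra.
by move: (pyth _ _ * _) => q; rewrite mulr2n; nra.
Qed.

Lemma pythZ k a b : pyth (k * a) (k * b) = `|k| * pyth a b.
Proof.
apply/eqP; rewrite -(@eqrXn2 _ 2) ?mulr_ge0 ?pyth_ge0//.
by rewrite exprMn !pyth_sqr real_normK ?num_real//; apply/eqP; ring.
Qed.

Lemma pyth_leD a b : 0 <= a -> 0 <= b -> pyth a b <= a + b.
Proof.
move=> a0 b0; rewrite -ler_sqr ?nnegrE ?addr_ge0 ?pyth_ge0// pyth_sqr; nra.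
Qed.

Lemma pyth_ge a b : `|a| <= pyth a b /\ `|b| <= pyth a b.
Proof.
have h c d : `|c| <= pyth c d.
  rewrite -ler_sqr ?nnegrE ?pyth_ge0// pyth_sqr real_normK ?num_real//.
  by rewrite lerDl sqr_ge0.
by split; [exact: h|rewrite /pyth addrC; exact: h].
Qed.

Definition l2 u := pyth (n2 (re u)) (n2 (im u)).

Definition cl2 u := sq (re u) /\ sq (im u).

Lemma l2_ge0 u : 0 <= l2 u. Proof. exact: pyth_ge0. Qed.

Lemma L2_norm u : cmeasurable u ->
  (L2 u <-> cl2 u) /\ (cl2 u -> L2norm u = (l2 u)%:E).
Proof.
move=> mu_; have [mr mi] := mu_.
pose g x := normc (u x).
have g0 x : 0 <= g x by rewrite /g; case: (u x) => a b; exact: sqrtr_ge0.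
have gE x : g x ^+ 2 = re u x ^+ 2 + im u x ^+ 2 by exact: normc_sqr.
have mg : measurable_fun setT g.
  have -> : g = (fun x => Num.sqrt (re u x ^+ 2 + im u x ^+ 2)).
    by apply/funext => x; rewrite -gE sqrtr_sqr ger0_norm.
  apply: (measurableT_comp (f := @Num.sqrt R)); first by apply: continuous_measurable_fun; exact: sqrt_continuous.
  by apply: measurable_funD; exact: measurable_funX.
have E : (\int[mu]_x (`|(g x)%:E| `^ 2) = \int[mu]_x (g x ^+ 2)%:E)%E.
  apply: eq_integral => x _; rewrite /= ger0_norm// -[2]/(2%:R) powR_mulrn//.
have NE : L2norm u = ((\int[mu]_x (g x ^+ 2)%:E) `^ 2^-1)%E.
  by rewrite /L2norm unlock E.
have sgP : sq g <-> cl2 u.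
  split=> [sg|[sr si]].
    have le x : `|re u x| <= `|g x| /\ `|im u x| <= `|g x|.
      have h : g x = pyth (re u x) (im u x).
        by rewrite /pyth -gE sqrtr_sqr ger0_norm.
      by rewrite (ger0_norm (g0 x)) h; exact: pyth_ge.
    by split; apply: sq_le sg => // x; case: (le x).
  split => //; apply: (eq_intg measurableT _ (intgD measurableT sr.2 si.2)) => x _ /=.
  by rewrite gE.
have LE : cl2 u -> L2norm u = (l2 u)%:E.
  move=> cu; have sg := sgP.2 cu; rewrite NE (Rint_EFin measurableT sg.2) poweR_EFin powR12_sqrt.
    rewrite /l2 /pyth !n2_sqr -(RintD measurableT cu.1.2 cu.2.2).
    by congr (Num.sqrt _)%:E; apply: eq_Rintegral => x _; rewrite gE.
  by rewrite -n2_sqr sqr_ge0.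
split=> //; split=> [[_]|cu]; last by split => //; rewrite LE// ltry.
move=> lt; apply/sgP; split => //; apply/integrableP; split.
  by apply/measurable_EFinP; exact: measurable_funX.
have -> : (\int[mu]_x `|(EFin \o (fun x => (g x ^+ 2)%R)) x| = \int[mu]_x (g x ^+ 2)%:E)%E.
  by apply: eq_integral => x _ /=; rewrite ger0_norm// sqr_ge0.
move: lt; rewrite NE; case: (integral _ _ _) => [r _|h|_]; [by rewrite ltry| |by []].
by move: h; rewrite /= gt_eqF ?invr_gt0.
Qed.

Lemma L2P u : L2 u <-> cl2 u.
Proof.
split=> [h|[s1 s2]]; first by have [[]] := L2_norm h.1; tauto.
have cm : cmeasurable u by split; [exact: s1.1|exact: s2.1].
by have [[_ h] _] := L2_norm cm; exact: h.
Qed.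

Lemma L2normE u : cl2 u -> L2norm u = (l2 u)%:E.
Proof.
by move=> cu; have [cm _] := (L2P u).2 cu; have [_] := L2_norm cm; exact.
Qed.

(** Test functions are real, so the real and imaginary parts decouple. *)
Lemma wdP u u' : weak_derivative u u' <-> wd (re u) (re u') /\ wd (im u) (im u').
Proof.
have E phi D v : cintegral D (fun x => v x * (phi x)%:C) =
    (\int[mu]_(x in D) (re v x * phi x)) +i* (\int[mu]_(x in D) (im v x * phi x)).
  rewrite /cintegral; congr Complex; apply: eq_Rintegral => x _.
    by rewrite ReM /= mulr0 subr0.
  by rewrite ImM /= mulr0 add0r.
split=> [h|[h1 h2] phi tphi].
  by split=> phi tphi; have := h phi tphi; rewrite !E => -[].
by rewrite !E (h1 _ tphi) (h2 _ tphi).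
Qed.

End Complex.

(** * H^1 as a complete seminormed space *)

Section H1space.
Context {R : realType}.
Local Notation mu := (@lebesgue_measure R).
Local Notation X := (R -> R[i]).
Implicit Types (u v w : X) (a b : R) (z : R[i]).

Lemma reD u v : re (u + v) = fun x => re u x + re v x.
Proof. by apply/funext => x; rewrite /re -ReD. Qed.
Lemma imD u v : im (u + v) = fun x => im u x + im v x.
Proof. by apply/funext => x; rewrite /im -ImD. Qed.
Lemma reB u v : re (u - v) = fun x => re u x - re v x.
Proof. by apply/funext => x; rewrite /re -ReB. Qed.
Lemma imB u v : im (u - v) = fun x => im u x - im v x.
Proof. by apply/funext => x; rewrite /im -ImB. Qed.
Lemma re_sc k u : re (sc k u) = fun x => k * re u x.
Proof. by apply/funext => x; rewrite /re /sc ReM /= mul0r subr0. Qed.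
Lemma im_sc k u : im (sc k u) = fun x => k * im u x.
Proof. by apply/funext => x; rewrite /im /sc ImM /= mul0r addr0. Qed.

Lemma cl2D u v : cl2 u -> cl2 v -> cl2 (u + v).
Proof. by move=> [h1 h2] [k1 k2]; split; rewrite ?reD ?imD; exact: sqD. Qed.
Lemma cl2B u v : cl2 u -> cl2 v -> cl2 (u - v).
Proof. by move=> [h1 h2] [k1 k2]; split; rewrite ?reB ?imB; exact: sqB. Qed.
Lemma cl2Z k u : cl2 u -> cl2 (sc k u).
Proof. by move=> [h1 h2]; split; rewrite ?re_sc ?im_sc; exact: sqZ. Qed.

Lemma l2D u v : cl2 u -> cl2 v -> l2 (u + v) <= l2 u + l2 v.
Proof.
move=> [h1 h2] [k1 k2]; apply: le_trans (pyth_tri _ _ _ _).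
by apply: pyth_le; rewrite n2_ge0 ?reD ?imD n2_triangle.
Qed.

Lemma l2_sc k u : cl2 u -> l2 (sc k u) = `|k| * l2 u.
Proof.
by move=> [h1 h2]; rewrite /l2 re_sc im_sc !n2Z// pythZ normr_id.
Qed.

Lemma l2_ae u v : cl2 u -> cl2 v -> u = v %[ae mu] -> l2 u = l2 v.
Proof.
move=> [[h1 _] [h2 _]] [[k1 _] [k2 _]] uv.
by rewrite /l2; congr pyth; apply: n2_ae => //; apply: ae_imp uv => x h _; rewrite /re /im h.
Qed.

(** Carries an explicit weak derivative. [wderiv] makes an arbitrary choice, but two choices agree
    almost everywhere, so the norm may be computed from any of them ([H1normE]). *)
Definition pairing u u' := [/\ cl2 u, cl2 u' & weak_derivative u u'].

Lemma pairing_unique u v u' v' : u = v %[ae mu] -> pairing u u' -> pairing v v' -> u' = v' %[ae mu].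
Proof.
move=> uv [[s1 s2] [s1' s2'] /wdP[d1 d2]] [[t1 t2] [t1' t2'] /wdP[e1 e2]].
have f1 : wd (re v) (re u').
  apply: (@wd_ae R (re u) (re v) (re u') (re u')) => //; [exact: s1.1|exact: t1.1|exact: s1'.1|exact: s1'.1| |exact: ae_eq_refl].
  by apply: ae_imp uv => x h _; rewrite /re h.
have f2 : wd (im v) (im u').
  apply: (@wd_ae R (im u) (im v) (im u') (im u')) => //; [exact: s2.1|exact: t2.1|exact: s2'.1|exact: s2'.1| |exact: ae_eq_refl].
  by apply: ae_imp uv => x h _; rewrite /im h.
have := wd_unique s1'.1 t1'.1 (sq_locint s1') (sq_locint t1') f1 e1.
move=> /ae_and /(_ (wd_unique s2'.1 t2'.1 (sq_locint s2') (sq_locint t2') f2 e2)).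
apply: ae_imp => x [h1 h2] _; move: (h1 I) (h2 I); rewrite /re /im.
by case: (u' x) (v' x) => a b [c d] /= -> ->.
Qed.

Lemma H1_pairing u : H1 u <-> exists u', pairing u u'.
Proof.
split=> [[/L2P cu [u' [/L2P cu' du]]]|[u' [/L2P cu /L2P cu' du]]]; first by exists u'.
by split => //; exists u'.
Qed.

Lemma wderiv_pairing u : H1 u -> pairing u (wderiv u).
Proof.
move=> [/L2P cu [u' hu']]; rewrite /wderiv; case: xgetP => [d -> [/L2P c d']|] //.
by move=> /(_ u').
Qed.

Lemma H1normE u u' : pairing u u' -> H1norm u = pyth (l2 u) (l2 u').
Proof.
move=> hu; have hH : H1 u by apply/H1_pairing; exists u'.
have hw := wderiv_pairing hH.
have e : l2 (wderiv u) = l2 u'.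
  have [_ c1 _] := hw; have [_ c2 _] := hu.
  by apply: l2_ae => //; apply: pairing_unique hw hu; exact: ae_eq_refl.
case: hw => c1 c2 _.
by rewrite /H1norm !L2normE//= e.
Qed.

Lemma wd_lin (k : R) (a a' b b' : R -> R) : sq a -> sq a' -> sq b -> sq b' -> wd a a' -> wd b b' ->
  wd (fun x : R => a x + k * b x) (fun x => a' x + k * b' x).
Proof.
move=> sa sa' sb sb' da db.
have h (p p' q q' : R -> R) : sq p -> sq p' -> sq q -> sq q' -> wd p p' -> wd q q' ->
    wd (fun x => p x - q x) (fun x => p' x - q' x).
  by move=> *; apply: wdB => //; exact: sq_locint.
have kb : wd (fun x => - k * b x) (fun x => - k * b' x).
  move=> phi tphi.
  have e (c psi : R -> R) : sq c -> sq psi -> \int[mu]_x (- k * c x * psi x) = - k * \int[mu]_x (c x * psi x).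
    move=> sc sp; rewrite -(RintZ _ measurableT (sqM_intg sc sp)).
    by apply: eq_Rintegral => x _; rewrite mulrA.
  have [sp sp'] := tf_sq tphi.
  by rewrite !e// (db _ tphi) mulrN.
have := h _ _ _ _ sa sa' (sqZ (- k) sb) (sqZ (- k) sb') da kb.
by congr wd; apply/funext => x; rewrite mulNr opprK.
Qed.

Lemma pairingL k u u' v v' : pairing u u' -> pairing v v' -> pairing (u + sc k v) (u' + sc k v').
Proof.
move=> [cu cu' /wdP[d1 d2]] [cv cv' /wdP[e1 e2]].
split; [by apply: cl2D => //; exact: cl2Z|by apply: cl2D => //; exact: cl2Z|].
case: cu cu' cv cv' => [s1 s2] [s1' s2'] [t1 t2] [t1' t2'].
by apply/wdP; rewrite !reD !imD !re_sc !im_sc; split; apply: wd_lin.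
Qed.

Lemma pairing0 : pairing 0 0.
Proof.
have c0 : cl2 (0 : X) by split; exact: sq0.
split=> //; apply/wdP; split=> phi _; rewrite !Rint_eq0 ?oppr0// => x; rewrite /re /im /= mul0r//.
Qed.

Lemma pairingD u u' v v' : pairing u u' -> pairing v v' -> pairing (u + v) (u' + v').
Proof.
move=> h k; have := pairingL 1 h k.
by rewrite /sc; congr pairing; apply/funext => x; rewrite !fctE mul1r.
Qed.

Lemma pairingZ k u u' : pairing u u' -> pairing (sc k u) (sc k u').
Proof. by move=> h; have := pairingL k pairing0 h; rewrite !add0r. Qed.

Lemma pairingB u u' v v' : pairing u u' -> pairing v v' -> pairing (u - v) (u' - v').
Proof. by move=> h k; have := pairingL (-1) h k; rewrite !scN1. Qed.

Lemma l2_complete (f : nat -> X) : (forall n, cl2 (f n)) ->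
  (forall e, 0 < e -> exists n0, forall m n, (n0 <= m)%N -> (n0 <= n)%N -> l2 (f m - f n) <= e) ->
  exists l, [/\ cl2 l, L2lim (fun n => re (f n)) (re l), L2lim (fun n => im (f n)) (im l) &
    l2 (f n - l) @[n --> \oo] --> 0].
Proof.
move=> cf ca.
have [|e e0|p [sp cp]] := @sq_complete R (fun n => re (f n)); first by move=> n; case: (cf n).
  have [n0 hn0] := ca e e0; exists n0 => m n hm hn; apply: le_trans (hn0 m n hm hn).
  rewrite -[leLHS]ger0_norm ?n2_ge0// -reB; exact: (pyth_ge _ _).1.
have [|e e0|q [sq_ cq]] := @sq_complete R (fun n => im (f n)); first by move=> n; case: (cf n).
  have [n0 hn0] := ca e e0; exists n0 => m n hm hn; apply: le_trans (hn0 m n hm hn).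
  rewrite -[leLHS]ger0_norm ?n2_ge0// -imB; exact: (pyth_ge _ _).2.
exists (fun x => p x +i* q x); split => //.
apply: cvg0_le (cvgD0 cp cq) => n; rewrite l2_ge0/=.
apply: le_trans (pyth_leD (n2_ge0 _) (n2_ge0 _)) _.
by rewrite reB imB.
Qed.

(** For completeness, functions and derivatives converge separately in L^2, and the limits are
    paired because the weak derivative is closed. *)
Lemma H1_seminormed : seminormed (@H1 R) (@H1norm R).
Proof.
split.
- by apply/H1_pairing; exists 0; exact: pairing0.
- move=> u v /H1_pairing[u' hu] /H1_pairing[v' hv]; apply/H1_pairing; exists (u' + v'); exact: pairingD.
- move=> k u /H1_pairing[u' hu]; apply/H1_pairing; exists (sc k u'); exact: pairingZ.
- by move=> u; exact: sqrtr_ge0.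
- move=> u v /H1_pairing[u' hu] /H1_pairing[v' hv].
  rewrite (H1normE hu) (H1normE hv) (H1normE (pairingD hu hv)).
  apply: le_trans (pyth_tri _ _ _ _); case: hu hv => [c1 c2 _] [e1 e2 _].
  by apply: pyth_le; rewrite l2_ge0 l2D.
- move=> k u /H1_pairing[u' hu]; rewrite (H1normE hu) (H1normE (pairingZ k hu)).
  by case: hu => c1 c2 _; rewrite !l2_sc// pythZ normr_id.
- move=> f Hf ca.
  have /choice[f' hf] n : exists u', pairing (f n) u' by apply/H1_pairing.
  have cf n : cl2 (f n) by case: (hf n).
  have cf' n : cl2 (f' n) by case: (hf n).
  have [l [cl lr li cvl]] : exists l, [/\ cl2 l, L2lim (fun n => re (f n)) (re l), L2lim (fun n => im (f n)) (im l) &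
      l2 (f n - l) @[n --> \oo] --> 0].
    apply: l2_complete => // e e0; have [n0 hn0] := ca e e0; exists n0 => m n hm hn.
    apply: le_trans (hn0 m n hm hn); rewrite (H1normE (pairingB (hf m) (hf n))).
    by rewrite -[leLHS]ger0_norm ?l2_ge0//; exact: (pyth_ge _ _).1.
  have [l' [cl' lr' li' cvl']] : exists l, [/\ cl2 l, L2lim (fun n => re (f' n)) (re l), L2lim (fun n => im (f' n)) (im l) &
      l2 (f' n - l) @[n --> \oo] --> 0].
    apply: l2_complete => // e e0; have [n0 hn0] := ca e e0; exists n0 => m n hm hn.
    apply: le_trans (hn0 m n hm hn); rewrite (H1normE (pairingB (hf m) (hf n))).
    by rewrite -[leLHS]ger0_norm ?l2_ge0//; exact: (pyth_ge _ _).2.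
  have hl : pairing l l'.
    split=> //; apply/wdP; split.
      by apply: (wd_lim _ _ _ lr lr') => n; case: (hf n) => [[h1 h2] [h1' h2'] /wdP[h3 h4]].
    by apply: (wd_lim _ _ _ li li') => n; case: (hf n) => [[h1 h2] [h1' h2'] /wdP[h3 h4]].
  exists l; split; first by apply/H1_pairing; exists l'.
  apply: cvg0_le (cvgD0 cvl cvl') => n; rewrite (H1normE (pairingB (hf n) hl)) pyth_ge0/=.
  by rewrite pyth_leD ?l2_ge0.
Qed.

Lemma aeeq_H1 u v : H1 u -> H1 v -> (aeeq u v <-> H1norm (u - v) = 0).
Proof.
move=> /H1_pairing[u' hu] /H1_pairing[v' hv]; rewrite (H1normE (pairingB hu hv)).
have [cu cu' _] := hu; have [cv cv' _] := hv.
split=> [uv|/eqP].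
  have c0 : cl2 (0 : X) by case: pairing0.
  have l0 : l2 (0 : X) = 0 by rewrite /l2 /pyth !n2_0 expr0n addr0 sqrtr0.
  rewrite (@l2_ae (u - v) 0)//; first last.
  - by apply: ae_imp uv => x h _; rewrite !fctE h// subrr.
  - exact: cl2B.
  rewrite (@l2_ae (u' - v') 0)//; first last.
  - by apply: ae_imp (pairing_unique uv hu hv) => x h _; rewrite !fctE h// subrr.
  - exact: cl2B.
  by rewrite l0 /pyth expr0n addr0 sqrtr0.
rewrite sqrtr_eq0 => le0.
have l0 : l2 (u - v) = 0.
  apply/eqP; rewrite -sqrf_eq0 eq_le sqr_ge0 andbT.
  by apply: le_trans le0; rewrite lerDl sqr_ge0.
have [s1 s2] := cl2B cu cv.
move: l0 => /eqP; rewrite /l2 sqrtr_eq0 => le1.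
have n1 : n2 (re (u - v)) = 0.
  apply/eqP; rewrite -sqrf_eq0 eq_le sqr_ge0 andbT.
  by apply: le_trans le1; rewrite lerDl sqr_ge0.
have n2_ : n2 (im (u - v)) = 0.
  apply/eqP; rewrite -sqrf_eq0 eq_le sqr_ge0 andbT.
  by apply: le_trans le1; rewrite lerDr sqr_ge0.
have := ae_and (n2_eq0 s1 n1) (n2_eq0 s2 n2_).
apply: ae_imp => x [h1 h2] _; move: (h1 I) (h2 I); rewrite reB imB /re /im /=.
case: (u x) (v x) => a b [c d] /= /eqP; rewrite subr_eq0 => /eqP -> /eqP.
by rewrite subr_eq0 => /eqP ->.
Qed.

Definition Ji u : X := fun y => (0 +i* 1) * u y.

Lemma re_Ji u : re (Ji u) = fun x => - im u x.
Proof. by apply/funext => x; rewrite /re /Ji ReM /= mul0r mul1r sub0r. Qed.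
Lemma im_Ji u : im (Ji u) = re u.
Proof. by apply/funext => x; rewrite /im /Ji ImM /= mul0r mul1r add0r. Qed.

Lemma cl2_Ji u : cl2 u -> cl2 (Ji u).
Proof. by case=> h1 h2; split; rewrite ?re_Ji ?im_Ji//; exact: sqN. Qed.

Lemma l2_Ji u : l2 (Ji u) = l2 u.
Proof. by rewrite /l2 re_Ji im_Ji n2N /pyth addrC. Qed.

Lemma pairing_Ji u u' : pairing u u' -> pairing (Ji u) (Ji u').
Proof.
move=> [cu cu' /wdP[d1 d2]]; split; [exact: cl2_Ji|exact: cl2_Ji|].
apply/wdP; rewrite !re_Ji !im_Ji; split => //.
case: cu cu' => [s1 s2] [s1' s2'].
have := wd_lin (-1) sq0 sq0 s2 s2' _ d2.
have E (f : R -> R) : (fun x => 0 + -1 * f x) = (fun x => - f x) by apply/funext => x; rewrite add0r mulN1r.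
rewrite !E; apply => phi _; rewrite !Rint_eq0 ?oppr0// => x; exact: mul0r.
Qed.

End H1space.

(** * The nonlinearity *)

Transparent n2 trigT trigN bump Rintegral.

Section Nonlinearity.
Context {R : realType}.
Implicit Types (p q M : R) (Phi Psi : R -> R -> R).

Lemma locLip_bound Phi M : locLip Phi ->
  exists K, 0 <= K /\ forall p q, `|p| <= M -> `|q| <= M -> `|Phi p q| <= K.
Proof.
move=> lP; have [L [L0 HL]] := lP `|M|.
exists (`|Phi 0 0| + L * (`|M| + `|M|)); split.
  by rewrite addr_ge0// mulr_ge0// addr_ge0.
move=> p q pM qM.
have pM' := le_trans pM (ler_norm M); have qM' := le_trans qM (ler_norm M).
have := HL p q 0 0 pM' qM'; rewrite normr0 !subr0 => /(_ (normr_ge0 _) (normr_ge0 _)) h.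
have -> : Phi p q = Phi 0 0 + (Phi p q - Phi 0 0) by ring.
apply: le_trans (ler_normD _ _) _; rewrite lerD2l; apply: le_trans h _.
by apply: ler_wpM2l => //; exact: lerD.
Qed.

Lemma locLip_cst k : locLip (fun _ _ : R => k).
Proof. by move=> M; exists 0; split => // *; rewrite subrr normr0 mul0r. Qed.

Lemma locLip_fst : locLip (fun p _ : R => p).
Proof. by move=> M; exists 1; split => // *; rewrite mul1r lerDl. Qed.

Lemma locLip_swap Phi : locLip Phi -> locLip (fun p q => Phi q p).
Proof.
move=> lP M; have [L [L0 HL]] := lP M; exists L; split => // p q p' q' *.
by rewrite [X in _ * X]addrC; exact: HL.
Qed.

Lemma locLipD Phi Psi : locLip Phi -> locLip Psi -> locLip (fun p q => Phi p q + Psi p q).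
Proof.
move=> lP lQ M; have [L [L0 HL]] := lP M; have [K [K0 HK]] := lQ M.
exists (L + K); split; first exact: addr_ge0.
move=> p q p' q' h1 h2 h3 h4; rewrite opprD addrACA mulrDl.
by apply: le_trans (ler_normD _ _) _; apply: lerD; [exact: HL|exact: HK].
Qed.

Lemma locLipM Phi Psi : locLip Phi -> locLip Psi -> locLip (fun p q => Phi p q * Psi p q).
Proof.
move=> lP lQ M; have [L [L0 HL]] := lP M; have [K [K0 HK]] := lQ M.
have [A [A0 HA]] := locLip_bound M lP; have [B [B0 HB]] := locLip_bound M lQ.
exists (L * B + A * K); split; first by rewrite addr_ge0// mulr_ge0.
move=> p q p' q' h1 h2 h3 h4.
have -> : Phi p q * Psi p q - Phi p' q' * Psi p' q' =
  (Phi p q - Phi p' q') * Psi p q + Phi p' q' * (Psi p q - Psi p' q') by ring.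
apply: le_trans (ler_normD _ _) _; rewrite [leRHS]mulrDl !normrM; apply: lerD.
  by rewrite [leRHS]mulrAC; apply: ler_pM => //; [exact: HL|exact: HB].
by rewrite -mulrA; apply: ler_pM => //; [exact: HA|exact: HK].
Qed.

Lemma expR_lip (B a b : R) : `|a| <= B -> `|b| <= B -> `|expR a - expR b| <= expR B * `|a - b|.
Proof.
wlog ba : a b / b <= a => [h|].
  have [ba|ab] := leP b a; first exact: h.
  by move=> aB bB; rewrite distrC [`|a - b|]distrC; apply: h => //; exact: ltW.
move=> aB bB; rewrite !ger0_norm ?subr_ge0 ?ler_expR//.
have := expR_ge1Dx (b - a).
have -> : expR b = expR a * expR (b - a) by rewrite -expRD; congr expR; ring.
have : expR a <= expR B by rewrite ler_expR (le_trans (ler_norm _) aB).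
by have := expR_gt0 a; move: (expR a) (expR B) (expR (b - a)) => u v w; nra.
Qed.

Lemma locLip_expR Phi : locLip Phi -> locLip (fun p q => expR (Phi p q)).
Proof.
move=> lP M; have [L [L0 HL]] := lP M; have [A [A0 HA]] := locLip_bound M lP.
exists (expR A * L); split; first by rewrite mulr_ge0// expR_ge0.
move=> p q p' q' h1 h2 h3 h4; apply: le_trans (expR_lip (HA _ _ h1 h2) (HA _ _ h3 h4)) _.
by rewrite -mulrA; apply: ler_wpM2l; [exact: expR_ge0|exact: HL].
Qed.

Variables (r : R).
Hypothesis r1 : 1 <= r.

Let r0 : r != 0. Proof. by rewrite gt_eqF// (lt_le_trans ltr01). Qed.

(** By homogeneity it suffices to treat [t = x / y] in [[0, 1]], where
    [1 - t^r <= 1 - t^k <= k (1 - t)] for an integer [k >= r]. Bounding the remaining factor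
    [y^(r - 1)] by [M^(r - 1)] uses [r >= 1]. *)
Lemma powR_lip M : 0 <= M -> exists K, 0 <= K /\ forall x y, 0 <= x -> x <= y -> y <= M ->
  0 <= y `^ r - x `^ r <= K * (y - x).
Proof.
move=> M0; pose k := (Num.trunc r).+1.
have rk : r <= k%:R by apply: ltW; exact: truncnS_gt.
have pow1 (t : R) : 0 <= t <= 1 -> 1 - t `^ r <= k%:R * (1 - t).
  move=> /andP[t0 t1].
  have [->|tN] := eqVneq t 0; first by rewrite powR0// !subr0 mulr1 ler1n.
  have tp : 0 < t by rewrite lt_neqAle eq_sym tN.
  apply: le_trans (_ : 1 - t ^+ k <= _).
    by rewrite lerB// -powR_mulrn//; apply: ger_powR => //; rewrite tp.
  elim: k {rk} => [|k IH]; first by rewrite expr0 subrr mul0r.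
  rewrite exprS -natr1; have : 0 <= t ^+ k by exact: exprn_ge0.
  have : t ^+ k <= 1 by exact: exprn_ile1.
  by move: (t ^+ k) (k%:R) IH => u v; nra.
exists (k%:R * M `^ (r - 1)); split; first by rewrite mulr_ge0// powR_ge0.
move=> x y x0 xy yM; have y0 := le_trans x0 xy.
apply/andP; split.
  by rewrite subr_ge0 ge0_ler_powR// ?nnegrE// (le_trans ler01).
have [yE|yN] := eqVneq y 0.
  have -> : x = 0 by apply: le_anti; rewrite x0 -yE xy.
  by rewrite yE !subrr mulr0.
have yp : 0 < y by rewrite lt_neqAle eq_sym yN.
have -> : x = y * (x / y) by rewrite mulrC divfK.
have t01 : 0 <= x / y <= 1 by rewrite divr_ge0//= ler_pdivrMr// mul1r.
have t0 : 0 <= x / y by case/andP: t01.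
rewrite powRM//.
have h := pow1 _ t01.
have yr : y `^ r = y `^ (r - 1) * y.
  by rewrite -[X in _ * X]powRr1 ?(ltW yp)// -powRD ?subrK//; apply/implyP.
have hM : y `^ (r - 1) <= M `^ (r - 1).
  by apply: ge0_ler_powR; rewrite ?nnegrE// subr_ge0.
have hp : 0 <= y `^ (r - 1) by exact: powR_ge0.
have g1 : 0 <= k%:R :> R by [].
rewrite yr; move: h hM hp t01 g1.
move: (x / y) (_ `^ r) (M `^ _) (y `^ _) k%:R => t tr m a b h hM hp /andP[t0' t1] b0.
have -> : a * y - a * y * tr = (a * y) * (1 - tr) by ring.
have -> : b * m * (y - y * t) = (m * y) * (b * (1 - t)) by ring.
apply: le_trans (_ : a * y * (b * (1 - t)) <= _).
  by apply: ler_wpM2l => //; exact: mulr_ge0.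
apply: ler_wpM2r; first by rewrite mulr_ge0// subr_ge0.
by apply: ler_wpM2r => //; exact: ltW.
Qed.

Lemma pyth_dist p q p' q' : `|pyth p q - pyth p' q'| <= `|p - p'| + `|q - q'|.
Proof.
have h a b a' b' : pyth a b <= pyth a' b' + (`|a - a'| + `|b - b'|).
  have := pyth_tri a' b' (a - a') (b - b'); rewrite !subrKC => k.
  apply: le_trans k _; rewrite lerD2l.
  have -> : pyth (a - a') (b - b') = pyth `|a - a'| `|b - b'|.
    by rewrite /pyth !real_normK ?num_real.
  exact: pyth_leD.
rewrite ler_norml lerBlDl h andbT lerBrDl -lerBrDr opprK.
by rewrite [`|p - p'|]distrC [`|q - q'|]distrC h.
Qed.

(* Bounded functions of the direction of [(p, q)], Lipschitz at distance 1 from the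
   origin; [p / pyth p q] is [0] at the origin by the convention [x / 0 = 0]. *)
Definition angular (x : R -> R -> R) := (forall p q, `|x p q| <= 1) /\
  forall p q p' q', 0 < pyth p' q' -> pyth p' q' <= pyth p q ->
    pyth p q * `|x p q - x p' q'| <= 2 * (`|p - p'| + `|q - q'|).

Lemma angular_fst : angular (fun p q => p / pyth p q).
Proof.
have b1 p q : `|p / pyth p q| <= 1.
  have [->|N] := eqVneq (pyth p q) 0; first by rewrite invr0 mulr0 normr0.
  have P : 0 < pyth p q by rewrite lt_neqAle eq_sym N pyth_ge0.
  by rewrite normf_div (gtr0_norm P) ler_pdivrMr// mul1r; case: (pyth_ge p q).
split => // p q p' q' P' PP.
have P := lt_le_trans P' PP.
rewrite -[X in X * _](gtr0_norm P) -normrM.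
have -> : pyth p q * (p / pyth p q - p' / pyth p' q') =
    (p - p') + (p' / pyth p' q') * (pyth p' q' - pyth p q).
  by field; rewrite !gt_eqF.
apply: le_trans (ler_normD _ _) _.
have h := b1 p' q'; have h2 := pyth_dist p' q' p q.
rewrite [`|p' - p|]distrC [`|q' - q|]distrC in h2.
have h3 : `|p' / pyth p' q' * (pyth p' q' - pyth p q)| <= `|p - p'| + `|q - q'|.
  by apply: le_trans h2; rewrite normrM ler_piMl.
have := normr_ge0 (q - q'); lra.
Qed.

Lemma pythC p q : pyth p q = pyth q p. Proof. by rewrite /pyth addrC. Qed.

Lemma angular_snd : angular (fun p q => q / pyth p q).
Proof.
have [h1 h2] := angular_fst; split => [p q|p q p' q']; first by rewrite pythC.
by rewrite (pythC p q) (pythC p' q') => a b; rewrite [`|p - _| + _]addrC; exact: h2.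
Qed.

Lemma pyth_bound p q M : `|p| <= M -> `|q| <= M -> pyth p q <= M + M.
Proof.
move=> h1 h2; have := pyth_dist p q 0 0.
rewrite !subr0 {2}/pyth expr0n addr0 sqrtr0 subr0 ger0_norm ?pyth_ge0// => h.
by apply: le_trans h _; exact: lerD.
Qed.

Lemma locLip_powR : locLip (fun p q => pyth p q `^ r).
Proof.
move=> M; have M0 : 0 <= `|M| + `|M| by exact: addr_ge0.
have [K [K0 HK]] := powR_lip M0; exists K; split => //.
move=> p q p' q' h1 h2 h3 h4.
wlog le : p q p' q' h1 h2 h3 h4 / pyth p' q' <= pyth p q => [h|].
  have [le|/ltW le] := leP (pyth p' q') (pyth p q); first exact: h.
  by rewrite distrC [`|p - _|]distrC [`|q - _|]distrC; apply: h.
have b : pyth p q <= `|M| + `|M|.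
  by apply: pyth_bound; [apply: le_trans h1 _|apply: le_trans h2 _]; exact: ler_norm.
have /andP[k1 k2] := HK _ _ (pyth_ge0 p' q') le b.
rewrite ger0_norm//; apply: le_trans k2 _; apply: ler_wpM2l => //.
by apply: le_trans (pyth_dist _ _ _ _); exact: ler_norm.
Qed.

(** Angular functions vary by about distance over radius. Changing direction at the smaller radius
    [m'] costs no more than [m'^r <= K m' <= K m] times this variation, so the singularity cancels.
    The constant is [K] for the radial part and [2 * K] for each direction. *)
Lemma locLip_homogeneous x y : angular x -> angular y ->
  locLip (fun p q => pyth p q `^ r * (x p q * y p q)).
Proof.
move=> [bx lx] [by_ ly] M; have M0 : 0 <= `|M| + `|M| by exact: addr_ge0.
have [K [K0 HK]] := powR_lip M0; exists (5 * K); split; first exact: mulr_ge0.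
move=> p q p' q' h1 h2 h3 h4.
wlog le : p q p' q' h1 h2 h3 h4 / pyth p' q' <= pyth p q => [h|].
  have [le|/ltW le] := leP (pyth p' q') (pyth p q); first exact: h.
  by rewrite distrC [`|p - _|]distrC [`|q - _|]distrC; apply: h.
have b : pyth p q <= `|M| + `|M|.
  by apply: pyth_bound; [apply: le_trans h1 _|apply: le_trans h2 _]; exact: ler_norm.
have P0 := pyth_ge0 p' q'.
have /andP[k1 k2] := HK _ _ P0 le b.
have /andP[_ k3] := HK _ _ (lexx 0) P0 (le_trans le b).
rewrite powR0// !subr0 in k3.
have d1 : pyth p q - pyth p' q' <= `|p - p'| + `|q - q'|.
  by apply: le_trans (pyth_dist _ _ _ _); exact: ler_norm.
have a'0 : 0 <= pyth p' q' `^ r by exact: powR_ge0.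
have ang z : angular z -> pyth p' q' `^ r * `|z p q - z p' q'| <= 2 * K * (`|p - p'| + `|q - q'|).
  move=> [bz lz]; have [E|N] := eqVneq (pyth p' q') 0.
    by rewrite E powR0// mul0r !mulr_ge0// addr_ge0.
  have P' : 0 < pyth p' q' by rewrite lt_neqAle eq_sym N.
  apply: le_trans (_ : K * (pyth p q * `|z p q - z p' q'|) <= _).
    rewrite mulrA; apply: ler_wpM2r => //; apply: le_trans k3 _; exact: ler_wpM2l.
  by rewrite [2 * K]mulrC -mulrA; apply: ler_wpM2l => //; exact: lz.
have ax := ang x (conj bx lx); have ay := ang y (conj by_ ly).
have -> : pyth p q `^ r * (x p q * y p q) - pyth p' q' `^ r * (x p' q' * y p' q') =
  (pyth p q `^ r - pyth p' q' `^ r) * (x p q * y p q) +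
  (pyth p' q' `^ r * (x p q - x p' q') * y p q + pyth p' q' `^ r * (y p q - y p' q') * x p' q') by ring.
apply: le_trans (ler_normD _ _) _.
have -> : 5 * K * (`|p - p'| + `|q - q'|) = K * (`|p - p'| + `|q - q'|) +
   (2 * K * (`|p - p'| + `|q - q'|) + 2 * K * (`|p - p'| + `|q - q'|)) by ring.
apply: lerD.
  rewrite normrM ger0_norm//; apply: le_trans (_ : pyth p q `^ r - pyth p' q' `^ r <= _).
    by rewrite ler_piMr// normrM mulr_ile1.
  by apply: le_trans k2 _; exact: ler_wpM2l.
apply: le_trans (ler_normD _ _) _; rewrite !normrM (ger0_norm a'0).
apply: lerD; [apply: le_trans ax|apply: le_trans ay]; rewrite ler_piMr// mulr_ge0//.
Qed.

(** At a zero of [g] continuity of [f] is enough for the product rule. It is applied at the origin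
    with [f] the exponential factor, which may have a corner there when [r = 1]. *)
Lemma is_derive_mul_root (f g : R -> R) (x b : R) : {for x, continuous f} ->
  is_derive x 1 g b -> g x = 0 -> is_derive x 1 (fun y => f y * g y) (f x * b).
Proof.
move=> cf [dg gb] gx.
have cg : (fun h : R => h^-1 *: ((g \o shift x) (h *: 1) - g x)) @ 0^' --> b.
  by rewrite -gb; exact: dg.
have cf' : (fun h : R => f (h + x)) @ 0^' --> f x.
  have h0 : (f \o shift x) 0 = f x by rewrite /= add0r.
  apply: cvg_within_filter; rewrite -h0.
  apply: (@continuous_comp _ _ _ (shift x) f); last by rewrite /= add0r.
  by apply: continuousD; [exact: cvg_id|exact: cvg_cst].
have c : (fun h : R => h^-1 *: (((fun y => f y * g y) \o shift x) (h *: 1) - f x * g x)) @ 0^' --> f x * b.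
  have -> : (fun h : R => h^-1 *: (((fun y => f y * g y) \o shift x) (h *: 1) - f x * g x)) =
      (fun h : R => f (h + x) * (h^-1 *: ((g \o shift x) (h *: 1) - g x))).
    apply/funext => h.
    by rewrite /= gx mulr0 !subr0 [h *: 1]mulr1 /GRing.scale /= mulrCA.
  exact: cvgM cf' cg.
by split; [apply: cvgP c|exact: cvg_lim c].
Qed.

Variable (c : R).

Definition expfac p q := expR (c * pyth p q `^ r).

(** With [z = (p, q)], these are [|z|^(r - 2) p ^ 2] and [|z|^(r - 2) p q] from the derivative of
    [|z|^r], written as a power times functions of the direction so that they vanish at the origin
    and [locLip_homogeneous] applies. *)
Definition hom11 p q := pyth p q `^ r * (p / pyth p q * (p / pyth p q)).
Definition hom12 p q := pyth p q `^ r * (p / pyth p q * (q / pyth p q)).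

Lemma locLip_expfac : locLip expfac.
Proof.
apply: locLip_expR; apply: (locLipM (locLip_cst c)); exact: locLip_powR.
Qed.

Lemma expfac_derive (P Q : R -> R) (x p' q' : R) : is_derive x 1 P p' -> is_derive x 1 Q q' ->
  pyth (P x) (Q x) != 0 ->
  is_derive x 1 (fun y => expfac (P y) (Q y))
    (expfac (P x) (Q x) * (c * (r * pyth (P x) (Q x) `^ r * ((P x * p' + Q x * q') / pyth (P x) (Q x) ^+ 2)))).
Proof.
move=> dP dQ N.
have s0 : 0 < P x * P x + Q x * Q x.
  have := pyth_sqr (P x) (Q x); rewrite !expr2 => <-.
  by rewrite mulr_gt0// lt_neqAle eq_sym N pyth_ge0.
(* As a power of [p ^ 2 + q ^ 2] the expression is differentiated away from the origin without
   passing through the square root. *)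
have pw p q : pyth p q `^ r = (p * p + q * q) `^ (r / 2).
  have nn : 0 <= p * p + q * q by rewrite addr_ge0// -expr2 sqr_ge0.
  by rewrite [r / 2]mulrC powRrM powR12_sqrt// /pyth !expr2.
have -> : (fun y => expfac (P y) (Q y)) = fun y => expR (c * (P y * P y + Q y * Q y) `^ (r / 2)).
  by apply/funext => y; rewrite /expfac pw.
have ds := is_derive_add (is_derive_mul dP dP) (is_derive_mul dQ dQ).
have dp := @is_derive_compose R (fun s => s `^ (r / 2)) _ x _ _ (is_derive1_powR (r / 2) s0) ds.
have de := @is_derive_compose R expR _ x _ _ (is_derive_expR _) (is_derive_scale c dp).
apply: (is_derive_val de); rewrite /= /expfac -pw; congr (_ * (c * _)).
have -> : (P x * P x + Q x * Q x) `^ (r / 2 - 1) = pyth (P x) (Q x) `^ r / pyth (P x) (Q x) ^+ 2.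
  rewrite pyth_sqr !expr2 pw powRB; last by apply/implyP => _; rewrite gt_eqF.
  by rewrite powRr1// ltW.
by move: (_ `^ r) => a; field.
Qed.

Lemma C1pair_nonlinearity : C1pair (fun p q => expfac p q * p)
  (fun p q => expfac p q * (1 + c * r * hom11 p q)) (fun p q => expfac p q * (c * r * hom12 p q)).
Proof.
have lh11 : locLip hom11 by apply: locLip_homogeneous; exact: angular_fst.
have lh12 : locLip hom12 by apply: locLip_homogeneous; [exact: angular_fst|exact: angular_snd].
have le := locLip_expfac.
split.
- exact: (locLipM le locLip_fst).
- apply: (locLipM le); apply: (locLipD (locLip_cst 1)); exact: (locLipM (locLip_cst (c * r))).
- apply: (locLipM le); exact: (locLipM (locLip_cst (c * r))).
move=> P Q x p' q' dP dQ.
(* At the origin [hom11] and [hom12] vanish, and the derivative comes from the linear factor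
   alone. *)
have [E|N] := eqVneq (pyth (P x) (Q x)) 0.
  have P0 : P x = 0 by apply/eqP; rewrite -normr_le0 -E; case: (pyth_ge (P x) (Q x)).
  have ce : {for x, continuous (fun y => expfac (P y) (Q y))}.
    by apply: locLip_cont => //; apply: is_derive_continuous; eassumption.
  apply: (is_derive_val (is_derive_mul_root ce dP P0)).
  by rewrite /hom11 /hom12 E powR0// !mul0r !mulr0 addr0 mul0r addr0 mulr1.
apply: (is_derive_val (is_derive_mul (expfac_derive dP dQ N) dP)).
rewrite /hom11 /hom12; move: N; move: (expfac _ _) (_ `^ r) => e a.
by move: (pyth _ _) => m N; field.
Qed.

Lemma C1pair_swap Phi Phi1 Phi2 : C1pair Phi Phi1 Phi2 ->
  C1pair (fun p q => Phi q p) (fun p q => Phi2 q p) (fun p q => Phi1 q p).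
Proof.
case=> l0 l1 l2 d; split; [exact: locLip_swap|exact: locLip_swap|exact: locLip_swap|].
by move=> P Q x p' q' dP dQ; apply: (is_derive_val (d _ _ _ _ _ dQ dP)); rewrite addrC.
Qed.

End Nonlinearity.

Opaque n2 trigT trigN bump Rintegral.

(** * Composition of H^1 functions with a C^1 function *)

Section Superposition.
Context {R : realType}.
Local Notation mu := (@lebesgue_measure R).
Implicit Types (A a B b f : R -> R) (Phi : R -> R -> R).

(** Four terms fit the splitting in [comp_lip]; shorter sums are obtained with zero coefficients. *)
Lemma n2_dominated f (k1 k2 k3 k4 : R) (u1 u2 u3 u4 : R -> R) : measurable_fun setT f ->
  sq u1 -> sq u2 -> sq u3 -> sq u4 -> 0 <= k1 -> 0 <= k2 -> 0 <= k3 -> 0 <= k4 ->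
  (forall x, `|f x| <= k1 * `|u1 x| + k2 * `|u2 x| + (k3 * `|u3 x| + k4 * `|u4 x|)) ->
  sq f /\ n2 f <= k1 * n2 u1 + k2 * n2 u2 + (k3 * n2 u3 + k4 * n2 u4).
Proof.
move=> mf s1 s2 s3 s4 p1 p2 p3 p4 le.
have Z (k : R) u : 0 <= k -> sq u -> sq (fun x => k * `|u x|) /\ n2 (fun x => k * `|u x|) = k * n2 u.
  move=> k0 su; split; first by apply: sqZ; exact: sq_norm.
  by rewrite n2Z ?n2_norm ?ger0_norm//; exact: sq_norm.
have [z1 e1] := Z _ _ p1 s1; have [z2 e2] := Z _ _ p2 s2.
have [z3 e3] := Z _ _ p3 s3; have [z4 e4] := Z _ _ p4 s4.
have t12 := n2_triangle z1 z2; have t34 := n2_triangle z3 z4.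
have t := n2_triangle (sqD z1 z2) (sqD z3 z4).
have sg := sqD (sqD z1 z2) (sqD z3 z4).
have le' x : `|f x| <= `|k1 * `|u1 x| + k2 * `|u2 x| + (k3 * `|u3 x| + k4 * `|u4 x|)|.
  by apply: le_trans (le x) _; exact: ler_norm.
have sf := sq_le mf le' sg; split=> //.
apply: le_trans (n2_le sf sg le') _; apply: le_trans t _.
rewrite -e1 -e2 -e3 -e4; exact: lerD.
Qed.

Lemma prim_sub A a B b : prim A a -> prim B b -> prim (fun x => A x - B x) (fun x => a x - b x).
Proof.
move=> [la pa] [lb pb]; split; first exact: locintB.
move=> x y xy; rewrite (RintB (measurable_itv _) (la _ _) (lb _ _)) -pa// -pb//; ring.
Qed.

Definition sobolev_rep A a := [/\ prim A a, sq A & sq a].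

Lemma rp_cont A a : sobolev_rep A a -> continuous A. Proof. by case=> h _ _; exact: prim_cont h. Qed.

Lemma locLip_meas Phi A a B b : locLip Phi -> sobolev_rep A a -> sobolev_rep B b ->
  measurable_fun setT (fun x => Phi (A x) (B x)).
Proof.
move=> lP hA hB; apply: continuous_measurable_fun => x.
by apply: locLip_cont => //; [exact: (rp_cont hA)|exact: (rp_cont hB)].
Qed.

Lemma rp_sup A a M x : sobolev_rep A a -> n2 A <= M -> n2 a <= M -> `|A x| <= M + M.
Proof. by case=> h1 h2 h3 m1 m2; apply: le_trans (sobolev x h1 h2 h3) _; exact: lerD. Qed.

Variables (Phi Phi1 Phi2 : R -> R -> R).
Hypotheses (CP : C1pair Phi Phi1 Phi2) (Phi0 : Phi 0 0 = 0).

Definition chain A a B b (x : R) := Phi1 (A x) (B x) * a x + Phi2 (A x) (B x) * b x.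

Lemma chain_meas A a B b : sobolev_rep A a -> sobolev_rep B b -> measurable_fun setT (chain A a B b).
Proof.
move=> hA hB; apply: measurable_funD; apply: measurable_funM.
- by apply: locLip_meas hA hB; exact: C1_lip1 CP.
- by case: hA => _ _ [].
- by apply: locLip_meas hA hB; exact: C1_lip2 CP.
- by case: hB => _ _ [].
Qed.

Lemma comp_rp A a B b : sobolev_rep A a -> sobolev_rep B b -> sobolev_rep (fun x => Phi (A x) (B x)) (chain A a B b).
Proof.
move=> hA hB; have [pA sA sa] := hA; have [pB sB sb] := hB.
pose M := Num.max (n2 A) (n2 a) + Num.max (n2 B) (n2 b).
have m0 : 0 <= Num.max (n2 A) (n2 a) /\ 0 <= Num.max (n2 B) (n2 b) by rewrite !le_max !n2_ge0.
have a1 : n2 A <= M /\ n2 a <= M.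
  by split; apply: le_trans (_ : Num.max (n2 A) (n2 a) <= _); rewrite ?le_max ?lexx ?orbT// lerDl; case: m0.
have b1 : n2 B <= M /\ n2 b <= M.
  by split; apply: le_trans (_ : Num.max (n2 B) (n2 b) <= _); rewrite ?le_max ?lexx ?orbT// lerDr; case: m0.
have sA' x := rp_sup x hA a1.1 a1.2; have sB' x := rp_sup x hB b1.1 b1.2.
have [L [L0 HL]] := C1_lip CP (M + M).
have [K1 [K10 HK1]] := locLip_bound (M + M) (C1_lip1 CP).
have [K2 [K20 HK2]] := locLip_bound (M + M) (C1_lip2 CP).
have MM0 : `|0 : R| <= M + M by rewrite normr0 !addr_ge0//; case: m0.
split.
- exact: prim_chain.
- have [] // := @n2_dominated (fun x => Phi (A x) (B x)) L L 0 0 A B A A.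
    by apply: locLip_meas hA hB; exact: C1_lip CP.
  move=> x; have := HL _ _ 0 0 (sA' x) (sB' x) MM0 MM0.
  by rewrite Phi0 !subr0 mulrDr !mul0r !addr0.
- have [] // := @n2_dominated (chain A a B b) K1 K2 0 0 a b a a.
    exact: chain_meas.
  move=> x; rewrite !mul0r !addr0; apply: le_trans (ler_normD _ _) _; rewrite !normrM.
  by apply: lerD; apply: ler_wpM2r => //; [apply: HK1|apply: HK2].
Qed.

(** The difference of derivatives splits into bounded coefficients times differences of [a] and [b],
    and differences of coefficients times [a1] and [b1]. The latter require Lipschitz partial
    derivatives, since only the functions themselves are bounded pointwise. The factor 4 comes from
    the Sobolev bounds [2 * D] on both [A - A1] and [B - B1]. *)
Lemma comp_lip M : 0 <= M -> exists K, 0 <= K /\ forall A a B b A1 a1 B1 b1 D,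
  [/\ sobolev_rep A a, sobolev_rep B b, sobolev_rep A1 a1 & sobolev_rep B1 b1] ->
  (n2 A <= M /\ n2 a <= M) /\ (n2 B <= M /\ n2 b <= M) ->
  (n2 A1 <= M /\ n2 a1 <= M) /\ (n2 B1 <= M /\ n2 b1 <= M) ->
  (n2 (fun x => A x - A1 x) <= D /\ n2 (fun x => a x - a1 x) <= D) /\
  (n2 (fun x => B x - B1 x) <= D /\ n2 (fun x => b x - b1 x) <= D) ->
  n2 (fun x => Phi (A x) (B x) - Phi (A1 x) (B1 x)) <= K * D /\
  n2 (fun x => chain A a B b x - chain A1 a1 B1 b1 x) <= K * D.
Proof.
move=> M0.
have [L [L0 HL]] := C1_lip CP (M + M).
have [L1 [L10 HL1]] := C1_lip1 CP (M + M).
have [L2 [L20 HL2]] := C1_lip2 CP (M + M).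
have [K1 [K10 HK1]] := locLip_bound (M + M) (C1_lip1 CP).
have [K2 [K20 HK2]] := locLip_bound (M + M) (C1_lip2 CP).
exists (2 * L + (K1 + K2 + 4 * L1 * M + 4 * L2 * M)).
have P1 : 0 <= 4 * L1 * M by rewrite mulr_ge0// mulr_ge0.
have P2 : 0 <= 4 * L2 * M by rewrite mulr_ge0// mulr_ge0.
have PK : 0 <= K1 + K2 + 4 * L1 * M + 4 * L2 * M by rewrite !addr_ge0.
have PL : 0 <= 2 * L by rewrite mulr_ge0.
split; first by rewrite addr_ge0.
move=> A a B b A1 a1 B1 b1 D [hA hB hA1 hB1] [[mA ma] [mB mb]] [[mA1 ma1] [mB1 mb1]] [[dA da] [dB db]].
have D0 : 0 <= D by apply: le_trans dA; exact: n2_ge0.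
have [pA sA sa] := hA; have [pB sB sb] := hB.
have [pA1 sA1 sa1] := hA1; have [pB1 sB1 sb1] := hB1.
have hdA : sobolev_rep (fun x => A x - A1 x) (fun x => a x - a1 x).
  by split; [exact: prim_sub|exact: sqB|exact: sqB].
have hdB : sobolev_rep (fun x => B x - B1 x) (fun x => b x - b1 x).
  by split; [exact: prim_sub|exact: sqB|exact: sqB].
have SA x := rp_sup x hA mA ma; have SB x := rp_sup x hB mB mb.
have SA1 x := rp_sup x hA1 mA1 ma1; have SB1 x := rp_sup x hB1 mB1 mb1.
have SdA x := rp_sup x hdA dA da; have SdB x := rp_sup x hdB dB db.
split.
  apply: le_trans (_ : 2 * L * D <= _); last first.
    by apply: ler_wpM2r => //; rewrite lerDl.
  have [|x|_] := @n2_dominated (fun x => Phi (A x) (B x) - Phi (A1 x) (B1 x)) L L 0 0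
    (fun x => A x - A1 x) (fun x => B x - B1 x) A A _ (sqB sA sA1) (sqB sB sB1) sA sA L0 L0 (lexx 0) (lexx 0).
  - by apply: measurable_funB; [exact: (locLip_meas (C1_lip CP) hA hB)|exact: (locLip_meas (C1_lip CP) hA1 hB1)].
  - by rewrite !mul0r !addr0 -mulrDr; exact: HL.
  move=> h; apply: le_trans h _; rewrite !mul0r !addr0 -mulrDr [2 * L]mulrC -mulrA mulr_natl mulr2n.
  by apply: ler_wpM2l => //; exact: lerD.
apply: le_trans (_ : (K1 * D + K2 * D + 4 * L1 * M * D + 4 * L2 * M * D) <= _); last first.
  by rewrite -!mulrDl; apply: ler_wpM2r => //; rewrite lerDr.
have q1 : 0 <= 4 * L1 * D by rewrite mulr_ge0// mulr_ge0.
have q2 : 0 <= 4 * L2 * D by rewrite mulr_ge0// mulr_ge0.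
have [|x|_] := @n2_dominated (fun x => chain A a B b x - chain A1 a1 B1 b1 x) K1 K2 (4 * L1 * D) (4 * L2 * D)
    (fun x => a x - a1 x) (fun x => b x - b1 x) a1 b1 _ (sqB sa sa1) (sqB sb sb1) sa1 sb1 K10 K20 q1 q2.
- by apply: measurable_funB; exact: chain_meas.
- have -> : chain A a B b x - chain A1 a1 B1 b1 x =
    (Phi1 (A x) (B x) * (a x - a1 x) + Phi2 (A x) (B x) * (b x - b1 x)) +
    ((Phi1 (A x) (B x) - Phi1 (A1 x) (B1 x)) * a1 x + (Phi2 (A x) (B x) - Phi2 (A1 x) (B1 x)) * b1 x).
    by rewrite /chain; ring.
  apply: le_trans (ler_normD _ _) _; apply: lerD; apply: le_trans (ler_normD _ _) _; rewrite !normrM.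
    by apply: lerD; apply: ler_wpM2r => //; [exact: HK1|exact: HK2].
  have dd : `|A x - A1 x| + `|B x - B1 x| <= 4 * D by have := SdA x; have := SdB x; lra.
  apply: lerD; apply: ler_wpM2r => //.
    apply: le_trans (HL1 _ _ _ _ (SA x) (SB x) (SA1 x) (SB1 x)) _.
    by rewrite [4 * L1]mulrC -mulrA; exact: ler_wpM2l.
  apply: le_trans (HL2 _ _ _ _ (SA x) (SB x) (SA1 x) (SB1 x)) _.
  by rewrite [4 * L2]mulrC -mulrA; exact: ler_wpM2l.
move=> h; apply: le_trans h _; rewrite -[leRHS]addrA; apply: lerD.
  by apply: lerD; exact: ler_wpM2l.
rewrite [4 * L1 * M * D]mulrAC [4 * L2 * M * D]mulrAC.
by apply: lerD; exact: ler_wpM2l.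
Qed.

End Superposition.

(** * The exponential nonlinearity on H^1 *)

Section Nonlinear.
Context {R : realType}.
Local Notation mu := (@lebesgue_measure R).
Local Notation X := (R -> R[i]).
Variables (r c : R).
Hypothesis r1 : 1 <= r.

Let f := exp_nonlinearity c r.
Let P1 p q := expfac r c p q * (1 + c * r * hom11 r p q).
Let P2 p q := expfac r c p q * (c * r * hom12 r p q).
Let P p q := expfac r c p q * p.
(** The arguments of [expfac] are exchanged so that [Q] is [P] with its variables swapped and
    inherits its derivatives from [C1pair_swap]. *)
Let Q p q := expfac r c q p * q.

Let CP : C1pair P P1 P2. Proof. exact: C1pair_nonlinearity. Qed.
Let CQ : C1pair Q (fun p q => P2 q p) (fun p q => P1 q p). Proof. exact: C1pair_swap CP. Qed.

Let fE (u : X) : re (fun x => f (u x)) = (fun x => P (re u x) (im u x)) /\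
  im (fun x => f (u x)) = (fun x => Q (re u x) (im u x)).
Proof.
have nE z : normc z = pyth (complex.Re z) (complex.Im z) by case: z.
split; apply/funext => x; rewrite /re /im /f /exp_nonlinearity.
  by rewrite ReM /= mul0r subr0 nE.
by rewrite ImM /= mul0r addr0 nE /Q /expfac (pythC (complex.Im _)).
Qed.

Let meas_expfac (a b : R -> R) : measurable_fun setT a -> measurable_fun setT b ->
  measurable_fun setT (fun x => expfac r c (a x) (b x)).
Proof.
move=> ma mb; apply: (measurableT_comp (f := expR)); first exact: measurable_expR.
apply: measurable_funM; first exact: measurable_cst.
apply: (measurableT_comp (f := fun s : R => s `^ r)); first exact: measurable_powR.
apply: (measurableT_comp (f := @Num.sqrt R)).
  by apply: continuous_measurable_fun; exact: sqrt_continuous.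
by apply: measurable_funD; exact: measurable_funX.
Qed.

Let meas_PQ (a b : R -> R) : measurable_fun setT a -> measurable_fun setT b ->
  measurable_fun setT (fun x => P (a x) (b x)) /\ measurable_fun setT (fun x => Q (a x) (b x)).
Proof. by move=> ma mb; split; apply: measurable_funM => //; exact: meas_expfac. Qed.

Definition repr (u u' : X) (A B : R -> R) :=
  [/\ sobolev_rep A (re u'), sobolev_rep B (im u'), re u = A %[ae mu] & im u = B %[ae mu]].

Lemma repr_exists (u u' : X) : pairing u u' -> exists A B, repr u u' A B.
Proof.
move=> [[s1 s2] [s1' s2'] /wdP[d1 d2]].
have [A [pA eA]] := wd_prim s1.1 (sq_locint s1) (sq_locint s1') d1.
have [B [pB eB]] := wd_prim s2.1 (sq_locint s2) (sq_locint s2') d2.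
have mA : measurable_fun setT A by apply: continuous_measurable_fun; exact: prim_cont pA.
have mB : measurable_fun setT B by apply: continuous_measurable_fun; exact: prim_cont pB.
exists A, B; split => //; split => //; [exact: sq_ae mA eA s1|exact: sq_ae mB eB s2].
Qed.

Definition nonlinear_deriv (u' : X) (A B : R -> R) : X := fun x =>
  chain P1 P2 A (re u') B (im u') x +i* chain (fun p q => P2 q p) (fun p q => P1 q p) A (re u') B (im u') x.

Lemma pairing_nonlinear u u' A B : pairing u u' -> repr u u' A B ->
  pairing (fun x => f (u x)) (nonlinear_deriv u' A B).
Proof.
move=> [[s1 s2] _ _] [hA hB eA eB].
have P0 : P 0 0 = 0 by rewrite /P mulr0.
have Q0 : Q 0 0 = 0 by rewrite /Q mulr0.
have [p1 q1 r1_] := comp_rp CP P0 hA hB; have [p2 q2 r2] := comp_rp CQ Q0 hA hB.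
have [m1 m2] := meas_PQ s1.1 s2.1.
have e1 : (fun x => P (A x) (B x)) = (fun x => P (re u x) (im u x)) %[ae mu].
  by have := ae_and eA eB; apply: ae_imp => x [h1 h2] _; rewrite (h1 Logic.I) (h2 Logic.I).
have e2 : (fun x => Q (A x) (B x)) = (fun x => Q (re u x) (im u x)) %[ae mu].
  by have := ae_and eA eB; apply: ae_imp => x [h1 h2] _; rewrite (h1 Logic.I) (h2 Logic.I).
have [f1 f2] := fE u.
split.
- by split; rewrite ?f1 ?f2; [exact: sq_ae m1 e1 q1|exact: sq_ae m2 e2 q2].
- by split.
apply/wdP; rewrite f1 f2; split.
  apply: (@wd_ae R (fun x => P (A x) (B x)) _ (chain P1 P2 A (re u') B (im u'))) => //.
  - exact: q1.1.
  - exact: r1_.1.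
  - exact: r1_.1.
  - exact: ae_eq_refl.
  - exact: prim_wd.
apply: (@wd_ae R (fun x => Q (A x) (B x)) _ (chain (fun p q => P2 q p) (fun p q => P1 q p) A (re u') B (im u'))) => //.
- exact: q2.1.
- exact: r2.1.
- exact: r2.1.
- exact: ae_eq_refl.
- exact: prim_wd.
Qed.

Lemma n2_le_H1 (u u' : X) : pairing u u' -> (n2 (re u) <= H1norm u /\ n2 (re u') <= H1norm u) /\
  (n2 (im u) <= H1norm u /\ n2 (im u') <= H1norm u).
Proof.
move=> hu; rewrite (H1normE hu).
have [h1 h2] := pyth_ge (l2 u) (l2 u'); rewrite !ger0_norm ?l2_ge0// in h1 h2.
have k (v : X) : n2 (re v) <= l2 v /\ n2 (im v) <= l2 v.
  by have := pyth_ge (n2 (re v)) (n2 (im v)); rewrite !ger0_norm ?n2_ge0.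
have [a1 a2] := k u; have [b1 b2] := k u'.
by split; split; [exact: le_trans h1|exact: le_trans h2|exact: le_trans h1|exact: le_trans h2].
Qed.

(** The estimates hold for the continuous representatives and are carried back to [u] and [w] by
    almost everywhere equality. *)
Lemma H1_nonlinear : loclip (@H1 R) (@H1norm R) (fun u x => f (u x)).
Proof.
split=> [u /H1_pairing[u' hu]|M].
  have [A [B hAB]] := repr_exists hu.
  by apply/H1_pairing; exists (nonlinear_deriv u' A B); exact: pairing_nonlinear.
have [K1 [K10 HK1]] := comp_lip CP (normr_ge0 M).
have [K2 [K20 HK2]] := comp_lip CQ (normr_ge0 M).
exists (2 * K1 + 2 * K2 + 1); split; first by rewrite ltr_wpDl// addr_ge0// mulr_ge0.
move=> u w /H1_pairing[u' hu] /H1_pairing[w' hw] uM wM.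
have [A [B hAB]] := repr_exists hu; have [A1 [B1 hAB1]] := repr_exists hw.
have [[n1 n2_] [n3 n4]] := n2_le_H1 hu; have [[k1 k2] [k3 k4]] := n2_le_H1 hw.
have [[d1 d2] [d3 d4]] := n2_le_H1 (pairingB hu hw).
rewrite !reB !imB in d1 d2 d3 d4.
have [hA hB eA eB] := hAB; have [hA1 hB1 eA1 eB1] := hAB1.
have [[su1 su2] _ _] := hu; have [[sw1 sw2] _ _] := hw.
have mm (a a' : R -> R) : sobolev_rep a a' -> measurable_fun setT a by case=> _ [].
have mA := mm _ _ hA; have mB := mm _ _ hB; have mA1 := mm _ _ hA1; have mB1 := mm _ _ hB1.
set D := H1norm (u - w) in d1 d2 d3 d4 *.
have D0 : 0 <= D by exact: sqrtr_ge0.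
have sub_ae (a b a1 b1 : R -> R) : a = a1 %[ae mu] -> b = b1 %[ae mu] ->
    (fun x => a x - b x) = (fun x => a1 x - b1 x) %[ae mu].
  by move=> h1 h2; have := ae_and h1 h2; apply: ae_imp => x [g1 g2] _; rewrite (g1 Logic.I) (g2 Logic.I).
have eDA := n2_ae (measurable_funB su1.1 sw1.1) (measurable_funB mA mA1) (sub_ae _ _ _ _ eA eA1).
have eDB := n2_ae (measurable_funB su2.1 sw2.1) (measurable_funB mB mB1) (sub_ae _ _ _ _ eB eB1).
have eA_ := n2_ae su1.1 mA eA; have eB_ := n2_ae su2.1 mB eB.
have eA1_ := n2_ae sw1.1 mA1 eA1; have eB1_ := n2_ae sw2.1 mB1 eB1.
have MM := ler_norm M.
have H1' : [/\ sobolev_rep A (re u'), sobolev_rep B (im u'), sobolev_rep A1 (re w') & sobolev_rep B1 (im w')] by [].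
have H2 : (n2 A <= `|M| /\ n2 (re u') <= `|M|) /\ (n2 B <= `|M| /\ n2 (im u') <= `|M|).
  by rewrite -eA_ -eB_; repeat split; apply: le_trans MM; apply: le_trans uM.
have H3 : (n2 A1 <= `|M| /\ n2 (re w') <= `|M|) /\ (n2 B1 <= `|M| /\ n2 (im w') <= `|M|).
  by rewrite -eA1_ -eB1_; repeat split; apply: le_trans MM; apply: le_trans wM.
have H4 : (n2 (fun x => A x - A1 x) <= D /\ n2 (fun x => re u' x - re w' x) <= D) /\
  (n2 (fun x => B x - B1 x) <= D /\ n2 (fun x => im u' x - im w' x) <= D).
  by rewrite -eDA -eDB.
have [g1 g2] := HK1 _ _ _ _ _ _ _ _ D H1' H2 H3 H4.
have [g3 g4] := HK2 _ _ _ _ _ _ _ _ D H1' H2 H3 H4.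
have pf := pairing_nonlinear hu hAB; have pg := pairing_nonlinear hw hAB1.
rewrite (H1normE (pairingB pf pg)).
have [fu1 fu2] := fE u; have [fw1 fw2] := fE w.
have [mu1 mu2] := meas_PQ su1.1 su2.1; have [mw1 mw2] := meas_PQ sw1.1 sw2.1.
have le1 : l2 ((fun x => f (u x)) - (fun x => f (w x))) <= K1 * D + K2 * D.
  apply: le_trans (pyth_leD (n2_ge0 _) (n2_ge0 _)) _; rewrite reB imB fu1 fu2 fw1 fw2.
  apply: lerD.
    apply: le_trans g1; rewrite le_eqVlt; apply/orP; left; apply/eqP; apply: n2_ae.
    - exact: measurable_funB.
    - by apply: measurable_funB; apply: (locLip_meas (C1_lip CP)); eassumption.
    - apply: sub_ae.
        by have := ae_and eA eB; apply: ae_imp => x [h1 h2] _; rewrite (h1 Logic.I) (h2 Logic.I).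
      by have := ae_and eA1 eB1; apply: ae_imp => x [h1 h2] _; rewrite (h1 Logic.I) (h2 Logic.I).
  apply: le_trans g3; rewrite le_eqVlt; apply/orP; left; apply/eqP; apply: n2_ae.
  - exact: measurable_funB.
  - by apply: measurable_funB; apply: (locLip_meas (C1_lip CQ)); eassumption.
  - apply: sub_ae.
      by have := ae_and eA eB; apply: ae_imp => x [h1 h2] _; rewrite (h1 Logic.I) (h2 Logic.I).
    by have := ae_and eA1 eB1; apply: ae_imp => x [h1 h2] _; rewrite (h1 Logic.I) (h2 Logic.I).
have le2 : l2 (nonlinear_deriv u' A B - nonlinear_deriv w' A1 B1) <= K1 * D + K2 * D.
  apply: le_trans (pyth_leD (n2_ge0 _) (n2_ge0 _)) _; rewrite reB imB.
  exact: lerD g2 g4.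
apply: le_trans (pyth_leD (l2_ge0 _) (l2_ge0 _)) _; apply: le_trans (lerD le1 le2) _.
have -> : (2 * K1 + 2 * K2 + 1) * D = K1 * D + K2 * D + (K1 * D + K2 * D) + D by ring.
by rewrite lerDl.
Qed.

End Nonlinear.

(** * The Fourier transform and the free evolution *)

Section Fourier.
Context {R : realType}.
Local Notation mu := (@lebesgue_measure R).
Local Notation X := (R -> R[i]).
Implicit Types (a b A : R -> R) (u v w g : X) (s t : R).

Lemma pairing_ae u u' v v' : u = v %[ae mu] -> u' = v' %[ae mu] -> cl2 v -> cl2 v' ->
  pairing u u' -> pairing v v'.
Proof.
move=> e e' [t1 t2] [t1' t2'] [[s1 s2] [s1' s2'] /wdP[d1 d2]]; split => //; apply/wdP; split.
  by apply: wd_ae s1.1 t1.1 s1'.1 t1'.1 _ _ d1; [apply: ae_imp e|apply: ae_imp e'] => x h _; rewrite /re h.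
by apply: wd_ae s2.1 t2.1 s2'.1 t2'.1 _ _ d2; [apply: ae_imp e|apply: ae_imp e'] => x h _; rewrite /im h.
Qed.

Lemma ae_sym u v : u = v %[ae mu] -> v = u %[ae mu].
Proof. by apply: ae_imp => x p _; rewrite p. Qed.

Lemma ae_sub u v u' v' : u = u' %[ae mu] -> v = v' %[ae mu] -> (u - v) = (u' - v') %[ae mu].
Proof. by move=> h k; have := ae_and h k; apply: ae_imp => x [p q] _; rewrite !fctE p// q. Qed.

Definition trig_lim (tr : R -> R) a : R -> R := xget (fun=> 0) [set A | L2lim (trigN tr a) A].

Lemma TL_lim (tr : R -> R) a : costr tr -> sq a -> L2lim (trigN tr a) (trig_lim tr a).
Proof.
move=> ht sa; have [A lA] := trigN_exists ht sa.
by rewrite /trig_lim; case: xgetP => [B -> //|/(_ A)].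
Qed.

Lemma TL_sq tr a : costr tr -> sq a -> sq (trig_lim tr a).
Proof. by move=> ht sa; have [] := TL_lim ht sa. Qed.

Lemma TL_unique tr a A : costr tr -> sq a -> L2lim (trigN tr a) A -> trig_lim tr a = A %[ae mu].
Proof.
move=> ht sa lA; apply: (L2lim_unique _ (TL_lim ht sa) lA) => n; exact: trigN_sq.
Qed.

Lemma TL_bound tr a : costr tr -> sq a -> n2 (trig_lim tr a) <= CF * n2 a.
Proof.
move=> ht sa; apply: (L2lim_bound _ (TL_lim ht sa)) => n; [exact: trigN_sq|exact: trigN_le].
Qed.

Lemma TLB tr a b : costr tr -> sq a -> sq b ->
  trig_lim tr (fun x => a x - b x) = (fun x => trig_lim tr a x - trig_lim tr b x) %[ae mu].
Proof.
move=> ht sa sb; apply: TL_unique => //; first exact: sqB.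
have := L2limB (fun n => trigN_sq n ht sa) (fun n => trigN_sq n ht sb) (TL_lim ht sa) (TL_lim ht sb).
congr L2lim; apply/funext => n.
have -> : (fun x => a x - b x) = (fun x => a x + -1 * b x) by apply/funext => x; rewrite mulN1r.
rewrite trigN_D//; last exact: sqZ.
by rewrite trigN_Z//; apply/funext => x; rewrite mulN1r.
Qed.

Lemma TLN tr a : costr tr -> sq a -> trig_lim tr (fun x => - a x) = (fun x => - trig_lim tr a x) %[ae mu].
Proof.
move=> ht sa; apply: TL_unique => //; first exact: sqN.
have := L2limZ (-1) (fun n => trigN_sq n ht sa) (TL_lim ht sa).
have -> : (fun x => - a x) = (fun x => -1 * a x) by apply/funext => x; rewrite mulN1r.
have -> : (fun x => - trig_lim tr a x) = (fun x => -1 * trig_lim tr a x) by apply/funext => x; rewrite mulN1r.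
by congr L2lim; apply/funext => n; rewrite trigN_Z.
Qed.

Transparent trigT trigN.

(** An equality of functions, not only almost everywhere: the truncated integrals coincide at every
    frequency, so [xget] chooses from the same set. *)
Lemma TL_ae tr a b : costr tr -> sq a -> sq b -> a = b %[ae mu] -> trig_lim tr a = trig_lim tr b.
Proof.
move=> ht sa sb ab; rewrite /trig_lim; suff -> : trigN tr a = trigN tr b by [].
apply/funext => n; apply/funext => xi; rewrite /trigN /trigT.
have mm (c : R -> R) : sq c -> measurable_fun `[- n%:R : R, n%:R] (fun x : R => tr (x * xi) * c x).
  move=> sc; apply: (intg_meas (measurable_itv _)).
  by apply: trigT_intg; [exact: costr_trig|exact: sq_intg].
apply: ae_Rint (mm _ sa) (mm _ sb) _ => //.
by apply: ae_imp ab => x h _; rewrite h.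
Qed.

Definition kap : R := (Num.sqrt (2 * pi))^-1.

Lemma trunc_fourierE s n u : cl2 u -> s = 1 \/ s = -1 ->
  re (trunc_fourier s n u) = (fun xi => kap * (trigN cos (re u) n xi - s * trigN sin (im u) n xi)) /\
  im (trunc_fourier s n u) = (fun xi => kap * (trigN cos (im u) n xi + s * trigN sin (re u) n xi)).
Proof.
move=> [s1 s2] hs.
have cs (y : R) : cos (s * y) = cos y by case: hs => ->; rewrite ?mul1r// mulN1r cosN.
have sn (y : R) : sin (s * y) = s * sin y by case: hs => ->; rewrite ?mul1r// !mulN1r sinN.
have i1 tr a xi : costr tr -> sq a -> intg `[- n%:R, n%:R] (fun x => tr (x * xi) * a x).
  by move=> ht sa; apply: trigT_intg; [exact: costr_trig|exact: sq_intg].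
have ct : costr (@cos R) by left.
have st : costr (@sin R) by right.
split; apply/funext => xi; rewrite /re /im /trunc_fourier /cintegral.
  rewrite ReM /= mul0r subr0; congr (_ * _).
  rewrite /trigN /trigT -(RintZ _ (measurable_itv _) (i1 _ _ _ st s2)).
  rewrite -(RintB (measurable_itv _) (i1 _ _ _ ct s1) (intgZ s (measurable_itv _) (i1 _ _ _ st s2))).
  by apply: eq_Rintegral => x _; rewrite ReM /= -mulrA cs sn mulrA.
rewrite ImM /= mul0r addr0; congr (_ * _).
rewrite /trigN /trigT -(RintZ _ (measurable_itv _) (i1 _ _ _ st s1)).
rewrite -(RintD (measurable_itv _) (i1 _ _ _ ct s2) (intgZ s (measurable_itv _) (i1 _ _ _ st s1))).
by apply: eq_Rintegral => x _; rewrite ImM /= -mulrA cs sn mulrA.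
Qed.

Opaque trigT trigN.

Opaque trig_lim.

(* An explicit representative of the Fourier transform with sign [s]. *)
Definition fourier_rep s u : X := fun x =>
  (kap * (trig_lim cos (re u) x - s * trig_lim sin (im u) x)) +i* (kap * (trig_lim cos (im u) x + s * trig_lim sin (re u) x)).

Let ct : costr (@cos R). Proof. by left. Qed.
Let st : costr (@sin R). Proof. by right. Qed.

Lemma trunc_lim s u : cl2 u -> s = 1 \/ s = -1 ->
  (forall n, cl2 (trunc_fourier s n u)) /\
  L2lim (fun n => re (trunc_fourier s n u)) (re (fourier_rep s u)) /\
  L2lim (fun n => im (trunc_fourier s n u)) (im (fourier_rep s u)).
Proof.
move=> cu hs; have [s1 s2] := cu.
have q1 tr a n : costr tr -> sq a -> sq (trigN tr a n) by move=> *; exact: trigN_sq.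
have q2 tr a n : costr tr -> sq a -> sq (fun x => s * trigN tr a n x) by move=> *; apply: sqZ; exact: trigN_sq.
split; last split.
- move=> n; have [e1 e2] := trunc_fourierE n cu hs; split; rewrite ?e1 ?e2; apply: sqZ.
    by apply: sqB; [exact: q1|exact: q2].
  by apply: sqD; [exact: q1|exact: q2].
- have -> : (fun n => re (trunc_fourier s n u)) = fun n xi => kap * (trigN cos (re u) n xi - s * trigN sin (im u) n xi).
    by apply/funext => n; have [-> _] := trunc_fourierE n cu hs.
  apply: L2limZ; first by move=> n; apply: sqB; [exact: q1|exact: q2].
  apply: L2limB; [by move=> n; exact: q1|by move=> n; exact: q2|exact: TL_lim|].
  by apply: L2limZ; [by move=> n; exact: q1|exact: TL_lim].
- have -> : (fun n => im (trunc_fourier s n u)) = fun n xi => kap * (trigN cos (im u) n xi + s * trigN sin (re u) n xi).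
    by apply/funext => n; have [_ ->] := trunc_fourierE n cu hs.
  apply: L2limZ; first by move=> n; apply: sqD; [exact: q1|exact: q2].
  apply: L2limD; [by move=> n; exact: q1|by move=> n; exact: q2|exact: TL_lim|].
  by apply: L2limZ; [by move=> n; exact: q1|exact: TL_lim].
Qed.

Lemma FG_cl2 s u : cl2 u -> s = 1 \/ s = -1 -> cl2 (fourier_rep s u).
Proof. by move=> cu hs; have [_ [[h1 _] [h2 _]]] := trunc_lim cu hs. Qed.

Lemma is_fourier_FG s u : cl2 u -> s = 1 \/ s = -1 -> is_fourier s u (fourier_rep s u).
Proof.
move=> cu hs; have [ctr [[h1 c1] [h2 c2]]] := trunc_lim cu hs.
split; first exact/L2P/FG_cl2.
have -> : (fun n => L2norm (fun xi => trunc_fourier s n u xi - fourier_rep s u xi)) =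
    EFin \o (fun n => l2 (trunc_fourier s n u - fourier_rep s u)).
  by apply/funext => n; rewrite /= -L2normE//; apply: cl2B => //; exact: FG_cl2.
apply: cvg_EFin; first exact: nearW.
apply: cvg0_le (cvgD0 c1 c2) => n /=; rewrite l2_ge0/=.
by apply: le_trans (pyth_leD (n2_ge0 _) (n2_ge0 _)) _; rewrite reB imB.
Qed.

Lemma is_fourier_unique s u g : cl2 u -> s = 1 \/ s = -1 -> is_fourier s u g ->
  cl2 g /\ g = fourier_rep s u %[ae mu].
Proof.
move=> cu hs [/L2P cg].
have [ctr [l1 l2_]] := trunc_lim cu hs.
have -> : (fun n => L2norm (fun xi => trunc_fourier s n u xi - g xi)) =
    EFin \o (fun n => l2 (trunc_fourier s n u - g)).
  by apply/funext => n; rewrite /= -L2normE//; apply: cl2B.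
move=> /fine_cvg c; split=> //.
have m1 : L2lim (fun n => re (trunc_fourier s n u)) (re g).
  split; first by case: cg.
  apply: cvg0_le c => n; rewrite n2_ge0/= -reB -[leLHS]ger0_norm ?n2_ge0//; exact: (pyth_ge _ _).1.
have m2 : L2lim (fun n => im (trunc_fourier s n u)) (im g).
  split; first by case: cg.
  apply: cvg0_le c => n; rewrite n2_ge0/= -imB -[leLHS]ger0_norm ?n2_ge0//; exact: (pyth_ge _ _).2.
have k1 := L2lim_unique (fun n => (ctr n).1) m1 l1; have k2 := L2lim_unique (fun n => (ctr n).2) m2 l2_.
have := ae_and k1 k2; apply: ae_imp => x [h1 h2] _; move: (h1 Logic.I) (h2 Logic.I).
by rewrite /re /im; case: (g x) (fourier_rep s u x) => p q [p' q'] /= -> ->.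
Qed.

Lemma fourierP u : cl2 u -> cl2 (fourier u) /\ fourier u = fourier_rep (-1) u %[ae mu].
Proof.
move=> cu; have hs : (-1 : R) = 1 \/ (-1 : R) = -1 by right.
rewrite /fourier; case: xgetP => [g -> h|/(_ (fourier_rep (-1) u))]; first exact: is_fourier_unique.
by move=> /(_ (is_fourier_FG cu hs)).
Qed.

Lemma inv_fourierP u : cl2 u -> cl2 (inv_fourier u) /\ inv_fourier u = fourier_rep 1 u %[ae mu].
Proof.
move=> cu; have hs : (1 : R) = 1 \/ (1 : R) = -1 by left.
rewrite /inv_fourier; case: xgetP => [g -> h|/(_ (fourier_rep 1 u))]; first exact: is_fourier_unique.
by move=> /(_ (is_fourier_FG cu hs)).
Qed.

Lemma FG_ae s u v : cl2 u -> cl2 v -> u = v %[ae mu] -> fourier_rep s u = fourier_rep s v.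
Proof.
move=> [s1 s2] [t1 t2] uv.
have e1 : re u = re v %[ae mu] by apply: ae_imp uv => x h _; rewrite /re h.
have e2 : im u = im v %[ae mu] by apply: ae_imp uv => x h _; rewrite /im h.
by rewrite /fourier_rep (TL_ae ct s1 t1 e1) (TL_ae st s2 t2 e2) (TL_ae ct s2 t2 e2) (TL_ae st s1 t1 e1).
Qed.

Lemma FG_B s u v : cl2 u -> cl2 v -> fourier_rep s (u - v) = fourier_rep s u - fourier_rep s v %[ae mu].
Proof.
move=> [s1 s2] [t1 t2].
have k1 := ae_and (TLB ct s1 t1) (TLB st s2 t2); have k2 := ae_and (TLB ct s2 t2) (TLB st s1 t1).
have := ae_and k1 k2; apply: ae_imp => x [[h1 h2] [h3 h4]] _; rewrite !fctE /fourier_rep !reB !imB.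
rewrite (h1 Logic.I) (h2 Logic.I) (h3 Logic.I) (h4 Logic.I).
move: (trig_lim cos (re u) x) (trig_lim sin (im u) x) (trig_lim cos (im u) x) (trig_lim sin (re u) x) => a1 a2 a3 a4.
move: (trig_lim cos (re v) x) (trig_lim sin (im v) x) (trig_lim cos (im v) x) (trig_lim sin (re v) x) => b1 b2 b3 b4.
by apply/eqP; rewrite eq_complex /=; apply/andP; split; apply/eqP; move: kap => k; ring.
Qed.

(** The real and imaginary parts each combine two real transforms, and the norm is bounded by the
    sum over both parts, hence [4 = 2 * 2]. *)
Definition CKF : R := 4 * (kap * CF).

Lemma kap_ge0 : 0 <= kap. Proof. by rewrite invr_ge0 sqrtr_ge0. Qed.

Lemma CKF_ge0 : 0 <= CKF.
Proof. by rewrite !mulr_ge0 ?kap_ge0// sqrtr_ge0. Qed.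

Lemma n2_le_l2 u : n2 (re u) <= l2 u /\ n2 (im u) <= l2 u.
Proof. by have := pyth_ge (n2 (re u)) (n2 (im u)); rewrite !ger0_norm ?n2_ge0. Qed.

Lemma FG_bound s u : cl2 u -> s = 1 \/ s = -1 -> l2 (fourier_rep s u) <= CKF * l2 u.
Proof.
move=> [s1 s2] hs; have [b1 b2] := n2_le_l2 u.
have ns : `|s| = 1 by case: hs => ->; rewrite ?normrN normr1.
have k0 := kap_ge0; have C0 : 0 <= CF :> R by exact: sqrtr_ge0.
have key (f x1 x2 m1 m2 : R -> R) : sq m1 -> sq m2 -> sq x1 -> sq x2 ->
    n2 m1 <= CF * n2 x1 -> n2 m2 <= CF * n2 x2 -> n2 x1 <= l2 u -> n2 x2 <= l2 u -> measurable_fun setT f ->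
    (forall x, `|f x| <= kap * (`|m1 x| + `|m2 x|)) -> n2 f <= 2 * (kap * CF) * l2 u.
  move=> q1 q2 q3 q4 l1 l2_ l3 l4 mf le.
  have [|_ h] := @n2_dominated R f kap kap 0 0 m1 m2 m1 m1 mf q1 q2 q1 q1 k0 k0 (lexx 0) (lexx 0).
    by move=> x; rewrite !mul0r !addr0 -mulrDr.
  apply: le_trans h _; rewrite !mul0r !addr0 -mulrDr.
  have -> : 2 * (kap * CF) * l2 u = kap * (CF * l2 u + CF * l2 u) by ring.
  apply: ler_wpM2l => //; apply: lerD; [apply: le_trans l1 _|apply: le_trans l2_ _]; exact: ler_wpM2l.
have cF := FG_cl2 (conj s1 s2) hs.
apply: le_trans (pyth_leD (n2_ge0 _) (n2_ge0 _)) _.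
have -> : CKF * l2 u = 2 * (kap * CF) * l2 u + 2 * (kap * CF) * l2 u by rewrite /CKF; ring.
apply: lerD.
  apply: (key _ _ _ _ _ (TL_sq ct s1) (TL_sq st s2) s1 s2 (TL_bound ct s1) (TL_bound st s2) b1 b2 cF.1.1).
  move=> x; rewrite /re /= normrM (ger0_norm k0); apply: ler_wpM2l => //.
  by apply: le_trans (ler_normB _ _) _; rewrite normrM ns mul1r.
apply: (key _ _ _ _ _ (TL_sq ct s2) (TL_sq st s1) s2 s1 (TL_bound ct s2) (TL_bound st s1) b2 b1 cF.2.1).
move=> x; rewrite /im /= normrM (ger0_norm k0); apply: ler_wpM2l => //.
by apply: le_trans (ler_normD _ _) _; rewrite normrM ns mul1r.
Qed.

Definition ixi (U : X) : X := fun xi => (0 +i* xi) * U xi.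

(** The transform ignores null sets, so [u] may be replaced by its absolutely continuous
    representative, for which the boundary terms of the integration by parts vanish in the limit. *)
Lemma FG_deriv u u' : pairing u u' -> fourier_rep (-1) u' = ixi (fourier_rep (-1) u) %[ae mu].
Proof.
move=> [[s1 s2] [s1' s2'] /wdP[d1 d2]].
have mult tr tr' (k : R) a a' : costr tr -> costr tr' -> sq a -> sq a' -> wd a a' ->
    (forall A C' S, prim A a' -> sq A -> sq a' -> L2lim (trigN tr a') C' -> L2lim (trigN tr' A) S ->
      C' = (fun xi => k * xi * S xi) %[ae mu]) ->
    trig_lim tr a' = (fun xi => k * xi * trig_lim tr' a xi) %[ae mu].
  move=> h1 h2 sa sa' da hyp.
  have [A [pA eA]] := wd_prim sa.1 (sq_locint sa) (sq_locint sa') da.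
  have sA : sq A by apply: sq_ae eA sa; apply: continuous_measurable_fun; exact: prim_cont pA.
  rewrite (TL_ae h2 sa sA eA); apply: (hyp A) => //; exact: TL_lim.
have k1 := mult _ _ 1 _ _ ct st s1 s1' d1 (fun A C' S => @trig_deriv_cos R A _ C' S).
have k2 := mult _ _ 1 _ _ ct st s2 s2' d2 (fun A C' S => @trig_deriv_cos R A _ C' S).
have k3 := mult _ _ (-1) _ _ st ct s1 s1' d1 (fun A C' S p q r l1 l2 => @trig_deriv_sin R A _ S C' p q r l1 l2).
have k4 := mult _ _ (-1) _ _ st ct s2 s2' d2 (fun A C' S p q r l1 l2 => @trig_deriv_sin R A _ S C' p q r l1 l2).
have := ae_and (ae_and k1 k2) (ae_and k3 k4); apply: ae_imp => x [[h1 h2] [h3 h4]] _.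
rewrite /ixi /fourier_rep (h1 Logic.I) (h2 Logic.I) (h3 Logic.I) (h4 Logic.I).
move: (trig_lim cos (re u) x) (trig_lim sin (im u) x) (trig_lim cos (im u) x) (trig_lim sin (re u) x) => a1 a2 a3 a4.
by apply/eqP; rewrite eq_complex /=; apply/andP; split; apply/eqP; move: kap => k; ring.
Qed.

(** The counterpart on the frequency side. Square integrability of [xi U] is read off from [V], and
    the derivatives of the inverse transforms come from differentiating the truncated ones and
    passing to the limit. *)
Lemma FG_wd U V : cl2 U -> cl2 V -> V = ixi U %[ae mu] -> pairing (fourier_rep 1 U) (fourier_rep 1 V).
Proof.
move=> cU cV VU; have [s1 s2] := cU; have [t1 t2] := cV.
have hs : (1 : R) = 1 \/ (1 : R) = -1 by left.
split; [exact: FG_cl2|exact: FG_cl2|].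
pose xa x := x * re U x; pose xb x := x * im U x.
have mx a : sq a -> measurable_fun setT (fun x : R => x * a x).
  by move=> sa; apply: measurable_funM => //; exact: sa.1.
have e1 : im V = xa %[ae mu].
  by apply: ae_imp VU => x h _; rewrite /im h// /ixi ImM /= mul0r add0r.
have e2 : re V = (fun x => - xb x) %[ae mu].
  by apply: ae_imp VU => x h _; rewrite /re h// /ixi ReM /= mul0r sub0r.
have sxa : sq xa by apply: sq_ae (mx _ s1) e1 t2.
have sxb' : sq (fun x => - xb x).
  by apply: sq_ae e2 t1; apply: measurableT_comp => //; exact: mx.
have sxb : sq xb by have := sqN sxb'; congr sq; apply/funext => x; rewrite opprK.
have w1 := trig_wd_sin s1 sxa (TL_lim st s1) (TL_lim ct sxa).
have w2 := trig_wd_sin s2 sxb (TL_lim st s2) (TL_lim ct sxb).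
have w3 := trig_wd_cos s1 sxa (TL_lim ct s1) (TL_lim st sxa).
have w4 := trig_wd_cos s2 sxb (TL_lim ct s2) (TL_lim st sxb).
have q tr a : costr tr -> sq a -> sq (trig_lim tr a) by exact: TL_sq.
have qN tr a : costr tr -> sq a -> sq (fun x => - trig_lim tr a x) by move=> *; apply: sqN; exact: TL_sq.
have v1 := wd_lin (-1) (q _ _ ct s1) (qN _ _ st sxa) (q _ _ st s2) (q _ _ ct sxb) w3 w2.
have v2 := wd_lin 1 (q _ _ ct s2) (qN _ _ st sxb) (q _ _ st s1) (q _ _ ct sxa) w4 w1.
have scal (k : R) a a' : sq a -> sq a' -> wd a a' -> wd (fun x => k * a x) (fun x => k * a' x).
  move=> sa sa' da.
  have := wd_lin k sq0 sq0 sa sa' _ da.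
  have E (f : R -> R) : (fun x => 0 + k * f x) = (fun x => k * f x) by apply/funext => x; rewrite add0r.
  by rewrite !E; apply => phi _; rewrite !Rint_eq0 ?oppr0// => x; exact: mul0r.
have z1 := scal kap _ _ (sqD (q _ _ ct s1) (sqZ (-1) (q _ _ st s2)))
  (sqD (qN _ _ st sxa) (sqZ (-1) (q _ _ ct sxb))) v1.
have z2 := scal kap _ _ (sqD (q _ _ ct s2) (sqZ 1 (q _ _ st s1)))
  (sqD (qN _ _ st sxb) (sqZ 1 (q _ _ ct sxa))) v2.
have cFU := FG_cl2 cU hs; have cFV := FG_cl2 cV hs.
have fin (a a' b b' : R -> R) : sq a -> sq a' -> measurable_fun setT b' -> b = a ->
    a' = b' %[ae mu] -> wd a a' -> wd b b'.
  move=> h1 h2 m -> e; apply: wd_ae h1.1 h1.1 h2.1 m _ e; exact: ae_eq_refl.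
have y1 := sqZ kap (sqD (q _ _ ct s1) (sqZ (-1) (q _ _ st s2))).
have y2 := sqZ kap (sqD (qN _ _ st sxa) (sqZ (-1) (q _ _ ct sxb))).
have y3 := sqZ kap (sqD (q _ _ ct s2) (sqZ 1 (q _ _ st s1))).
have y4 := sqZ kap (sqD (qN _ _ st sxb) (sqZ 1 (q _ _ ct sxa))).
apply/wdP; split.
  apply: (fin _ _ _ _ y1 y2 cFV.1.1 _ _ z1).
    by apply/funext => x; rewrite /re /fourier_rep /= mul1r mulN1r.
  have := TLN ct sxb; apply: ae_imp => x h _.
  rewrite /re /fourier_rep /= (TL_ae ct t1 sxb' e2) (TL_ae st t2 sxa e1) (h Logic.I).
  by move: (trig_lim cos xb x) (trig_lim sin xa x) kap => p1 p2 k; ring.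
apply: (fin _ _ _ _ y3 y4 cFV.2.1 _ _ z2); first by [].
have := TLN st sxb; apply: ae_imp => x h _.
rewrite /im /fourier_rep /= (TL_ae st t1 sxb' e2) (TL_ae ct t2 sxa e1) (h Logic.I).
by move: (trig_lim sin xb x) (trig_lim cos xa x) kap => p1 p2 k; ring.
Qed.

End Fourier.

Opaque fourier_rep.

(** * The free evolution on L^2 and H^1 *)

Section Group.
Context {R : realType}.
Local Notation mu := (@lebesgue_measure R).
Local Notation X := (R -> R[i]).
Implicit Types (u v w U V : X) (s t : R).

Let h1 : (1 : R) = 1 \/ (1 : R) = -1. Proof. by left. Qed.
Let hm : (-1 : R) = 1 \/ (-1 : R) = -1. Proof. by right. Qed.

Definition multi t U : X := fun xi => expi (- (t * xi ^+ 2)) * U xi.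

Lemma re_multi t U : re (multi t U) = fun x => cos (- (t * x ^+ 2)) * re U x - sin (- (t * x ^+ 2)) * im U x.
Proof. by apply/funext => x; rewrite /re /multi ReM. Qed.
Lemma im_multi t U : im (multi t U) = fun x => cos (- (t * x ^+ 2)) * im U x + sin (- (t * x ^+ 2)) * re U x.
Proof. by apply/funext => x; rewrite /im /multi ImM. Qed.

Let meas_tr t (tr : R -> R) : trig tr -> measurable_fun setT (fun x : R => tr (- (t * x ^+ 2))).
Proof.
move=> [ct _]; apply: continuous_measurable_fun => x.
apply: (@continuous_comp _ _ _ (fun y : R => - (t * y ^+ 2)) tr); last exact: ct.
apply: continuousN; apply: continuousM; first exact: cvg_cst.
exact: exprn_continuous.
Qed.

(** A crude bound: both real and imaginary part of the product are estimated by the sum of the two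
    norms of [U], each at most [l2 U]. *)
Lemma multi_cl2 t U : cl2 U -> cl2 (multi t U) /\ l2 (multi t U) <= 4 * l2 U.
Proof.
move=> [s1 s2]; have [b1 b2] := n2_le_l2 U.
have [ct bt] := @trig_cos R; have [st bs] := @trig_sin R.
have mr : measurable_fun setT (re (multi t U)).
  rewrite re_multi; apply: measurable_funB; apply: measurable_funM; try exact: s1.1; try exact: s2.1.
    exact: meas_tr trig_cos.
  exact: meas_tr trig_sin.
have mi : measurable_fun setT (im (multi t U)).
  rewrite im_multi; apply: measurable_funD; apply: measurable_funM; try exact: s1.1; try exact: s2.1.
    exact: meas_tr trig_cos.
  exact: meas_tr trig_sin.
have [|q1 e1] := n2_dominated mr s1 s2 s1 s1 ler01 ler01 (lexx 0) (lexx 0).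
  move=> x; rewrite !mul0r !addr0 re_multi; apply: le_trans (ler_normB _ _) _.
  by rewrite !normrM; apply: lerD; apply: ler_wpM2r.
have [|q2 e2] := n2_dominated mi s2 s1 s1 s1 ler01 ler01 (lexx 0) (lexx 0).
  move=> x; rewrite !mul0r !addr0 im_multi; apply: le_trans (ler_normD _ _) _.
  by rewrite !normrM; apply: lerD; apply: ler_wpM2r.
split; first by split.
apply: le_trans (pyth_leD (n2_ge0 _) (n2_ge0 _)) _.
by move: (n2 _) (n2 _) (n2 _) (n2 _) (l2 U) b1 b2 e1 e2 => x1 x2 x3 x4 x5; lra.
Qed.

Lemma multiB t U V : multi t (U - V) = multi t U - multi t V.
Proof. by apply/funext => x; rewrite /multi !fctE mulrBr. Qed.

(** [schrodinger] passes through arbitrary choices of both transforms; this explicit function agrees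
    with it almost everywhere, and linearity and derivatives are studied here. *)
Definition evol t u : X := fourier_rep 1 (multi t (fourier_rep (-1) u)).

Lemma evol_cl2 t u : cl2 u -> cl2 (evol t u).
Proof.
move=> cu; apply: FG_cl2 => //; apply: (multi_cl2 _ _).1; exact: FG_cl2.
Qed.

Lemma schrodinger_ae t u : cl2 u -> cl2 (schrodinger t u) /\ schrodinger t u = evol t u %[ae mu].
Proof.
move=> cu; have [cf ef] := fourierP cu; have cF := FG_cl2 cu hm.
have [c1 _] := multi_cl2 t cf; have [c2 _] := multi_cl2 t cF.
have [ci ei] := inv_fourierP c1; split; first exact: ci.
have e : multi t (fourier u) = multi t (fourier_rep (-1) u) %[ae mu].
  by apply: ae_imp ef => x h _; rewrite /multi h.
by have E := FG_ae 1 c1 c2 e; rewrite /evol -E.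
Qed.

Definition CS : R := CKF * (4 * CKF).

Lemma CS_ge0 : 0 <= CS.
Proof. by apply: mulr_ge0; [|apply: mulr_ge0 => //]; exact: CKF_ge0. Qed.

Lemma evol_bound t u : cl2 u -> l2 (evol t u) <= CS * l2 u.
Proof.
move=> cu; have cF := FG_cl2 cu hm; have [cm bm] := multi_cl2 t cF.
apply: le_trans (FG_bound cm h1) _; rewrite /CS -mulrA; apply: ler_wpM2l; first exact: CKF_ge0.
apply: le_trans bm _; rewrite -mulrA; apply: ler_wpM2l => //; exact: FG_bound.
Qed.

Lemma evolB t u w : cl2 u -> cl2 w -> evol t (u - w) = evol t u - evol t w %[ae mu].
Proof.
move=> cu cw; have cF := FG_cl2 cu hm; have cG := FG_cl2 cw hm.
have [cm _] := multi_cl2 t cF; have [cn _] := multi_cl2 t cG.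
have [cd _] := multi_cl2 t (FG_cl2 (cl2B cu cw) hm).
have e : multi t (fourier_rep (-1) (u - w)) = multi t (fourier_rep (-1) u) - multi t (fourier_rep (-1) w) %[ae mu].
  by rewrite -multiB; apply: ae_imp (FG_B (-1) cu cw) => x h _; rewrite /multi h.
have E := FG_ae 1 cd (cl2B cm cn) e.
have := FG_B 1 cm cn; rewrite -E; exact.
Qed.

(** The multiplier commutes with multiplication by [i xi], which represents the derivative on both
    sides. *)
Lemma evol_pairing t u u' : pairing u u' -> pairing (evol t u) (evol t u').
Proof.
move=> hu; have [cu cu' _] := hu.
apply: FG_wd; [exact: (multi_cl2 _ (FG_cl2 cu hm)).1|exact: (multi_cl2 _ (FG_cl2 cu' hm)).1|].
by apply: ae_imp (FG_deriv hu) => x h _; rewrite /multi h// /ixi mulrCA.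
Qed.

(** Dominated convergence works along sequences, so a failure of continuity is turned into a
    sequence of times [sn n] tending to [t]. *)
Lemma multi_cont t U : cl2 U -> forall e, 0 < e -> exists2 d : R, 0 < d &
  forall s, `|s - t| < d -> l2 (multi s U - multi t U) < e.
Proof.
move=> cU e e0; have [s1 s2] := cU; apply: contrapT => hn.
have /choice[sn Hsn] (n : nat) : exists s, `|s - t| < n.+1%:R^-1 /\ e <= l2 (multi s U - multi t U).
  apply: contrapT => h; apply: hn; exists n.+1%:R^-1; first by rewrite invr_gt0.
  move=> s hs; rewrite ltNge; apply/negP => le; apply: h; by exists s.
have cs : sn n @[n --> \oo] --> t.
  apply/cvgrPdist_lt => d d0.
  have : (fun n : nat => n.+1%:R^-1 : R) @ \oo --> 0 by exact: cvg_harmonic.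
  move=> /cvgr0Pnorm_lt /(_ d d0) [n0 _ hn0]; exists n0 => // n /= nn; rewrite distrC.
  apply: lt_trans (Hsn n).1 _; have := hn0 n nn; rewrite /= ger0_norm// invr_ge0//.
have ctr (tr : R -> R) x : continuous tr -> tr (- (sn n * x ^+ 2)) - tr (- (t * x ^+ 2)) @[n --> \oo] --> 0.
  move=> c; rewrite -[X in _ --> X](subrr (tr (- (t * x ^+ 2)))); apply: cvgB; last exact: cvg_cst.
  have cc : (fun n => - (sn n * x ^+ 2)) @ \oo --> - (t * x ^+ 2).
    by apply: cvgN; apply: cvgM => //; exact: cvg_cst.
  exact: (cvg_comp _ _ cc (c _)).
have [ct bt] := @trig_cos R; have [st bs] := @trig_sin R.
pose g x := 2 * (`|re U x| + `|im U x|).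
have sg : sq g by apply: sqZ; apply: sqD; exact: sq_norm.
have bd (a b p q r w : R) : `|a| <= 1 -> `|b| <= 1 -> `|p| <= 1 -> `|q| <= 1 ->
    `|(a - b) * r| + `|(p - q) * w| <= 2 * (`|r| + `|w|).
  move=> ha hb hp hq; rewrite !normrM mulrDr; apply: lerD; apply: ler_wpM2r => //.
    by apply: le_trans (ler_normB _ _) _; rewrite -[2]/(1 + 1); exact: lerD.
  by apply: le_trans (ler_normB _ _) _; rewrite -[2]/(1 + 1); exact: lerD.
have cd n := cl2B (multi_cl2 (sn n) cU).1 (multi_cl2 t cU).1.
have reE n x : re (multi (sn n) U - multi t U) x =
   (cos (- (sn n * x ^+ 2)) - cos (- (t * x ^+ 2))) * re U x - (sin (- (sn n * x ^+ 2)) - sin (- (t * x ^+ 2))) * im U x.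
  by rewrite reB !re_multi; ring.
have imE n x : im (multi (sn n) U - multi t U) x =
   (cos (- (sn n * x ^+ 2)) - cos (- (t * x ^+ 2))) * im U x + (sin (- (sn n * x ^+ 2)) - sin (- (t * x ^+ 2))) * re U x.
  by rewrite imB !im_multi; ring.
have cvZ (p q : nat -> R) (y z : R) : p n @[n --> \oo] --> 0 -> q n @[n --> \oo] --> 0 ->
   p n * y + q n * z @[n --> \oo] --> 0.
  move=> hp hq; apply: cvgD0; [have := cvgM0 y hp|have := cvgM0 z hq].
    by have -> : (fun n => y * p n) = (fun n => p n * y) by apply/funext => n; rewrite mulrC.
  by have -> : (fun n => z * q n) = (fun n => q n * z) by apply/funext => n; rewrite mulrC.
have [|x||n x|_ k1] := @n2_dct R (fun n => re (multi (sn n) U - multi t U)) (fun=> 0) g.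
- by move=> n; exact: (cd n).1.
- have := cvZ _ _ (re U x) (- im U x) (ctr cos x ct) (ctr sin x st).
  have -> // : (fun n => (cos (- (sn n * x ^+ 2)) - cos (- (t * x ^+ 2))) * re U x +
    (sin (- (sn n * x ^+ 2)) - sin (- (t * x ^+ 2))) * - im U x) =
    (fun n => re (multi (sn n) U - multi t U) x).
  by apply/funext => n; rewrite reE mulrN.
- by [].
- by rewrite reE; apply: le_trans (ler_normB _ _) _; exact: bd.
have [|x||n x|_ k2] := @n2_dct R (fun n => im (multi (sn n) U - multi t U)) (fun=> 0) g.
- by move=> n; exact: (cd n).2.
- have := cvZ _ _ (im U x) (re U x) (ctr cos x ct) (ctr sin x st).
  have -> // : (fun n => (cos (- (sn n * x ^+ 2)) - cos (- (t * x ^+ 2))) * im U x +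
    (sin (- (sn n * x ^+ 2)) - sin (- (t * x ^+ 2))) * re U x) =
    (fun n => im (multi (sn n) U - multi t U) x).
  by apply/funext => n; rewrite imE.
- by [].
- rewrite imE /g [`|re U x| + _]addrC; apply: le_trans (ler_normD _ _) _; exact: bd.
have z (f : R -> R) : (fun x => f x - (fun=> 0) x) = f by apply/funext => x; rewrite subr0.
have : e <= 0.
  apply: (cvg0_ge (cvgD0 k1 k2)) => n; rewrite !z.
  by apply: le_trans (Hsn n).2 _; exact: pyth_leD (n2_ge0 _) (n2_ge0 _).
by rewrite leNgt e0.
Qed.

Lemma evol_cont t u : cl2 u -> forall e, 0 < e -> exists2 d : R, 0 < d &
  forall s, `|s - t| < d -> l2 (evol s u - evol t u) < e.
Proof.
move=> cu e e0; have cF := FG_cl2 cu hm.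
have C1 : 0 < CKF + 1 :> R by rewrite ltr_wpDl// CKF_ge0.
have e1 : 0 < e / (CKF + 1) by rewrite divr_gt0.
have [d d0 Hd] := multi_cont t cF e1; exists d => // s st.
have cs := (multi_cl2 s cF).1; have ct := (multi_cl2 t cF).1.
have -> : l2 (evol s u - evol t u) = l2 (fourier_rep 1 (multi s (fourier_rep (-1) u) - multi t (fourier_rep (-1) u))).
  apply: l2_ae; [by apply: cl2B; exact: evol_cl2|by apply: FG_cl2 => //; exact: cl2B|].
  by apply: ae_sym; exact: FG_B.
apply: le_lt_trans (FG_bound (cl2B cs ct) h1) _.
apply: le_lt_trans (_ : (CKF + 1) * l2 (multi s (fourier_rep (-1) u) - multi t (fourier_rep (-1) u)) < _).
  by apply: ler_wpM2r; rewrite ?l2_ge0// lerDl.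
by rewrite mulrC -ltr_pdivlMr//; exact: Hd.
Qed.

Lemma schrodinger_pairing t u u' : pairing u u' -> pairing (schrodinger t u) (evol t u').
Proof.
move=> hu; have [cu cu' _] := hu; have [cs es] := schrodinger_ae t cu.
have er : evol t u' = evol t u' %[ae mu] by exact: ae_eq_refl.
exact: (pairing_ae (ae_sym es) er cs (evol_cl2 t cu') (evol_pairing t hu)).
Qed.

Lemma l2_schrodinger_sub s t u w : cl2 u -> cl2 w ->
  l2 (schrodinger s u - schrodinger t w) = l2 (evol s u - evol t w).
Proof.
move=> cu cw; have [cs es] := schrodinger_ae s cu; have [ct et] := schrodinger_ae t cw.
apply: l2_ae; [exact: cl2B|by apply: cl2B; exact: evol_cl2|exact: ae_sub].
Qed.

Lemma H1_propagator : propagator (@H1 R) (@H1norm R) schrodinger (CS + 1).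
Proof.
have C0 : 0 <= CS + 1 :> R by rewrite addr_ge0// CS_ge0.
have up (x y z w : R) : 0 <= x -> 0 <= z -> x <= CS * y -> z <= CS * w -> 0 <= y -> 0 <= w ->
    pyth x z <= (CS + 1) * pyth y w.
  move=> x0 z0 xy zw y0 w0; rewrite -[X in X * _](ger0_norm C0) -pythZ; apply: pyth_le.
    by rewrite x0 (le_trans xy)// ler_wpM2r// lerDl.
  by rewrite z0 (le_trans zw)// ler_wpM2r// lerDl.
split.
- by rewrite lerDr CS_ge0.
- by move=> t u /H1_pairing[u' hu]; apply/H1_pairing; exists (evol t u'); exact: schrodinger_pairing.
- move=> t u w /H1_pairing[u' hu] /H1_pairing[w' hw].
  have [cu cu' _] := hu; have [cw cw' _] := hw.
  rewrite (H1normE (pairingB (schrodinger_pairing t hu) (schrodinger_pairing t hw))) (H1normE (pairingB hu hw)).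
  have lip a b : cl2 a -> cl2 b -> l2 (evol t a - evol t b) <= CS * l2 (a - b).
    move=> ca cb; apply: le_trans (evol_bound t (cl2B ca cb)).
    rewrite le_eqVlt; apply/orP; left; apply/eqP; apply: l2_ae.
    + by apply: cl2B; exact: evol_cl2.
    + by apply: evol_cl2; exact: cl2B.
    + by apply: ae_sym; exact: evolB.
  by apply: up; rewrite ?l2_ge0// ?l2_schrodinger_sub//; exact: lip.
- move=> t u /H1_pairing[u' hu]; have [cu cu' _] := hu.
  rewrite (H1normE (schrodinger_pairing t hu)) (H1normE hu).
  have [cs es] := schrodinger_ae t cu.
  apply: up; rewrite ?l2_ge0//; last exact: evol_bound.
  by rewrite (l2_ae cs (evol_cl2 t cu) es); exact: evol_bound.
- move=> t u /H1_pairing[u' hu] e e0; have [cu cu' _] := hu.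
  have e2 : 0 < e / 2 by rewrite divr_gt0.
  have [d1 d10 k1] := evol_cont t cu e2; have [d2 d20 k2] := evol_cont t cu' e2.
  exists (Num.min d1 d2); first by rewrite lt_min d10.
  move=> s; rewrite lt_min => /andP[s1 s2].
  rewrite (H1normE (pairingB (schrodinger_pairing s hu) (schrodinger_pairing t hu))).
  apply: le_lt_trans (pyth_leD (l2_ge0 _) (l2_ge0 _)) _.
  by rewrite [e]splitr l2_schrodinger_sub//; apply: ltrD; [exact: k1|exact: k2].
Qed.

Lemma H1_isom : isom (@H1 R) (@H1norm R) Ji.
Proof.
split.
- by move=> u /H1_pairing[u' hu]; apply/H1_pairing; exists (Ji u'); exact: pairing_Ji.
- by move=> u w; apply/funext => x; rewrite /Ji !fctE mulrBr.
- by move=> u /H1_pairing[u' hu]; rewrite (H1normE hu) (H1normE (pairing_Ji hu)) !l2_Ji.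
Qed.

End Group.

(** * Well-posedness *)

Transparent n2 trigT trigN bump Rintegral trig_lim fourier_rep.

Section Assembly.
Context {R : realType}.
Local Notation X := (R -> R[i]).
Variables (f : R[i] -> R[i]) (C : R).
Let F (u : X) : X := fun x => f (u x).
Hypothesis HF : loclip (@H1 R) (@H1norm R) F.
Hypothesis HS : propagator (@H1 R) (@H1norm R) schrodinger C.

Let sn := @H1_seminormed R.
Let HJi := @H1_isom R.
Local Notation N := (@H1norm R).
Local Notation solution := (sol (@H1 R) N schrodinger F (@Ji R)).

Lemma C_H1_good T (v : R -> X) : C_H1 T v <-> good (@H1 R) N v T.
Proof.
split=> -[hv cv]; split.
- by move=> t tT; apply: hv; rewrite in_itv.
- move=> t tT e e0.
  have tT' : t \in `[- T, T] by rewrite in_itv.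
  have /cvgr0Pnorm_lt /(_ e e0) := cv t tT'.
  move=> /nbhs_ballP[d /= d0 Hd]; exists d => // s sT st.
  apply: le_lt_trans (ler_norm _) _; apply: Hd; last by rewrite /= in_itv.
  by rewrite /ball /= distrC.
- by move=> t; rewrite in_itv /= => tT; exact: hv.
- move=> t; rewrite in_itv /= => tT; apply/cvgr0Pnorm_lt => e e0.
  have [d d0 Hd] := cv t tT e e0; apply/nbhs_ballP; exists d => // s /= st; rewrite in_itv /= => sT.
  rewrite ger0_norm ?(sn_N0 sn)//; apply: Hd => //.
  by move: st; rewrite /ball /= distrC.
Qed.

Lemma good_sub (v : R -> X) t T : 0 < T -> - T <= t <= T -> good (@H1 R) N v T -> forall a b, - T <= a -> b <= T ->
  Hon (@H1 R) (duh schrodinger F v t) a b.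
Proof.
move=> T0 tT gv a b aT bT tau /andP[at_ tb]; have [hd _] := duh_good sn HS HF t gv.
by apply: hd; rewrite (le_trans aT at_) (le_trans tb bT).
Qed.

(** On one side stands a Riemann integral from 0 to [t], on the other an antiderivative on all of
    [[-T, T]]; [mv_RInt] and [mv_RInt_unique] translate. For [t < 0] the integral is minus the one
    over [[t, 0]], which matches [J t - J 0] up to the order of the endpoints. *)
Lemma duhamel_sol w T v : H1 w -> 0 < T -> duhamel_solution f w T v <-> solution w T v.
Proof.
move=> hw T0.
have zT : - T <= 0 <= T by apply/andP; split; lra.
have /andP[z1 z2] := zT.
have hT : - T < T by lra.
split=> [[/C_H1_good gv sv]|[gv sv]]; (split; first by [exact/C_H1_good|exact gv]).
  move=> t tT; have [hd cd] := duh_good sn HS HF t gv.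
  have /andP[t1 t2] := tT.
  have [J hJ] := antiderivative_exists sn hT hd cd.
  exists J; split => //.
  have tT' : t \in `[- T, T] by rewrite in_itv.
  have [J0 [hI eI]] := sv t tT'.
  have j0 := hJ.1 0 zT; have jt := hJ.1 t tT.
  have [hH eN] : H1 J0 /\ N (J0 - (J t - J 0)) = 0.
    move: hI; rewrite /is_H1_integral; have [t0|t0] := leP 0 t => hI.
      have hI' : RInt (@H1 R) N (duh schrodinger F v t) 0 t J0 := hI.
      split; first by case: hI'.
      exact: (mv_RInt_unique sn t0 (mv_sub z1 t2 hJ) hI').
    have hI' : RInt (@H1 R) N (duh schrodinger F v t) t 0 (- J0) := hI.
    have hN : H1 (- J0) by case: hI'.
    have hH : H1 J0 by rewrite -[J0]opprK; exact: (snN sn).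
    split => //; have h := mv_RInt_unique sn (ltW t0) (mv_sub t1 z2 hJ) hI'.
    have E : - (J0 - (J t - J 0)) = - J0 - (J 0 - J t) by rewrite opprD !opprB.
    by rewrite -(NN sn (snB sn hH (snB sn jt j0))) E.
  have hv := gv.1 t tT; have hs := pr_H HS t hw.
  have hJJ := snB sn jt j0.
  have hA : H1 (schrodinger t w + Ji J0) by apply: (sn_D sn) => //; exact: (is_H HJi).
  have hB : H1 (schrodinger t w + Ji (J t - J 0)) by apply: (sn_D sn) => //; exact: (is_H HJi).
  have e1 : N (v t - (schrodinger t w + Ji J0)) = 0 by apply/(aeeq_H1 hv hA); exact: eI.
  apply/eqP; rewrite eq_le (sn_N0 sn) andbT.
  apply: le_trans (NtriB sn hv hA hB) _; rewrite e1 add0r.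
  have -> : schrodinger t w + Ji J0 - (schrodinger t w + Ji (J t - J 0)) = Ji (J0 - (J t - J 0)).
    rewrite (is_B HJi J0 (J t - J 0)); move: (schrodinger t w) (Ji J0) (Ji (J t - J 0)) => a b c.
    by apply/funext => x; rewrite !fctE; ring.
  by rewrite (is_N HJi) ?eN//; exact: (snB sn).
move=> t; rewrite in_itv /= => tT; have [J [hJ eN]] := sv t tT.
have /andP[t1 t2] := tT.
have j0 := hJ.1 0 zT; have jt := hJ.1 t tT; have hJJ := snB sn jt j0.
exists (J t - J 0); split.
  rewrite /is_H1_integral; have [t0|t0] := leP 0 t.
    exact: (mv_RInt sn t0 (good_sub T0 tT gv z1 t2) (mv_sub z1 t2 hJ)).
  have := mv_RInt sn (ltW t0) (good_sub T0 tT gv t1 z2) (mv_sub t1 z2 hJ).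
  by rewrite -(opprB (J t) (J 0)).
have hv := gv.1 t tT; have hs := pr_H HS t hw.
have hB : H1 (schrodinger t w + Ji (J t - J 0)) by apply: (sn_D sn) => //; exact: (is_H HJi).
by apply/(aeeq_H1 hv hB).
Qed.

Lemma solution_unique w T v v' : H1 w -> 0 < T -> solution w T v -> solution w T v' ->
  forall t : R, - T <= t <= T -> N (v' t - v t) = 0.
Proof.
move=> hw T0 sv sv' t tT.
have [M1 h1] := contOn_bounded sn sv.1.1 sv.1.2; have [M2 h2] := contOn_bounded sn sv'.1.1 sv'.1.2.
have [L [L0 HL]] := sol_dependence sn HS HF HJi (Num.max M1 M2).
have b1 (s : R) : - T <= s <= T -> N (v s) <= Num.max M1 M2 by move=> /h1 h; rewrite le_max h.
have b2 (s : R) : - T <= s <= T -> N (v' s) <= Num.max M1 M2 by move=> /h2 h; rewrite le_max h orbT.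
have := HL w w T v' v T0 hw hw sv' sv b2 b1 t tT.
rewrite subrr (N00 sn) mulr0 mul0r => le0.
by apply/eqP; rewrite eq_le le0 (sn_N0 sn).
Qed.

Theorem well_posed : locally_well_posed_H1 f.
Proof.
(* The first half of well-posedness is the second half evaluated at the datum [v0]. *)
move=> v0 hv0; suff second : exists T : R, 0 < T /\ exists V, H1_neighborhood v0 V /\
    exists Phi : (R -> R[i]) -> R -> R -> R[i],
      (forall w, V w -> unique_duhamel_solution f w T (Phi w)) /\ continuous_into_C_H1 V T Phi.
  split => //; have [T [T0 [V [[_ [rho rho0 HV]] [Phi [HPhi _]]]]]] := second.
  exists T; split => //; exists (Phi v0); apply: HPhi; apply: HV => //.
  rewrite (_ : H1dist v0 v0 = N (v0 - v0))// subrr (N00 sn)//.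
have m0 : 0 < N v0 + 1 by rewrite ltr_wpDl// (sn_N0 sn).
(* The size [N v0 + 1] lets one time [T] and one bound [M] serve every datum in the unit ball around
   [v0]. *)
have [T [M [T0 HT]]] := local_existence sn HS HF HJi m0.
pose V w := H1 w /\ N (w - v0) < 1.
have Vm w : V w -> H1 w /\ N w <= N v0 + 1.
  by move=> [hw wv]; split => //; apply: le_trans (NleB sn hw hv0) _; rewrite lerD2l ltW.
have /choice[Phi HPhi] w : exists v, V w -> solution w T v /\ forall t : R, - T <= t <= T -> N (v t) <= M.
  have [Vw|nV] := EM (V w); last by exists (fun=> 0).
  by have [hw wm] := Vm w Vw; have [v hv] := HT w hw wm; exists v.
exists T; split => //; exists V; split; first split.
- by move=> w [].
- by exists 1.
exists Phi; split.
  move=> w Vw; have [hw _] := Vm w Vw; have [sv _] := HPhi w Vw; split; first exact/duhamel_sol.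
  move=> v' /(duhamel_sol _ hw T0) sv' t; rewrite in_itv /= => tT.
  by apply/(aeeq_H1 (sv'.1.1 t tT) (sv.1.1 t tT)); exact: (solution_unique hw T0 sv sv').
move=> w Vw eps eps0; have [hw _] := Vm w Vw; have [sv bv] := HPhi w Vw.
have [L [L0 HL]] := sol_dependence sn HS HF HJi M.
have C0 : 0 <= C by apply: le_trans (pr_C HS).
pose K := 2 * C * expR (L * T) + 1.
have K0 : 0 < K by rewrite ltr_wpDl// mulr_ge0 ?expR_ge0// mulr_ge0.
exists (eps / K); first by rewrite divr_gt0.
move=> w' Vw' ww t; rewrite in_itv /= => tT.
have [hw' _] := Vm w' Vw'; have [sv' bv'] := HPhi w' Vw'.
have ww' : N (w' - w) < eps / K := ww.
apply: le_lt_trans (HL w' w T _ _ T0 hw' hw sv' sv bv' bv t tT) _.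
rewrite mulrAC; apply: le_lt_trans (_ : K * N (w' - w) < _).
  by apply: ler_wpM2r; rewrite ?(sn_N0 sn)// lerDl.
by rewrite mulrC -ltr_pdivlMr.
Qed.

End Assembly.

Theorem corollary1p14 (R : realType) (r c : R) (hr : 1 <= r) (hc : c != 0) :
  locally_well_posed_H1 (exp_nonlinearity c r).
Proof. exact: (well_posed (H1_nonlinear c hr) (@H1_propagator R)). Qed.
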